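(* There exists a polynomial-time algorithm that, given a permutation $\pi\in S_n$, determines whether $\pi$ is perfect (i.e. whether some perfect tangle solves $\pi$), and, if so, outputs a perfect tangle solving $\pi$.
   Context: $S_n$ is the set of permutations $\pi=[\pi(1),\dots,\pi(n)]$ of $\{1,\dots,n\}$, $\pi(p)$ being the element at position $p$. For $1\le i<n$, the swap $\sigma(i)$ transforms $\pi$ into $\pi\cdot\sigma(i)$ by exchanging the elements in positions $i$ and $i+1$. Two permutations are adjacent if one is obtained from the other by swaps $\sigma(p_1),\dots,\sigma(p_k)$ ($k\ge0$) with $|p_i-p_j|\ge2$ for $i\neq j$. A tangle is a finite sequence $\pi_0,\dots,\pi_m$ of permutations with consecutive ones adjacent; it solves $\pi$ if $\pi_0=\pi$ and $\pi_m$ is the identity (by convention $\pi_0=\pi_1$ and $\pi_{m-1}=\pi_m$). In its drawing, element $x$ at time $t$ is placed at $(p,-t)$ where $\pi_t(p)=x$, and path $x$ is the polyline through these points, $t=0,\dots,m$. A segment is a maximal straight piece of a path; a non-vertical segment is an L-segment if, traversed downward, it moves left (oriented north-east to south-west), and an R-segment if it moves right (north-west to south-east). An inversion of $\pi$ is a pair $(a,b)$ with $a>b$ and $a$ at an earlier position than $b$. A tangle solving $\pi$ is simple if it has the minimum number of path crossings among all tangles solving $\pi$ (equivalently, no two paths cross more than once). A tangle is perfect if it is simple and each path has at most one L-segment and at most one R-segment. *)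

(* Defs.v *)
From mathcomp Require Import all_boot all_order all_algebra all_fingroup.

Set Implicit Arguments.
Unset Strict Implicit.
Unset Printing Implicit Defensive.

Import Order.TTheory GRing.Theory Num.Theory.

(** * Tangles

    Positions, elements and swap indices are numbered from 0.  A permutation
    [pi : 'S_n] is read as the word [pi 0, pi 1, ...]: [pi p] is the element at
    position [p]. *)

Lemma swap_index_subproof n (i : 'I_n.-1) : i.+1 < n.
Proof. by case: n i => [[]|n i] //=; rewrite ltnS ltn_ord. Qed.

Definition left_pos n (i : 'I_n.-1) : 'I_n := widen_ord (leq_pred n) i.
Definition right_pos n (i : 'I_n.-1) : 'I_n := Ordinal (swap_index_subproof i).

(** The product of [perm] applies its left factor first, so that this maps the
    position [p] to [pi (tperm i i.+1 p)]. *)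
Definition swap n (pi : 'S_n) (i : 'I_n.-1) : 'S_n :=
  (tperm (left_pos i) (right_pos i) * pi)%g.

Definition apart n (i j : 'I_n.-1) : bool := (i.+2 <= j) || (j.+2 <= i).

Definition obtained_by_swaps n (pi rho : 'S_n) : Prop :=
  exists2 s : seq 'I_n.-1, pairwise (@apart n) s & rho = foldl (@swap n) pi s.

Definition adjacent n (pi rho : 'S_n) : Prop :=
  obtained_by_swaps pi rho \/ obtained_by_swaps rho pi.

(** The number [m] of steps of the sequence [pi_0, ..., pi_m]. *)
Definition duration n (T : seq 'S_n) : nat := (size T).-1.

Definition at_time n (T : seq 'S_n) (t : nat) : 'S_n := nth 1%g T t.

Definition tangle n (T : seq 'S_n) : Prop :=
  0 < size T /\
  forall t, t < duration T -> adjacent (at_time T t) (at_time T t.+1).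

(** The last three conditions are the convention that a tangle starts and ends
    with a repeated permutation. *)
Definition solves n (pi : 'S_n) (T : seq 'S_n) : Prop :=
  [/\ tangle T,
      at_time T 0 = pi /\ at_time T (duration T) = 1%g,
      0 < duration T,
      at_time T 0 = at_time T 1 &
      at_time T (duration T).-1 = at_time T (duration T)].

(** At time [t] the path of [x] passes through the point
    [(position T x t, - t)]. *)
Definition position n (T : seq 'S_n) (x : 'I_n) (t : nat) : 'I_n :=
  ((at_time T t)^-1)%g x.

Definition step n (T : seq 'S_n) (x : 'I_n) (t : nat) : int :=
  ((position T x t.+1)%:Z - (position T x t)%:Z)%R.

(** The part of the path of [x] between times [s] and [e] is a straight piece;
    the corners of a path are at integer times. *)
Definition straight n (T : seq 'S_n) (x : 'I_n) (s e : nat) : Prop :=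
  s < e <= duration T /\ forall t, s <= t < e -> step T x t = step T x s.

Definition segment n (T : seq 'S_n) (x : 'I_n) (s e : nat) : Prop :=
  straight T x s e /\
  forall s' e', straight T x s' e' -> s' <= s -> e <= e' ->
    s' = s /\ e' = e.

Definition L_segment n (T : seq 'S_n) (x : 'I_n) (s e : nat) : Prop :=
  segment T x s e /\ (step T x s < 0)%R.

Definition R_segment n (T : seq 'S_n) (x : 'I_n) (s e : nat) : Prop :=
  segment T x s e /\ (0 < step T x s)%R.

Definition at_most_one (P : nat -> nat -> Prop) : Prop :=
  forall s e s' e', P s e -> P s' e' -> s = s' /\ e = e'.

(** The path of [x] passes from the left of the path of [y] to its right between
    times [t] and [t.+1]. *)
Definition crosses_at n (T : seq 'S_n) (x y : 'I_n) (t : nat) : bool :=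
  (position T x t < position T y t) && (position T y t.+1 < position T x t.+1).

(** Each crossing is counted once, at the pair whose first path comes from the
    left. *)
Definition crossings n (T : seq 'S_n) : nat :=
  \sum_(t < duration T) #|[set xy : 'I_n * 'I_n | crosses_at T xy.1 xy.2 t]|.

Definition simple_tangle n (pi : 'S_n) (T : seq 'S_n) : Prop :=
  solves pi T /\ forall T', solves pi T' -> crossings T <= crossings T'.

Definition perfect_tangle n (pi : 'S_n) (T : seq 'S_n) : Prop :=
  simple_tangle pi T /\
  forall x : 'I_n, at_most_one (L_segment T x) /\ at_most_one (R_segment T x).

Definition perfect n (pi : 'S_n) : Prop :=
  exists T : seq 'S_n, perfect_tangle pi T.

(** * Algorithms and their running time

    An algorithm is a program of a first-order call-by-value functional language
    whose data are natural numbers and pairs.  Variables are de Bruijn indices;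
    functions are unary and named by their index in the program, and function 0
    is the entry point.  The running time is the number of rules in the
    evaluation, every operation costing 1.

    Up to a polynomial this is time on a Turing machine: pairs are stored as
    pointers to shared cells, an environment has length bounded by the size of
    the program, and since the only arithmetic is addition and truncated
    subtraction, numbers gain at most one bit per operation.  (A unit-cost
    multiplication would break this.) *)

Inductive value : Type :=
| VNum of nat
| VPair of value & value.

Inductive expr : Type :=
| EVar of nat
| ENum of nat
| EAdd of expr & expr
| ESub of expr & expr
| EIf of expr & expr & expr   (* nonzero test *)
| EPair of expr & expr
| ECase of expr & expr & expr (* number: binds it; pair: binds both sides *)
| ELet of expr & expr
| ECall of nat & expr.

Definition program := seq expr.

(** [eval p env e v t]: under [env], [e] evaluates to [v] in time [t].  An
    ill-typed operation or an unbound name has no evaluation. *)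
Inductive eval (p : program) : seq value -> expr -> value -> nat -> Prop :=
| eval_Var env i : i < size env ->
    eval p env (EVar i) (nth (VNum 0) env i) 1
| eval_Num env k :
    eval p env (ENum k) (VNum k) 1
| eval_Add env e1 e2 k1 k2 t1 t2 :
    eval p env e1 (VNum k1) t1 -> eval p env e2 (VNum k2) t2 ->
    eval p env (EAdd e1 e2) (VNum (k1 + k2)) (t1 + t2).+1
| eval_Sub env e1 e2 k1 k2 t1 t2 :
    eval p env e1 (VNum k1) t1 -> eval p env e2 (VNum k2) t2 ->
    eval p env (ESub e1 e2) (VNum (k1 - k2)) (t1 + t2).+1
| eval_If env e e1 e2 k v t t' :
    eval p env e (VNum k) t -> eval p env (if k != 0 then e1 else e2) v t' ->
    eval p env (EIf e e1 e2) v (t + t').+1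
| eval_Pair env e1 e2 v1 v2 t1 t2 :
    eval p env e1 v1 t1 -> eval p env e2 v2 t2 ->
    eval p env (EPair e1 e2) (VPair v1 v2) (t1 + t2).+1
| eval_CaseNum env e e1 e2 k v t t' :
    eval p env e (VNum k) t -> eval p (VNum k :: env) e1 v t' ->
    eval p env (ECase e e1 e2) v (t + t').+1
| eval_CasePair env e e1 e2 v1 v2 v t t' :
    eval p env e (VPair v1 v2) t -> eval p (v1 :: v2 :: env) e2 v t' ->
    eval p env (ECase e e1 e2) v (t + t').+1
| eval_Let env e1 e2 v1 v t t' :
    eval p env e1 v1 t -> eval p (v1 :: env) e2 v t' ->
    eval p env (ELet e1 e2) v (t + t').+1
| eval_Call env f e v1 v t t' :
    f < size p ->
    eval p env e v1 t -> eval p [:: v1] (nth (ENum 0) p f) v t' ->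
    eval p env (ECall f e) v (t + t').+1.

Lemma eval_functional p env e v t v' t' :
  eval p env e v t -> eval p env e v' t' -> v = v' /\ t = t'.
Proof.
move=> ev; elim: ev v' t' => {env e v t};
  intros; match goal with H : eval _ _ _ _ _ |- _ => inversion H; subst; clear H
  end;
  repeat match goal with
  | IH : forall v t, eval _ ?env ?e v t -> _, H : eval _ ?env ?e _ _ |- _ =>
      have [] := IH _ _ H; clear IH H; (try discriminate);
      intros E ?; (try injection E as ?); subst
  end; by [].
Qed.

Definition runs (p : program) (input output : value) (t : nat) : Prop :=
  eval p [:: input] (ECall 0 (EVar 0)) output t.

(** Data are encoded LISP-style. *)
Definition enc_seq (s : seq value) : value := foldr VPair (VNum 0) s.

Definition enc_perm n (pi : 'S_n) : value :=
  enc_seq [seq VNum (pi p) | p <- enum 'I_n].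

Definition enc_tangle n (T : seq 'S_n) : value :=
  enc_seq [seq enc_perm pi | pi <- T].

Definition answer_no : value := VNum 0.
Definition answer_yes n (T : seq 'S_n) : value := VPair (VNum 1) (enc_tangle T).

(* Main.v *)
(* Write [p] and [v] for the initial and the final position of an element.  In a
   perfect tangle the path of [a] has one R-segment, with one step per inversion
   [(a, _)], and one L-segment, with one step per inversion [(_, a)].  Only the order
   of the two segments, recorded by a marking [m] ("right first"), and their times
   are free.  Locating the crossing of an inversion [(a, b)] on the R-segment of [a]
   and on the L-segment of [b] shows that a marking comes from a perfect tangle if
   and only if it is monotone along [implies] and the linear system
   [Y b - X a = weight a b] has a solution.

   The system is solvable if and only if it is balanced on all rectangles, made of
   two rows [x, y] and two columns [b, b'], and for this it suffices to consider
   consecutive left-to-right maxima and consecutive right-to-left minima.  The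
   condition becomes: [m] is false on [F0], true on [F1], and for each cell as many
   elements are marked in its low part as are unmarked in its high part.  An element
   is in the low part of at most one cell, and in the high part of at most one, so
   that a marking of this kind gives a perfect matching of each element with another
   one, or with itself, along [pairable].  An auction finds such a matching.
   A parity count on closed walks in the graph of cells shows that [pairable] is
   bipartite apart from its loops; hence the orbits of the matching are even, the
   matching can be chosen involutive, and then it determines a marking.  Permuting
   the marks among elements with the same cells makes the marking monotone.

   Times are found by relaxation.  That the running time is polynomial is built in:
   all functions are combinators whose only loops have [n + 2] rounds. *)

Require Import Defs.
From mathcomp Require Import all_boot all_order all_algebra all_fingroup.
From mathcomp Require Import zify ring.

Set Implicit Arguments.
Unset Strict Implicit.
Unset Printing Implicit Defensive.

Import Order.TTheory GRing.Theory Num.Theory.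

(** * Forced elements and cells *)

(** Every non-vertical segment has speed 1 or -1, so a perfect drawing is determined by the marking
    and by two constants per path: [t - pos] on the R-segment and [t + pos] on the L-segment. Where
    [a] crosses [b] these constants differ by twice the position plus one, and that position is the
    number of paths to the left, which depends on the marking alone. Once the marking is chosen, the
    unknowns therefore separate into one potential for the rows [a] and one for the columns [b],
    with the inversions as equations. The obstacle is the choice of the marking. The cell
    constraints compare cardinalities of overlapping sets, and balancing them means pairing elements
    in a graph that need not look bipartite. A permutation along [pairable] is only a relaxation of
    such a pairing, being a cover by cycles, but it is an assignment problem, which an auction
    solves with bounded integer prices and without augmenting paths. The parity argument on the
    cells is what excludes odd cycles and makes the relaxation exact. *)

Section Points.
Variables (T : finType) (p v : T -> nat).

Definition inverted a b := (p a < p b) && (v b < v a).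
Definition ascending c d := (p c < p d) && (v c < v d).
Definition mid a b c := inverted a c && inverted c b.

Definition rect x y b b' := [&& inverted x b, inverted x b', inverted y b & inverted y b'].

(** [F0] and [F1] collect the elements whose mark is dictated by a rectangle whose rows or columns
    are ordered differently by [p] and by [v]: such a rectangle is balanced only if every term of
    its defect vanishes, see [irregular_forced]. *)
Definition F0 c :=
  [exists x, exists y, exists b, exists b',
    [&& rect x y b b', p x < p c < p y, v b < v c < v b'
      & ~~ ((v x < v y) && (p b < p b'))]].
Definition F1 c :=
  [exists x, exists y, exists b, exists b',
    [&& rect x y b b', p b < p c < p b', v x < v c < v y
      & ~~ ((p x < p y) && (v b < v b'))]].
Definition unforced c := ~~ F0 c && ~~ F1 c.

(** Both [c] and [d] are inverted with [a] and with [b]. When [a] crosses [b], such an element is to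
    their right if it is marked and to their left if not; since [c] always stays left of [d], a mark
    on [c] entails one on [d]. *)
Definition implies c d :=
  [exists a, exists b,
    [&& ascending c d, p a < p c, v d < v a, p d < p b & v b < v c]].

Definition next_record a a' :=
  [&& p a < p a', v a < v a' & [forall e, (p e < p a') ==> (v e <= v a)]].
Definition next_minimum b b' :=
  [&& p b < p b', v b < v b' & [forall e, (p b < p e) ==> (v b' <= v e)]].

Definition quad := (T * T * T * T)%type.
Definition qa (u : quad) := u.1.1.1.
Definition qa' (u : quad) := u.1.1.2.
Definition qb (u : quad) := u.1.2.
Definition qb' (u : quad) := u.2.

Definition cell u :=
  [&& next_record (qa u) (qa' u), next_minimum (qb u) (qb' u)
    & inverted (qa' u) (qb u) && (v (qb' u) < v (qa u))].
(** [low] and [high] are the supports of the two sums in the defect of a cell, see [cell_defect]: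
    there a low element counts if it is marked, a high one if it is not. *)
Definition low u c := (p (qa u) < p c < p (qa' u)) && (v (qb u) < v c < v (qb' u)).
Definition high u c := (p (qb u) < p c < p (qb' u)) && (v (qa u) < v c < v (qa' u)).

Lemma F0P c : reflect (exists x y b b',
   [&& rect x y b b', p x < p c < p y, v b < v c < v b'
      & ~~ ((v x < v y) && (p b < p b'))]) (F0 c).
Proof.
apply: (iffP idP) => [/existsP[x /existsP[y /existsP[b /existsP[b' H]]]]|].
  by exists x, y, b, b'.
by case=> x [y [b [b' H]]]; apply/existsP; exists x; apply/existsP; exists y;
  apply/existsP; exists b; apply/existsP; exists b'.
Qed.

Lemma F1P c : reflect (exists x y b b',
   [&& rect x y b b', p b < p c < p b', v x < v c < v y
      & ~~ ((p x < p y) && (v b < v b'))]) (F1 c).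
Proof.
apply: (iffP idP) => [/existsP[x /existsP[y /existsP[b /existsP[b' H]]]]|].
  by exists x, y, b, b'.
by case=> x [y [b [b' H]]]; apply/existsP; exists x; apply/existsP; exists y;
  apply/existsP; exists b; apply/existsP; exists b'.
Qed.

Lemma impliesP c d : reflect (exists a b,
  [&& ascending c d, p a < p c, v d < v a, p d < p b & v b < v c]) (implies c d).
Proof.
apply: (iffP idP) => [/existsP[a /existsP[b H]]|[a [b H]]]; first by exists a, b.
by apply/existsP; exists a; apply/existsP; exists b.
Qed.

Lemma next_recordP a a' : next_record a a' ->
  [/\ p a < p a', v a < v a' & (forall e, p e < p a' -> v e <= v a)].
Proof. by case/and3P=> ? ? /forallP H; split=> // e; apply/implyP. Qed.

Lemma next_minimumP b b' : next_minimum b b' ->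
  [/\ p b < p b', v b < v b' & (forall e, p b < p e -> v b' <= v e)].
Proof. by case/and3P=> ? ? /forallP H; split=> // e; apply/implyP. Qed.

Lemma cellP u : cell u ->
  [/\ p (qa u) < p (qa' u) < p (qb u), v (qb u) < v (qb' u) < v (qa u),
      (p (qb u) < p (qb' u)) && (v (qa u) < v (qa' u)),
      (forall e, p e < p (qa' u) -> v e <= v (qa u)) &
      (forall e, p (qb u) < p e -> v (qb' u) <= v e)].
Proof.
rewrite /cell /inverted => /and3P[/next_recordP[? ? ?] /next_minimumP[? ? ?] H].
split=> //; lia.
Qed.


Hypotheses (pI : injective p) (vI : injective v).

(** If the rectangle that forces [c] does not surround [d], one built from some of its corners and
    from [a], [b], [c] does. [F0_down] is similar. *)
Lemma F1_up c d : implies c d -> F1 c -> F1 d.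
Proof.
move=> /impliesP[a [b H]] /F1P[x [y [e [e' K]]]]; rewrite /rect /inverted /ascending in H K.
apply/F1P; rewrite /rect /inverted.
have dy : v d != v y by apply: contraL H => /eqP/vI ->; lia.
have de' : p d != p e' by apply: contraL H => /eqP/pI ->; lia.
case: (ltnP (v d) (v y)) => ?; last by exists y, a, c, b; lia.
case: (ltnP (p d) (p e')) => de; first by exists x, y, e, e'; lia.
by exists c, y, e', b; lia.
Qed.

Lemma F0_down c d : implies c d -> F0 d -> F0 c.
Proof.
move=> /impliesP[a [b H]] /F0P[x [y [e [e' K]]]]; rewrite /rect /inverted /ascending in H K.
apply/F0P; rewrite /rect /inverted.
have cx : p c != p x by apply: contraL H => /eqP/pI ->; lia.
have ce : v c != v e by apply: contraL H => /eqP/vI ->; lia.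
case: (ltnP (p x) (p c)) => ?; last by exists a, x, b, d; lia.
case: (ltnP (v e) (v c)) => ?; first by exists x, y, e, e'; lia.
by exists a, d, b, e; lia.
Qed.

(* In the next four lemmas, a failure of the conclusion produces a rectangle
   forcing [c] or [d]. *)
Lemma low_up u c d : cell u -> low u c -> implies c d -> ~~ F0 c -> low u d.
Proof.
move=> /cellP[? ? ? ra mb] lc /impliesP[a [b H]]; apply: contraR => ld.
rewrite /low /ascending in lc H ld; move: (ra a) (ra d) (mb b) (mb d) => raa rad mbb mbd.
have dpa : p d != p (qa' u) by apply: contraL H => /eqP/pI ->; move: (ra a); lia.
have dpb : p d != p (qb u) by apply: contraL H => /eqP/pI ->; lia.
have dvb : v d != v (qb' u) by apply: contraL H => /eqP/vI ->; lia.
apply/F0P; rewrite /rect /inverted.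
case: (ltnP (p d) (p (qb u))) => ?; last by lia.
case: (ltnP (v d) (v (qb' u))) => ?.
  by exists (qa u), (qa' u), (qb u), d; lia.
by exists a, d, (qb u), (qb' u); lia.
Qed.

Lemma low_down u c d : cell u -> low u d -> implies c d -> ~~ F0 c -> low u c.
Proof.
move=> /cellP[? ? ? ra mb] lc /impliesP[a [b H]]; apply: contraR => ld.
rewrite /low /ascending in lc H ld; move: (ra a) (ra d) (mb b) (mb d) => raa rad mbb mbd.
have cpa : p c != p (qa u) by apply: contraL H => /eqP/pI ->; lia.
have cvb : v c != v (qb u) by apply: contraL H => /eqP/vI ->; lia.
apply/F0P; rewrite /rect /inverted.
case: (ltnP (p c) (p (qa u))) => ?; first by exists a, (qa u), b, d; lia.
by exists a, d, b, (qb u); lia.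
Qed.

Lemma high_down u c d : cell u -> high u d -> implies c d -> ~~ F1 d -> high u c.
Proof.
move=> /cellP[? ? ? ra mb] lc /impliesP[a [b H]]; apply: contraR => ld.
rewrite /high /ascending in lc H ld; move: (ra a) (ra c) (mb b) (mb c) => raa rac mbb mbc.
have cpb : p c != p (qb u) by apply: contraL H => /eqP/pI ->; lia.
have cpa : p c != p (qa' u) by apply: contraL H => /eqP/pI ->; lia.
have cva : v c != v (qa u) by apply: contraL H => /eqP/vI ->; lia.
apply/F1P; rewrite /rect /inverted.
case: (ltnP (p (qa' u)) (p c)) => ?; last by lia.
case: (ltnP (v (qa u)) (v c)) => ?.
  by exists c, (qa' u), (qb u), (qb' u); lia.
by exists (qa u), (qa' u), c, b; lia.
Qed.

Lemma high_up u c d : cell u -> high u c -> implies c d -> ~~ F1 d -> high u d.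
Proof.
move=> /cellP[? ? ? ra mb] lc /impliesP[a [b H]]; apply: contraR => ld.
rewrite /high /ascending in lc H ld; move: (ra a) (ra d) (mb b) (mb d) => raa rad mbb mbd.
have dpb : p d != p (qb' u) by apply: contraL H => /eqP/pI ->; lia.
have dva : v d != v (qa' u) by apply: contraL H => /eqP/vI ->; lia.
apply/F1P; rewrite /rect /inverted.
case: (ltnP (v d) (v (qa' u))) => ?; last by exists (qa' u), a, c, b; lia.
by exists c, a, (qb' u), b; lia.
Qed.

(** Consecutive records have disjoint intervals of positions, and consecutive minima have disjoint
    intervals of values. *)
Lemma low_uniq u w c : cell u -> cell w -> low u c -> low w c -> u = w.
Proof.
case: u => [[[a a'] b] b']; case: w => [[[x x'] y] y'].
move=> /cellP; rewrite /qa /qa' /qb /qb' /= => -[A1 A2 A3 A5 A6] /cellP.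
rewrite /low /qa /qa' /qb /qb' /= => -[B1 B2 B3 B5 B6] C D.
have ea : a = x by apply: vI; move: (A5 x) (B5 a); lia.
have eb : b = y.
  by apply: pI; move: (A6 y) (B6 b) (A6 c) (B6 c); lia.
subst x y.
have ea' : a' = x' by apply: pI; move: (A5 x') (B5 a'); lia.
have eb' : b' = y' by apply: vI; move: (A6 y') (B6 b'); lia.
by subst.
Qed.

Lemma high_uniq u w c : cell u -> cell w -> high u c -> high w c -> u = w.
Proof.
case: u => [[[a a'] b] b']; case: w => [[[x x'] y] y'].
move=> /cellP; rewrite /qa /qa' /qb /qb' /= => -[A1 A2 A3 A5 A6] /cellP.
rewrite /high /qa /qa' /qb /qb' /= => -[B1 B2 B3 B5 B6] C D.
have ea : a = x by apply: vI; move: (A5 x) (B5 a) (A5 x') (B5 a'); lia.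
have eb : b = y.
  by apply: pI; move: (A6 y) (B6 b) (A6 y') (B6 b'); lia.
subst x y.
have ea' : a' = x' by apply: pI; move: (A5 x') (B5 a'); lia.
have eb' : b' = y' by apply: vI; move: (A6 y') (B6 b'); lia.
by subst.
Qed.

(** * The graph of cells *)

(* An unforced element high in [u] and low in [w] turns in exactly one of the
   two corresponding rectangles of a perfect tangle. *)
Definition link u w :=
  [&& cell u, cell w & [exists c, [&& high u c, low w c & unforced c]]].
Definition below (u w : quad) := (v (qa u) < v (qa w)) && (v (qb u) < v (qb w)).

Lemma linkP u w : link u w ->
  [/\ cell u, cell w & exists c, [/\ high u c, low w c, ~~ F0 c & ~~ F1 c]].
Proof.
case/and3P=> -> -> /existsP[c /and3P[? ? /andP[? ?]]]; split=> //; by exists c.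
Qed.

Lemma link_below u w : link u w -> below u w.
Proof.
case/linkP=> /cellP[? ? ? ra mb] /cellP[? ? ? rw mw] [c [hc lc _ _]].
rewrite /high /low /below in hc lc *.
move: (mw (qb u)) (mb (qb w)) (mw c); lia.
Qed.

Lemma below_irr u : ~~ below u u. Proof. by rewrite /below ltnn. Qed.
Lemma below_trans u w t : below u w -> below w t -> below u t.
Proof. rewrite /below; lia. Qed.

Lemma cell_records u w : cell u -> cell w -> v (qa u) < v (qa w) ->
  v (qa' u) <= v (qa w) /\ p (qa' u) <= p (qa w).
Proof.
move=> /cellP[A1 _ A3 ra _] /cellP[B1 _ B3 rb _] lt.
have le : p (qa' u) <= p (qa w) by move: (ra (qa w)); lia.
split=> //; case: (leqP (v (qa' u)) (v (qa w))) => // gt.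
by move: (rb (qa' u)); lia.
Qed.

Lemma cell_minima u w : cell u -> cell w -> v (qb u) < v (qb w) ->
  v (qb' u) <= v (qb w) /\ p (qb' u) <= p (qb w).
Proof.
move=> /cellP[A1 A2 A3 _ ra] /cellP[B1 B2 B3 _ rb] lt.
have le : p (qb u) < p (qb w).
  rewrite ltnNge leq_eqVlt; apply/norP; split; last by apply/negP => /rb; lia.
  by apply: contraTneq lt => /pI ->; rewrite ltnn.
have le' := ra _ le; split=> //; rewrite leqNgt; apply/negP => /rb; lia.
Qed.

Lemma cell_next_record u w : cell u -> cell w -> qa u = qa w -> qa' u = qa' w.
Proof.
move=> /cellP[_ _ A3 ra _] /cellP[_ _ B3 rb _] eq; apply: pI.
by rewrite eq in A3 ra; move: (ra (qa' w)) (rb (qa' u)); lia.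
Qed.

Lemma cell_next_minimum u w : cell u -> cell w -> qb u = qb w -> qb' u = qb' w.
Proof.
move=> /cellP[_ _ A3 _ ma] /cellP[_ _ B3 _ mb] eq; apply: vI.
by rewrite eq in A3 ma; move: (ma (qb' w)) (mb (qb' u)); lia.
Qed.

Lemma low_ll u w c d : cell u -> cell w -> low u c -> low w d -> ascending c d ->
  v (qa u) <= v (qa w) /\ v (qb u) <= v (qb w).
Proof.
move=> cu cw; have [/cellP[A1 A2 A3 ra _] /cellP[B1 B2 B3 rb _]] := (cu, cw).
rewrite /low /ascending => lc ld lt; split; first by apply: rb; lia.
rewrite leqNgt; apply/negP => /(cell_minima cw cu)[]; lia.
Qed.

Lemma high_ll u w c d : cell u -> cell w -> high u c -> high w d -> ascending c d ->
  v (qa u) <= v (qa w) /\ v (qb u) <= v (qb w).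
Proof.
move=> cu cw; have [/cellP[A1 A2 A3 ra _] /cellP[B1 B2 B3 rb _]] := (cu, cw).
rewrite /high /ascending => lc ld lt; split.
  by rewrite leqNgt; apply/negP => /(cell_records cw cu)[]; lia.
by rewrite leqNgt; apply/negP => /(cell_minima cw cu)[]; lia.
Qed.

Lemma below_ll_high u w c d : cell u -> cell w -> high u c -> high w d ->
  below u w -> ascending c d.
Proof.
move=> cu cw hc hd /andP[/(cell_records cu cw)[A1 A2] /(cell_minima cu cw)[B1 B2]].
by move: hc hd; rewrite /high /ascending; lia.
Qed.

Lemma below_ll_low u w c d : cell u -> cell w -> low u c -> low w d ->
  below u w -> ascending c d.
Proof.
move=> cu cw hc hd /andP[/(cell_records cu cw)[A1 A2] /(cell_minima cu cw)[B1 B2]].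
by move: hc hd; rewrite /low /ascending; lia.
Qed.

(** If only one side holds, the linking elements [c], [d] are still ascending, and the cells on the
    failing side share a record or a minimum. Corners of these cells then witness [implies c d],
    which puts [c] and [d] into the same cell on the other side and contradicts strictness there. *)
Lemma below_link u w u1 w1 : link u w -> link u1 w1 -> below u u1 = below w w1.
Proof.
case/linkP=> cu cw [c [hc lc c0 c1]] /linkP[cu1 cw1 [d [hd ld d0 d1]]].
have [/cellP[A1 A2 A3 ra ma] /cellP[B1 B2 B3 rb mb]] := (cu, cw).
have [/cellP[D1 D2 D3 rd md] /cellP[E1 E2 E3 re me]] := (cu1, cw1).
apply/idP/idP => lt; apply/negPn/negP => nlt.
- have cd := below_ll_high cu cu1 hc hd lt.
  have [le1 le2] := low_ll cw cw1 lc ld cd.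
  have eq : qa w = qa w1 \/ qb w = qb w1.
    case: (eqVneq (v (qa w)) (v (qa w1))) => [/vI|ne1]; first by left.
    by right; apply: vI; move: nlt le1 le2 ne1; rewrite /below; clear; lia.
  have imp : implies c d.
    apply/impliesP; exists (qa w), (qb w).
    move: lc ld cd B1 B2 E1 E2; rewrite /low /ascending; case: eq => eq.
      by rewrite (cell_next_record cw cw1 eq) eq; clear; lia.
    by rewrite (cell_next_minimum cw cw1 eq) eq; clear; lia.
  have hd2 := high_up cu hc imp d1.
  by move: (high_uniq cu cu1 hd2 hd) lt => ->; rewrite (negbTE (below_irr _)).
- have cd := below_ll_low cw cw1 lc ld lt.
  have [le1 le2] := high_ll cu cu1 hc hd cd.
  have eq : qa u = qa u1 \/ qb u = qb u1.
    case: (eqVneq (v (qa u)) (v (qa u1))) => [/vI|ne1]; first by left.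
    by right; apply: vI; move: nlt le1 le2 ne1; rewrite /below; clear; lia.
  have imp : implies c d.
    apply/impliesP; exists (qa' u1), (qb' u1).
    move: hc hd cd A1 A2 D1 D2; rewrite /high /ascending; case: eq => eq.
      by rewrite (cell_next_record cu cu1 eq) eq; clear; lia.
    by rewrite (cell_next_minimum cu cu1 eq) eq; clear; lia.
  have ld2 := low_up cw lc imp c0.
  by move: (low_uniq cw cw1 ld2 ld) lt => ->; rewrite (negbTE (below_irr _)).
Qed.
End Points.

(** * Parity of closed walks *)

Section Walks.
Variables (Q : finType) (link below : rel Q).
Hypothesis link_below : forall u w, link u w -> below u w.
Hypothesis below_link : forall u w u1 w1,
  link u w -> link u1 w1 -> below u u1 = below w w1.
Hypothesis below_irr : forall u, ~~ below u u.
Hypothesis below_trans : forall u w t, below u w -> below w t -> below u t.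

Definition walk (x : nat -> Q) (up : nat -> bool) n :=
  forall i, i < n -> if up i then link (x i) (x i.+1) else link (x i.+1) (x i).

Fixpoint height (up : nat -> bool) n : int :=
  if n is m.+1 then (height up m + (if up m then 1 else -1))%R else 0%R.

Lemma telescope_addb (g : nat -> bool) n :
  \big[addb/false]_(0 <= a < n) (g a (+) g a.+1) = g 0 (+) g n.
Proof.
elim: n => [|n IH]; first by rewrite big_nil addbb.
by rewrite big_nat_recr //= IH addbA -(addbA (g 0)) addbb addbF.
Qed.

(* Count modulo 2, in two ways, the pairs of steps [a < b] such that an endpoint
   of [a] is level with the bottom of [b] and [below] the top of [b]. *)
Lemma tent x up n : walk x up n -> 0 < n -> height up n = 1%R ->
  (forall t, 0 < t <= n -> (1 <= height up t)%R) -> below (x 0) (x n).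
Proof.
move=> wk n0 hn hge.
have up0 : up 0 by move: (hge 1); rewrite /= n0 => /(_ isT); case: (up 0).
case: (ltnP 1 n) => [n1|]; last first.
  by case: n n0 wk hn hge => [|[|//]] // _ wk _ _ _; move: (wk 0 isT); rewrite up0 => /link_below.
have upl : up n.-1 = false.
  move: (hge n.-1); case: n n1 hn {n0 wk hge} => [|[|n]] //= _; case: (up n.+1) => //= hn.
  by move=> /(_ ltac:(lia)); lia.
pose H := height up.
pose lev b : int := if up b then H b else H b.+1.
pose lo b := if up b then x b else x b.+1.
pose hi b := if up b then x b.+1 else x b.
pose V i b := (H i == lev b) && below (x i) (hi b).
pose E a k := (H k == lev a + 1)%R && below (lo a) (x k).
have lnk b : b < n -> link (lo b) (hi b).
  by move=> /wk; rewrite /lo /hi; case: (up b).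
have levge b : 0 < b < n -> (1 <= lev b)%R.
  by rewrite /lev => bn; case: (up b); apply: hge; lia.
have Hs b : H b.+1 = (if up b then lev b + 1 else lev b)%R.
  by rewrite /lev /H /=; case: (up b).
have Hb' b : H b = (if up b then lev b else lev b + 1)%R.
  by rewrite /lev /H /=; case: (up b) => //; clear; lia.
(* The term with the bottom of [a] and the top of [b] is common to both sides; the other two agree
   by [below_link], which lets one compare bottoms instead of tops. *)
have VE a b : a < b -> b < n -> V a b (+) V a.+1 b = E a b (+) E a b.+1.
  move=> ab bn; have an := ltn_trans ab bn.
  have bl := below_link (lnk _ an) (lnk _ bn).
  have -> : V a b (+) V a.+1 b = ((lev a == lev b) && below (lo a) (hi b))
      (+) ((lev a + 1 == lev b)%R && below (hi a) (hi b)).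
    by rewrite /V Hs Hb' /lo /hi; case: (up a); rewrite // addbC.
  have -> : E a b (+) E a b.+1 = ((lev a + 1 == lev b)%R && below (lo a) (lo b))
      (+) ((lev a == lev b) && below (lo a) (hi b)).
    rewrite /E Hs Hb' /lo /hi; case: (up b); rewrite ?(inj_eq (addIr _)) !(eq_sym (lev b)) //.
    by rewrite addbC.
  by rewrite bl addbC.
(* After telescoping, the left side counts the rising steps other than the first; the right side
   counts the rising steps other than the last, and adds [below (x 0) (x n)]. As the first step
   rises and the last one falls, this extra term must be true. *)
have : \big[addb/false]_(0 <= b < n) \big[addb/false]_(0 <= a < n | a < b) (V a b (+) V a.+1 b)
     = \big[addb/false]_(0 <= a < n) \big[addb/false]_(0 <= b < n | a < b) (E a b (+) E a b.+1).
  rewrite (exchange_big_dep xpredT) //=; apply: eq_big_nat => a an.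
  rewrite !(big_nat_cond _ _ _ _ (fun i => a < i)).
  by apply: eq_bigr => b /andP[/andP[_ bn] ab]; apply: VE.
have -> : \big[addb/false]_(0 <= b < n) \big[addb/false]_(0 <= a < n | a < b) (V a b (+) V a.+1 b)
   = \big[addb/false]_(0 <= b < n) ((0 < b) && up b).
  apply: eq_big_nat => b /andP[_ bn].
  have -> : \big[addb/false]_(0 <= a < n | a < b) (V a b (+) V a.+1 b) =
            \big[addb/false]_(0 <= a < b) (V a b (+) V a.+1 b).
    rewrite (@big_cat_nat _ _ _ b) //=; last exact: ltnW.
    rewrite [X in _ (+) X]big_nat_cond [X in _ (+) X]big1 ?addbF; last by move=> i; lia.
    by rewrite [LHS]big_nat_cond [RHS]big_nat_cond; apply: eq_bigl => i; lia.
  rewrite telescope_addb; case: (posnP b) => [->|b0]; first by rewrite addbb.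
  have Hb : (H 0 == lev b) = false.
    by apply/negbTE/eqP; have := levge b; rewrite b0 bn /H /= => /(_ isT); lia.
  rewrite /V Hb /= Hb' /hi; have := lnk _ bn; rewrite /lo /hi.
  case: (up b) => /=; first by rewrite eqxx => /link_below ->.
  by move=> _; case: eqP => //; clear; lia.
have -> : \big[addb/false]_(0 <= a < n) \big[addb/false]_(0 <= b < n | a < b) (E a b (+) E a b.+1)
   = \big[addb/false]_(0 <= a < n) (((a < n.-1) && up a) (+) ((a == 0) && below (x 0) (x n))).
  apply: eq_big_nat => a /andP[_ an].
  have -> : \big[addb/false]_(0 <= b < n | a < b) (E a b (+) E a b.+1) =
            \big[addb/false]_(0 <= b < n - a.+1) (E a (b + a.+1) (+) E a (b + a.+1).+1).
    rewrite (@big_cat_nat _ _ _ a.+1) //=.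
    rewrite [X in X (+) _]big_nat_cond [X in X (+) _]big1 ?addFb; last by move=> i; lia.
    rewrite big_nat_cond -{1}[a.+1]add0n big_addn.
    by rewrite [RHS]big_nat_cond; apply: eq_bigl => i; lia.
  rewrite (telescope_addb (fun b => E a (b + a.+1))) add0n subnK //.
  have En : E a n = (a == 0) && below (x 0) (x n).
    rewrite /E; case: (posnP a) => [->|a0]; first by rewrite /lev up0 /lo up0 /H hn.
    have := levge a; rewrite a0 an => /(_ isT) h; rewrite /H hn.
    by case: eqP => //; move: h; clear; lia.
  rewrite En; congr (_ (+) _); have := lnk _ an; rewrite /E Hs /lo /hi.
  case: (ltnP a n.-1) => an1 /=.
    case: (up a) => /=; first by rewrite eqxx => /link_below ->.
    by move=> _; case: eqP => //; clear; lia.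
  have ea : a = n.-1 by move: an an1; clear; lia.
  have -> : up a = false by rewrite ea.
  by move=> _; case: eqP => // h; exfalso; move: h; clear; lia.
rewrite big_split /=.
have -> : \big[addb/false]_(0 <= i < n) ((i == 0) && below (x 0) (x n)) = below (x 0) (x n).
  rewrite big_ltn // big_nat_cond big1 ?addbF // => i; lia.
have -> : \big[addb/false]_(0 <= i < n) ((i < n.-1) && up i) = \big[addb/false]_(0 <= i < n) up i.
  apply: eq_big_nat => i /andP[_ ?]; case: ltnP => //= ?.
  by have -> : i = n.-1 by lia.
rewrite big_ltn // [in X in _ = X]big_ltn //= up0.
have -> : \big[addb/false]_(1 <= i < n) ((0 < i) && up i) = \big[addb/false]_(1 <= i < n) up i.
  by apply: eq_big_nat => i /andP[-> _].
by case: (\big[_/_]_(1 <= i < n) up i); case: below.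
Qed.

Lemma height_shift up s n :
  height up (s + n) = (height up s + height (fun i => up (s + i)%N) n)%R.
Proof. by elim: n => [|n IH]; rewrite ?addn0 ?addr0 // addnS /= IH addrA. Qed.

Lemma walk_shift x up s n m : walk x up n -> s + m <= n ->
  walk (fun i => x (s + i)) (fun i => up (s + i)) m.
Proof. by move=> wk sm i im; rewrite addnS; apply: wk; lia. Qed.

(** Cut at the last visit to height 1: the first piece is covered by [tent], the rest again stays
    above its start, and [below] is transitive. *)
Lemma walk_above x up n : walk x up n -> 0 < n ->
  (forall t, 0 < t <= n -> (1 <= height up t)%R) -> below (x 0) (x n).
Proof.
elim/ltn_ind: n x up => n IH x up wk n0 hge.
pose P t := (t <= n) && (height up t == 1)%R.
have P1 : exists t, P t.
  exists 1; rewrite /P n0 /=; move: (hge 1); rewrite /= n0 => /(_ isT).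
  by case: (up 0).
have Pn t : P t -> t <= n by case/andP.
case: (ex_maxnP P1 Pn) => t /andP[tn /eqP ht] mx.
have t0 : 0 < t by case: t ht {tn mx} => //= ht; lia.
have b1 : below (x 0) (x t).
  apply: (@tent x up) => // [i it|i it]; first by apply: wk; lia.
  by apply: hge; lia.
case: (ltnP t n) => tn'; last by have <- : t = n by lia.
apply: below_trans b1 _.
have := @IH (n - t) _ (fun i => x (t + i)) (fun i => up (t + i)).
rewrite addn0 subnKC //; apply; try lia; first by apply: (walk_shift wk); lia.
move=> s sn; have := height_shift up t s; rewrite ht => e.
have hne : height up (t + s) <> 1%R.
  by move=> e1; move: (mx (t + s)); rewrite /P e1 eqxx; lia.
have h2 : (1 <= height up (t + s))%R by apply: hge; lia.
by move: hne h2; rewrite e; clear; lia.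
Qed.

Lemma odd_height up n : odd `|height up n| = odd n.
Proof. elim: n => //= n IH; case: (up n); lia. Qed.

Lemma no_rising_cycle x up n : walk x up n -> x n = x 0 -> (0 < height up n)%R -> False.
Proof.
move=> wk xn hn; have n0 : 0 < n by case: n hn {wk xn}.
(* Unrolling the closed walk periodically allows it to be started at any vertex. *)
pose x' i := x (i %% n); pose up' i := up (i %% n).
have wk' m : walk x' up' m.
  move=> i _; rewrite /x' /up'; have := wk (i %% n) (ltn_pmod _ n0).
  have -> : x (i.+1 %% n) = x (i %% n).+1 => //.
  rewrite -addn1 -modnDml addn1; have := ltn_pmod i n0.
  rewrite leq_eqVlt => /orP[/eqP ->|lt]; first by rewrite modnn xn.
  by rewrite modn_small.
have hs m : m <= n -> height up' m = height up m.
  elim: m => //= m IH mn; rewrite IH ?(ltnW mn) //; congr (_ + _)%R.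
  by rewrite /up' modn_small.
have hp m : height up' (n + m) = (height up n + height up' m)%R.
  rewrite height_shift hs //; congr (_ + _)%R.
  by elim: m => //= m ->; rewrite /up' modnDl.
(* the last minimum of the height over one period *)
have [i iN imin] : exists2 i, i < n & forall t, t < n -> (height up' i <= height up' t)%R /\ (i < t
    -> (height up' i < height up' t)%R).
  elim: (n) n0 => // m IH _; case: m IH => [_|m IH].
    by exists 0 => // t; case: t => //.
  have [//|i im ih] := IH.
  case: (leP (height up' m.+1) (height up' i))%R => le.
    exists m.+1 => // t tm; case: (ltnP t m.+1) => tm'.
      by have [? _] := ih t tm'; split; [apply: le_trans le _ | lia].
    have -> : t = m.+1 by lia.
    by split; [|rewrite ltnn].
  exists i; first by lia.
  move=> t tm; case: (ltnP t m.+1) => tm'; first exact: ih.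
  have -> : t = m.+1 by lia.
  by split=> // ; apply: ltW.
(* One full turn from the last minimum stays above its starting height, so [walk_above] puts the
   starting cell below itself. *)
have /negP := below_irr (x' (i + 0)); apply.
have {2}-> : x' (i + 0) = x' (i + n) by rewrite /x' addn0 modnDr.
apply: (@walk_above (fun j => x' (i + j)) (fun j => up' (i + j)) n) => //.
  by apply: (@walk_shift _ _ _ (i + n)).
move=> t tn; have := height_shift up' i t => e.
case: (ltnP (i + t) n) => it; first by have [_] := imin _ it; lia.
have := hp (i + t - n); rewrite subnKC // => e2.
have [|? _] := imin (i + t - n); lia.
Qed.

(** The height has the parity of the length, so an odd closed walk has a nonzero height; if it
    falls, its reverse rises. *)
Lemma odd_cycle x up n : walk x up n -> x n = x 0 -> ~~ odd n.
Proof.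
move=> wk xn; apply/negP => on.
have : height up n <> 0%R by move=> h0; have := odd_height up n; rewrite h0 on.
case: (ltP 0%R (height up n)) => [h _|h hne]; first exact: (no_rising_cycle wk xn).
apply: (@no_rising_cycle (fun i => x (n - i)) (fun i => ~~ up (n - i.+1)) n).
- move=> i im /=; have := wk (n - i.+1) ltac:(lia).
  by rewrite subnSK //; case: (up _).
- by rewrite subnn subn0.
suff -> : height (fun i => ~~ up (n - i.+1)) n = (- height up n)%R by lia.
have aux m : m <= n -> height (fun i => ~~ up (n - i.+1)) m = (height up (n - m) - height up n)%R.
  elim: m => [|m IH] mn /=; first by rewrite subn0; lia.
  rewrite IH ?(ltnW mn) // -(subnSK mn) /=; case: (up _) => /=; lia.
by rewrite aux // subnn /=; lia.
Qed.

(** In the double cover [e2], an odd closed walk at [u] is exactly a path from [(u, b)] to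
    [(u, ~~ b)]. As there is none, each component lifts to two sheets, and the sheet through its
    root gives the colour. *)
Lemma links_bipartite : exists kappa : Q -> bool, forall u w, link u w -> kappa w = ~~ kappa u.
Proof.
pose e1 : rel Q := fun u w => link u w || link w u.
pose e2 : rel (Q * bool) := fun s t => e1 s.1 t.1 && (t.2 == ~~ s.2).
have e1s : connect_sym e1.
  by apply: sym_connect_sym => u w; rewrite /e1 orbC.
have e2s : connect_sym e2.
  apply: sym_connect_sym => -[u b] [w c]; rewrite /e2 /e1 /= orbC.
  by case: b; case: c.
have noodd u b : ~~ connect e2 (u, b) (u, ~~ b).
  apply/negP => /connectP[q pq lq].
  pose x i := (nth (u, b) ((u, b) :: q) i).1.
  pose up i := link (x i) (x i.+1).
  have st i : i < size q -> e2 (nth (u, b) ((u, b) :: q) i) (nth (u, b) q i).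
    by move=> iq; apply: (pathP (u, b) pq).
  have par i : i <= size q -> (nth (u, b) ((u, b) :: q) i).2 = b (+) odd i.
    elim: i => [|i IH] iq /=; first by rewrite addbF.
    have /andP[_ /eqP ->] := st _ iq; rewrite IH ?(ltnW iq) //.
    by case: (b); case: (odd i).
  have lst : nth (u, b) ((u, b) :: q) (size q) = (u, ~~ b) by rewrite lq (last_nth (u, b)).
  have oq : odd (size q).
    by move: (par _ (leqnn _)); rewrite lst /=; case: (b); case: odd.
  have := @odd_cycle x up (size q); rewrite oq => /(_ _ _)/negP; apply=> //.
    move=> i iq; have /andP[] := st _ iq; rewrite /up /x /= /e1 => + _.
    by case: ifP => //=.
  by rewrite /x lst.
have lift u w : connect e1 u w -> forall b, connect e2 (u, b) (w, true) || connect e2 (u, b) (w,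
    false).
  move=> /connectP[q]; elim: q u => [|z q IH] u /=.
    by move=> _ -> []; rewrite connect0 ?orbT.
  move=> /andP[uz pz] lz b; have st : e2 (u, b) (z, ~~ b) by rewrite /e2 /= uz eqxx.
  have /orP[h|h] := IH _ pz lz (~~ b).
    by rewrite (connect_trans (connect1 st) h).
  by rewrite (connect_trans (connect1 st) h) orbT.
exists (fun u => connect e2 (fingraph.root e1 u, false) (u, true)) => u w uw.
have uw1 : e1 u w by rewrite /e1 uw.
have rt : fingraph.root e1 u = fingraph.root e1 w.
  by apply/(fingraph.rootP e1s); apply: connect1.
have wr : connect e1 (fingraph.root e1 u) u by rewrite e1s connect_root.
have st b : e2 (u, b) (w, ~~ b) by rewrite /e2 /= uw1 eqxx.
have := lift _ _ wr false; rewrite -rt.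
have ex : ~~ (connect e2 (fingraph.root e1 u, false) (u, true) && connect e2 (fingraph.root e1 u,
    false) (u, false)).
  apply/negP => /andP[h1 h2]; have /negP := noodd u true; apply.
  by rewrite e2s in h1; apply: connect_trans h1 h2.
case h1: (connect _ _ (u, true)) => /=.
  move=> _; apply/negP => h2; move: ex; rewrite h1 /= => /negP; apply.
  apply: (connect_trans h2); rewrite e2s; exact: (connect1 (st false)).
by move=> h2; apply: (connect_trans h2); apply: connect1 (st false).
Qed.
End Walks.

(** * Pairings and marks *)

Lemma perm_iota (s : seq nat) :
  uniq s -> all (fun i => i < size s) s -> perm_eq s (iota 0 (size s)).
Proof.
move=> us /allP as_; have sub : {subset s <= iota 0 (size s)}.
  by move=> i /as_; rewrite mem_iota.
have [_ e] := uniq_min_size us sub (eq_leq (size_iota _ _)).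
by apply: uniq_perm; rewrite ?iota_uniq.
Qed.

(** The ranks of the elements of [A] are the integers below [#|A|] in some order. *)
Lemma count_rank_lt (T : finType) (A : pred T) (rank : T -> nat) K :
  {in A &, injective rank} -> (forall d, A d -> rank d < #|A|) -> K <= #|A| ->
  #|[pred d | A d && (rank d < K)]| = K.
Proof.
move=> ri rlt KA; have us : uniq (map rank (enum A)).
  by rewrite map_inj_in_uniq ?enum_uniq // => x y; rewrite !mem_enum; apply: ri.
have := @perm_iota (map rank (enum A)) us.
rewrite size_map -cardE => /(_ _)/seq.permP/(_ (fun i => i < K)) e.
rewrite cardE -(size_map rank).
have -> : size [seq rank i | i <- enum [pred d | A d && (rank d < K)]] = count (fun i => i < K)
    (map rank (enum A)).
  rewrite size_map count_map -size_filter; congr size.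
  by rewrite /enum_mem -filter_predI; apply: eq_filter => d; rewrite /= andbC.
rewrite e; last by apply/allP => i /mapP[d]; rewrite mem_enum => /rlt ? ->.
have {e} : forall M, K <= M -> count (fun i => i < K) (iota 0 M) = K.
  move=> M KM; rewrite -(subnKC KM) iotaD count_cat add0n.
  rewrite (@eq_in_count _ _ xpredT); last by move=> i; rewrite mem_iota.
  rewrite count_predT size_iota (@eq_in_count _ _ pred0); last by move=> i; rewrite mem_iota /=;
    lia.
  by rewrite count_pred0 addn0.
by apply.
Qed.

(* The prices of the auction algorithm; a frustrated bidder and the price levels
   [k, k + 1, ...] violate Hall's condition. *)
Lemma auction_failure (T : finType) (B : rel T) (own : T -> option T) (price : T -> nat) x :
  (forall y z, own y = Some z -> forall y', B z y' -> price y <= (price y').+1) ->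
  (forall y, own y = None -> price y = 0) ->
  (forall y y' z, own y = Some z -> own y' = Some z -> y = y') ->
  (forall y, own y != Some x) ->
  (forall y, B x y -> #|T| < price y) ->
  forall tau : T -> T, injective tau -> (forall z, B z (tau z)) -> False.
Proof.
move=> Hp H0 Hi Hx Hb tau ti tB.
pose A k := [set y | k <= price y].
(* The owners in level [k + 1], together with [x], are sent injectively into level [k] by [tau],
   because an owner pays at most one more than the price of anything else it accepts. Iterating
   makes level 0 larger than [T]. *)
have step k : k <= #|T| -> #|A k.+1| < #|A k|.
  move=> kT.
  have sub : tau x |: [set tau (odflt y (own y)) | y in A k.+1] \subset A k.
    apply/subsetP => y /setU1P[->|/imsetP[z]]; rewrite !inE.
      by have := Hb _ (tB x); lia.
    case E: (own z) => [w|] /= pz ->; last by move: pz; rewrite H0.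
    have := Hp _ _ E _ (tB w); lia.
  apply: leq_trans (subset_leq_card sub).
  rewrite cardsU1 card_in_imset.
    suff -> : tau x \notin [set tau (odflt y (own y)) | y in A k.+1] by [].
    apply/imsetP => -[y]; rewrite inE => py /ti.
    case E: (own y) => [w|] /=; last by move: py; rewrite H0.
    by move=> e; have := Hx y; rewrite E e eqxx.
  move=> y z; rewrite !inE => py pz /ti.
  case E: (own y) => [w|] /=; last by move: py; rewrite H0.
  case E': (own z) => [w'|] /=; last by move: pz; rewrite H0.
  by move=> e; apply: (Hi _ _ w); rewrite // E' e.
have : forall k, k <= #|T|.+1 -> #|A k| + k <= #|T|.
  elim=> [|k IH] kT; first by rewrite addn0 max_card.
  by have := step k kT; have := IH (ltnW kT); lia.
by move=> /(_ _ (leqnn _)); lia.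
Qed.

Section Selection.
Variables (T : finType) (p v : T -> nat).
Hypotheses (pI : injective p) (vI : injective v).
Local Notation F0 := (F0 p v).
Local Notation F1 := (F1 p v).
Local Notation cell := (cell p v).
Local Notation low := (low p v).
Local Notation high := (high p v).
Local Notation unforced := (unforced p v).

Definition in_low c := [exists u, cell u && low u c].
Definition in_high c := [exists u, cell u && high u c].
(** [c], if marked, and [d], if unmarked, may balance each other in their common cell. *)
Definition up c d := [&& [exists u, [&& cell u, low u c & high u d]], ~~ F0 c & ~~ F1 d].
(** An element may be its own partner only if no cell counts it: unmarked it must avoid the high
    parts ([ok0]), marked the low parts ([ok1]). *)
Definition ok0 c := ~~ F1 c && ~~ in_high c.
Definition ok1 c := ~~ F0 c && ~~ in_low c.
Definition pairable c d := [|| up c d, up d c | (c == d) && (ok0 c || ok1 c)].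

Record admissible (m : T -> bool) : Prop := Admissible {
  adm_F0 : forall c, F0 c -> ~~ m c;
  adm_F1 : forall c, F1 c -> m c;
  adm_cell : forall u, cell u ->
    #|[pred c | low u c && m c]| = #|[pred d | high u d && ~~ m d]| }.
Definition monotone (m : T -> bool) := forall c d, implies p v c d -> m c -> m d.

Lemma up_lt c d : up c d -> v c < v d.
Proof.
case/andP=> /existsP[u /and3P[/cellP[? ? ? _ _]]].
rewrite /low /high; lia.
Qed.

(** An element gets the colour of the cell in whose low part it is, or else the opposite of the
    colour of the cell in whose high part it is. If both cells exist and the element is unforced,
    they are linked, so that the two rules agree. *)
Lemma pairable_bipartite :
  exists zeta : T -> bool, forall c d, up c d -> zeta d = ~~ zeta c.
Proof.
have [k kl] := links_bipartite (@link_below _ p v) (below_link pI vI)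
  (@below_irr _ v) (@below_trans _ v).
pose A c : pred (quad T) := fun u => [&& cell u, low u c & ~~ F0 c].
pose B c : pred (quad T) := fun u => [&& cell u, high u c & ~~ F1 c].
exists (fun c => if [pick u | A c u] is Some u then k u
                 else if [pick u | B c u] is Some u then ~~ k u else false).
move=> c d /and3P[/existsP[u /and3P[cu lc hd]] c0 d1].
have -> : (if [pick u | A c u] is Some u then k u else
          if [pick u | B c u] is Some u then ~~ k u else false) = k u.
  case: pickP => [w /and3P[cw lw _]|/(_ u)]; last by rewrite /A cu lc c0.
  by rewrite (low_uniq pI vI cu cw lc lw).
case: pickP => [w /and3P[cw lw d0]|_].
  apply: kl; apply/and3P; split=> //; apply/existsP; exists d.
  by rewrite hd lw /unforced d0 d1.
case: pickP => [w /and3P[cw hw _]|/(_ u)]; last by rewrite /B cu hd d1.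
by rewrite (high_uniq pI vI cu cw hd hw).
Qed.

Section Pairing.
Variable tau : T -> T.
Hypothesis tauK : involutive tau.
Hypothesis tau_pair : forall c, pairable c (tau c).

(** By [up_lt], the smaller element of a pair is the one in the low part, so it is the one to be
    marked. *)
Definition mark0 c := if tau c == c then ~~ ok0 c else v c < v (tau c).

Lemma mark0P c : tau c != c -> up c (tau c) && mark0 c || up (tau c) c && ~~ mark0 c.
Proof.
move=> ne; rewrite /mark0 (negbTE ne); have := tau_pair c.
rewrite /pairable (eq_sym c) (negbTE ne) orbF.
case/orP=> h; have := up_lt h; rewrite h => lt; first by rewrite lt.
by apply/orP; right; lia.
Qed.

Lemma mark0_fix c : tau c = c -> mark0 c = ~~ ok0 c /\ (ok0 c || ok1 c).
Proof.
move=> e; rewrite /mark0 e eqxx; split=> //; have := tau_pair c.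
rewrite e /pairable eqxx /= => /or3P[/up_lt|/up_lt|//]; lia.
Qed.

(** For every cell, [tau] exchanges the marked low elements and the unmarked high ones. *)
Lemma mark0_admissible : admissible mark0.
Proof.
split=> [c c0|c c1|u cu].
- case: (eqVneq (tau c) c) => [/mark0_fix[-> /orP[->//|]]|/mark0P].
    by rewrite /ok1 c0.
  by rewrite /up c0 andbF /= => /andP[_ ->].
- case: (eqVneq (tau c) c) => [/mark0_fix[-> _]|/mark0P]; first by rewrite /ok0 c1.
  by rewrite /up c1 !andbF orbF => /andP[_ ->].
rewrite -!sum1_card big_mkcond [RHS]big_mkcond (reindex_inj (inv_inj tauK)) /=.
apply: eq_bigr => c _; rewrite !inE; congr (if _ then _ else _).
case: (eqVneq (tau c) c) => [e|ne].
  have [h1 h2] := mark0_fix e; rewrite e h1 negbK.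
  have notlow : low u c -> ok0 c.
    move: h2; rewrite /ok1 => /orP[//|/andP[_ /negP il]] lc; case: il.
    by apply/existsP; exists u; rewrite cu.
  have nothigh : high u c -> ~~ ok0 c.
    by move=> hc; rewrite /ok0 negb_and !negbK; apply/orP; right; apply/existsP; exists u; rewrite
      cu.
  case: (ok0 c) notlow nothigh => /= nl nh; rewrite ?andbT ?andbF.
    by case: (high u c) nh => // /(_ isT).
  by case: (low u c) nl => // /(_ isT).
have ne' : tau (tau c) != tau c by rewrite tauK eq_sym.
have := mark0P ne'; rewrite tauK => /orP[/andP[h1 h2]|/andP[h1 /negbTE h2]].
  have /orP[/andP[h3 _]|/andP[_ /negbTE h4]] := mark0P ne.
    by have := up_lt h1; have := up_lt h3; lia.
  rewrite h2 h4 !andbT; case/and3P: h1 => /existsP[w /and3P[cw lw hw]] _ _.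
  apply/idP/idP => h.
    by rewrite (low_uniq pI vI cu cw h lw).
  by rewrite (high_uniq pI vI cu cw h hw).
have /orP[/andP[_ h4]|/andP[h3 _]] := mark0P ne.
  by rewrite h2 h4 !andbF.
by have := up_lt h1; have := up_lt h3; lia.
Qed.
End Pairing.

(** * Rearranging marks inside classes of twins *)

Section Sorting.
Variable m0 : T -> bool.

Definition twin c d := [&& unforced c, unforced d &
  [forall u, cell u ==> (low u c == low u d) && (high u c == high u d)]].
(** Each class keeps its number of marks but gives them to its largest values, since [implies c d]
    entails [v c < v d]. *)
Definition sorted_mark c :=
  if unforced c then #|[pred d | twin c d && (v c < v d)]| < #|[pred d | twin c d && m0 d]|
  else m0 c.

Lemma twinP c d : twin c d -> unforced c /\ unforced d /\
  forall u, cell u -> low u c = low u d /\ high u c = high u d.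
Proof.
case/and3P=> ? ? /forallP H; do 2 split=> //.
by move=> u cu; move: (H u); rewrite cu /= => /andP[/eqP ? /eqP ?].
Qed.

Lemma twin_trans c d : twin c d -> twin c =1 twin d.
Proof.
move=> cd; have [uc [ud H]] := twinP cd => e.
rewrite /twin uc ud /=; congr (_ && _); apply: eq_forallb => u.
by case cu: (cell u) => //=; have [-> ->] := H u cu.
Qed.

Lemma twin_refl c : unforced c -> twin c c.
Proof. by move=> uc; rewrite /twin uc /=; apply/forallP => u; rewrite !eqxx implybT. Qed.

Lemma sorted_class c : unforced c ->
  #|[pred d | twin c d && sorted_mark d]| = #|[pred d | twin c d && m0 d]|.
Proof.
move=> uc; set K := #|[pred d | twin c d && m0 d]|.
rewrite -(@count_rank_lt T (twin c) (fun d => #|[pred e | twin c e && (v d < v e)]|) K).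
- apply: eq_card => d; rewrite !inE; case cd: (twin c d) => //=.
  have [_ [ud _]] := twinP cd; rewrite /sorted_mark ud.
  have e1 := twin_trans cd.
  congr (_ < _); apply: eq_card => e; rewrite !inE -e1 //.
- move=> d e; rewrite !unfold_in => cd ce eq; apply: vI.
  have aux x y : twin c x -> twin c y -> v x < v y ->
      #|[pred z | twin c z && (v y < v z)]| < #|[pred z | twin c z && (v x < v z)]|.
    move=> cx cy lt; apply: proper_card; apply/properP; split.
      by apply/subsetP => z; rewrite !inE => /andP[-> ?] /=; lia.
    by exists y; rewrite !inE ?cy ?lt ?ltnn ?andbF.
  by case: (ltngtP (v d) (v e)) => // h; [have := aux _ _ cd ce h | have := aux _ _ ce cd h];
    rewrite eq ltnn.
- move=> d cd; apply: proper_card; apply/properP; split.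
    by apply/subsetP => z; rewrite !inE => /andP[].
  by exists d; rewrite ?inE ?ltnn ?andbF.
- by apply: subset_leq_card; apply/subsetP => z; rewrite !inE => /andP[].
Qed.

(** The unforced elements of [P] form a union of classes, and the marks of forced elements are
    unchanged. *)
Lemma sorted_sum (P : pred T) : (forall c d, twin c d -> P c -> P d) ->
  #|[pred c | P c && sorted_mark c]| = #|[pred c | P c && m0 c]|.
Proof.
move=> Ptwin; rewrite -!sum1_card.
rewrite (bigID unforced) [RHS](bigID unforced) /=; congr (_ + _); last first.
  apply: eq_bigl => c; rewrite !inE; case uc: (unforced c); rewrite ?andbF //.
  by rewrite /sorted_mark uc.
pose rep c := odflt c [pick d | twin c d].
have rep_in c : unforced c -> twin c (rep c).
  by rewrite /rep => uc; case: pickP => [//|/(_ c)]; rewrite twin_refl.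
have repE c d : unforced c -> unforced d -> (rep c == rep d) = twin c d.
  move=> uc ud; apply/eqP/idP => [e|cd].
    by rewrite (twin_trans (rep_in c uc)) e -(twin_trans (rep_in d ud)) twin_refl.
  rewrite /rep (eq_pick (twin_trans cd)); case: pickP => // /(_ d).
  by rewrite twin_refl.
rewrite (partition_big rep predT) // [RHS](partition_big rep predT) //=.
apply: eq_bigr => r _.
case: (pickP (fun c => [&& P c, unforced c & rep c == r])) => [c /and3P[Pc uc /eqP <-]|none].
  have cls (mm : T -> bool) : \sum_(i | (i \in [pred c | P c && mm c]) && unforced i && (rep i ==
      rep c)) 1
     = #|[pred d | twin c d && mm d]|.
    rewrite -sum1_card; apply: eq_bigl => d; rewrite !inE.
    case ud: (unforced d); last first.
      by rewrite andbF /=; apply/esym/negP => /andP[/twinP[_ [h _]]]; rewrite h in ud.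
    rewrite andbT eq_sym (repE _ _ uc ud).
    case cd: (twin c d); rewrite ?andbF //= andbT.
    by rewrite (Ptwin _ _ cd Pc).
  by rewrite !cls sorted_class.
by rewrite !big_pred0 // => c; rewrite !inE; move: (none c); case: (P c) => //=; case: (unforced c);
   rewrite ?andbF //= => ->; rewrite andbF.
Qed.

Hypothesis m0P : admissible m0.

Lemma sorted_admissible : admissible sorted_mark.
Proof.
have [H0 H1 Hc] := m0P; split=> [c c0|c c1|u cu].
- by rewrite /sorted_mark /unforced c0 /= H0.
- by rewrite /sorted_mark /unforced c1 andbF H1.
rewrite sorted_sum; last by move=> c d /twinP[_ [_ /(_ u cu)[-> _]]].
rewrite Hc //; apply/eqP; rewrite -(eqn_add2l #|[pred c | high u c && m0 c]|).
have comp (mm : T -> bool) : #|[pred c | high u c && mm c]| + #|[pred c | high u c && ~~ mm c]| =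
    #|high u|.
  rewrite -(cardID [pred c | mm c] (high u)); congr (_ + _); apply: eq_card => c;
  by rewrite !inE // andbC.
rewrite comp -sorted_sum ?comp // => c d /twinP[_ [_ /(_ u cu)[_ ->]]] //.
Qed.

(** Forced elements are handled by [F1_up] and [F0_down]. Two unforced elements related by [implies]
    lie in the same cells, so they are twins, and the order inside their class decides. *)
Lemma sorted_monotone : monotone sorted_mark.
Proof.
have [H0 H1 _] := sorted_admissible.
move=> c d cd mc; case c1: (F1 c); first by apply: H1; apply: F1_up cd c1.
case c0: (F0 c); first by move: (H0 c c0); rewrite mc.
case d1: (F1 d); first exact: H1.
case d0: (F0 d); first by rewrite (F0_down pI vI cd d0) in c0.
have uc : unforced c by rewrite /unforced c0 c1.
have ud : unforced d by rewrite /unforced d0 d1.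
have tw : twin c d.
  rewrite /twin uc ud /=; apply/forallP => u; apply/implyP => cu.
  apply/andP; split; apply/eqP; apply/idP/idP => h.
  - by apply: (low_up pI vI cu h cd); rewrite c0.
  - by apply: (low_down pI vI cu h cd); rewrite c0.
  - by apply: (high_up pI vI cu h cd); rewrite d1.
  - by apply: (high_down pI vI cu h cd); rewrite d1.
move: mc; rewrite /sorted_mark uc ud => lt.
have <- : #|[pred e | twin c e && m0 e]| = #|[pred e | twin d e && m0 e]|.
  by apply: eq_card => e; rewrite !inE (twin_trans tw).
apply: leq_ltn_trans lt; apply: subset_leq_card; apply/subsetP => e.
rewrite !inE (twin_trans tw) => /andP[-> /=]; apply: ltn_trans.
by case/impliesP: cd => a [b]; rewrite /ascending; lia.
Qed.
End Sorting.

(** In each cell, the [i]-th marked low element and the [i]-th unmarked high one are exchanged;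
    elements that no cell counts stay fixed. The cardinality condition makes this possible. *)
Lemma admissible_pairing m : admissible m ->
  exists2 tau : T -> T, injective tau & forall c, pairable c (tau c).
Proof.
case=> H0 H1 Hc.
pose A u : pred T := [pred c | low u c && m c].
pose D u : pred T := [pred c | high u c && ~~ m c].
pose tau c := if m c then
     if [pick u | cell u && low u c] is Some u then nth c (enum (D u)) (index c (enum (A u))) else c
   else if [pick u | cell u && high u c] is Some u then nth c (enum (A u)) (index c (enum (D u)))
     else c.
have tA u c : cell u -> A u c -> tau c \in D u /\ index (tau c) (enum (D u)) = index c (enum (A u)).
  move=> cu /andP[lc mc]; rewrite /tau mc.
  case: pickP => [w /andP[cw lw]|/(_ u)]; last by rewrite cu lc.
  rewrite -(low_uniq pI vI cu cw lc lw).
  have lt : index c (enum (A u)) < size (enum (D u)).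
    by rewrite -cardE -Hc // cardE index_mem mem_enum inE lc.
  split; last by rewrite index_uniq // enum_uniq.
  by rewrite -mem_enum mem_nth.
have tD u c : cell u -> D u c -> tau c \in A u /\ index (tau c) (enum (A u)) = index c (enum (D u)).
  move=> cu /andP[lc mc]; rewrite /tau (negbTE mc).
  case: pickP => [w /andP[cw lw]|/(_ u)]; last by rewrite cu lc.
  rewrite -(high_uniq pI vI cu cw lc lw).
  have lt : index c (enum (D u)) < size (enum (A u)).
    by rewrite -cardE Hc // cardE index_mem mem_enum inE lc.
  split; last by rewrite index_uniq // enum_uniq.
  by rewrite -mem_enum mem_nth.
have cases c : [\/ exists2 u, cell u & A u c, exists2 u, cell u & D u c |
    tau c = c /\ (if m c then ~~ in_low c else ~~ in_high c)].
  rewrite /tau; case mc: (m c).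
    case: pickP => [u /andP[cu lu]|none].
      by apply: Or31; exists u => //; rewrite /A /= lu mc.
    by apply: Or33; split=> //; apply/existsP => -[u]; rewrite none.
  case: pickP => [u /andP[cu lu]|none].
    by apply: Or32; exists u => //; rewrite /D /= lu mc.
  by apply: Or33; split=> //; apply/existsP => -[u]; rewrite none.
have tauK : involutive tau.
  move=> c; case: (cases c) => [[u cu Ac]|[u cu Dc]|[e _]]; last by rewrite !e.
    have [tc e] := tA u c cu Ac; have [ttc e2] := tD u _ cu tc.
    have Ac' : c \in enum (A u) by rewrite mem_enum.
    rewrite -mem_enum in ttc; rewrite -(nth_index c ttc) e2 e nth_index //.
  have [tc e] := tD u c cu Dc; have [ttc e2] := tA u _ cu tc.
  have Dc' : c \in enum (D u) by rewrite mem_enum.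
  by rewrite -mem_enum in ttc; rewrite -(nth_index c ttc) e2 e nth_index.
apply: (ex_intro2 _ _ tau (inv_inj tauK)) => c; rewrite /pairable; case: (cases c) => [[u cu Ac]|[u
  cu Dc]|[-> h]].
- have [/andP[hc mt] _] := tA u c cu Ac; case/andP: Ac => lc mc.
  apply/or3P/Or31/and3P; split; first by apply/existsP; exists u; rewrite cu lc.
    by apply: contraL mc => /H0.
  by apply: contra mt => /H1.
- have [/andP[hc mt] _] := tD u c cu Dc; case/andP: Dc => lc mc.
  apply/or3P/Or32/and3P; split; first by apply/existsP; exists u; rewrite cu hc.
    by apply: contraL mt => /H0.
  by apply: contra mc => /H1.
rewrite eqxx /ok0 /ok1; apply/or3P/Or33; move: h; case mc: (m c) => ->.
  by rewrite !andbT; case c0: (F0 c); rewrite ?orbT //; move: (H0 c c0); rewrite mc.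
by rewrite !andbT; case c1: (F1 c) => //; move: (H1 c c1); rewrite mc.
Qed.
End Selection.

(** * Drawability *)

Section Lines.
Variables (T : finType) (p v : T -> nat).
Hypotheses (pI : injective p) (vI : injective v).
Variable m : T -> bool.
Local Notation inv := (inverted p v).

(** [weight a b] counts the paths to the left of the crossing of [a] and [b], apart from those
    inverted with [a] from the left or with [b] from the right. The omitted paths depend on the
    marks of [a] and [b] only, see [crossing_position]. *)
Definition passes a b c := [&& p c < p b, v c < v a & ~~ (mid p v a b c && m c)].
Definition weight a b := \sum_c (passes a b c : nat).
Definition balanced x y b b' := weight x b + weight y b' = weight x b' + weight y b.

Local Open Scope ring_scope.
Local Notation "⟦ b ⟧" := ((nat_of_bool b%N)%:Z) (at level 0, b at level 200).

(** The mixed second difference of [passes] over the rectangle: in the expansion [passesE], products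
    that depend on the row alone or on the column alone cancel, and two factored terms remain. *)
Definition defect x y b b' c : int :=
  ⟦ ~~ m c ⟧ * ((⟦ p c < p b ⟧ - ⟦ p c < p b' ⟧) * (⟦ v c < v x ⟧ - ⟦ v c < v y ⟧))
  - ⟦ m c ⟧ * ((⟦ p c <= p x ⟧ - ⟦ p c <= p y ⟧) * (⟦ v c <= v b ⟧ - ⟦ v c <= v b' ⟧)).

Lemma passesE a b c : inv a b ->
  ⟦ passes a b c ⟧ = ⟦ p c < p b ⟧ * ⟦ v c < v a ⟧
     - ⟦ m c ⟧ * ((⟦ p c < p b ⟧ - ⟦ p c <= p a ⟧) * (⟦ v c < v a ⟧ - ⟦ v c <= v b ⟧)).
Proof.
rewrite /inv /passes /mid /inverted (ltnNge (p a) (p c)) (ltnNge (v b) (v c)) => /andP[H1 H2].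
have h1 : (p c <= p a)%N -> (p c < p b)%N by lia.
have h2 : (v c <= v b)%N -> (v c < v a)%N by lia.
move: h1 h2.
case: (p c <= p a)%N; case: (p c < p b)%N => h1; try by [move: (h1 isT)].
all: case: (v c <= v b)%N; case: (v c < v a)%N => h2; try by [move: (h2 isT)].
all: by case: (m c).
Qed.

Lemma rectP x y b b' : rect p v x y b b' -> [/\ inv x b, inv x b', inv y b & inv y b'].
Proof. by case/and4P. Qed.

Lemma defect_sum x y b b' : rect p v x y b b' ->
  (weight x b + weight y b')%:Z - (weight x b' + weight y b)%:Z = \sum_c defect x y b b' c.
Proof.
move=> /rectP[i1 i2 i3 i4].
have E a e : inv a e -> (weight a e)%:Z = \sum_c (⟦ p c < p e ⟧ * ⟦ v c < v a ⟧
     - ⟦ m c ⟧ * ((⟦ p c < p e ⟧ - ⟦ p c <= p a ⟧) * (⟦ v c < v a ⟧ - ⟦ v c <= v e ⟧))).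
  move=> i; rewrite /weight (big_morph Posz PoszD (erefl _)).
  by apply: eq_bigr => c _; rewrite passesE.
rewrite !PoszD !E // -!big_split -sumrB; apply: eq_bigr => c _ /=.
rewrite /defect; have -> : ⟦ ~~ m c ⟧ = 1 - ⟦ m c ⟧ by case: (m c).
by ring.
Qed.

Lemma balanced_defect x y b b' : rect p v x y b b' ->
  balanced x y b b' <-> \sum_c defect x y b b' c = 0.
Proof.
move=> /defect_sum <-; rewrite /balanced; split=> [->|]; first by rewrite subrr.
by move/eqP; rewrite subr_eq0 => /eqP[].
Qed.

Definition between (f : T -> nat) a b c := (f a < f c < f b)%N || (f b < f c < f a)%N.

(** Each difference of indicators is a signed indicator of an interval. Strict and weak comparisons
    disagree only when [c] is a corner, and there the other factor of the term is zero. *)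
Lemma defectE x y b b' c : rect p v x y b b' ->
  defect x y b b' c =
   ⟦ ~~ m c ⟧ * ⟦ between p b b' c && between v x y c ⟧ * (if (p b < p b')%N == (v x < v y)%N then
     1 else -1)
   - ⟦ m c ⟧ * ⟦ between p x y c && between v b b' c ⟧ * (if (p x < p y)%N == (v b < v b')%N then 1
       else -1).
Proof.
move=> R; have [i1 i2 i3 i4] := rectP R; rewrite /inv /inverted in i1 i2 i3 i4.
have aux (f : T -> nat) a a' : injective f ->
    f c != f a -> f c != f a' ->
    ⟦ f c < f a ⟧ - ⟦ f c < f a' ⟧ = ⟦ between f a a' c ⟧ * (if (f a < f a')%N then -1 else 1)
  /\ ⟦ f c <= f a ⟧ - ⟦ f c <= f a' ⟧ = ⟦ between f a a' c ⟧ * (if (f a < f a')%N then -1 else 1).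
  move=> fI n1 n2; rewrite /between.
  by case: (ltngtP (f c) (f a)) n1 => //; case: (ltngtP (f c) (f a')) n2 => // h1 _ h2 _;
     case: (ltngtP (f a) (f a')) => h3 //=; split=> //; lia.
have [|nc] := boolP (c \in [:: x; y; b; b']).
  have bz (f : T -> nat) a a' c' : (f c' < f a)%N && (f c' < f a')%N -> ⟦ f c' < f a ⟧ - ⟦ f c' < f
      a' ⟧ = 0 :> int /\ ⟦ (f c' <= f a)%N ⟧ - ⟦ (f c' <= f a')%N ⟧ = 0 :> int.
    by move=> /andP[h1 h2]; rewrite h1 h2 (ltnW h1) (ltnW h2) !subrr.
  have bz' (f : T -> nat) a a' c' : (f a < f c')%N && (f a' < f c')%N -> ⟦ f c' < f a ⟧ - ⟦ f c' <
      f a' ⟧ = 0 :> int /\ ⟦ (f c' <= f a)%N ⟧ - ⟦ (f c' <= f a')%N ⟧ = 0 :> int.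
    move=> /andP[h1 h2]; rewrite (ltnNge (f c') (f a)) (ltnNge (f c') (f a')).
    by rewrite (leqNgt (f c') (f a)) (leqNgt (f c') (f a')) h1 h2 (ltnW h1) (ltnW h2) !subrr.
  have nb f a a' : (f c < f a)%N && (f c < f a')%N || (f a < f c)%N && (f a' < f c)%N -> between f
      a a' c = false.
    by rewrite /between; lia.
  rewrite !inE => /or4P[]/eqP e; subst c; rewrite /defect.
  - have [-> _] := bz p b b' x ltac:(lia); have [_ ->] := bz' v b b' x ltac:(lia).
    by rewrite !(nb p b b') ?(nb v b b') ?andbF ?mulr0 ?mul0r ?mulr0 //; lia.
  - have [-> _] := bz p b b' y ltac:(lia); have [_ ->] := bz' v b b' y ltac:(lia).
    by rewrite !(nb p b b') ?(nb v b b') ?andbF ?mulr0 ?mul0r ?mulr0 //; lia.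
  - have [-> _] := bz v x y b ltac:(lia); have [_ ->] := bz' p x y b ltac:(lia).
    by rewrite !(nb v x y) ?(nb p x y) ?andbF ?mulr0 ?mul0r ?mulr0 //; lia.
  - have [-> _] := bz v x y b' ltac:(lia); have [_ ->] := bz' p x y b' ltac:(lia).
    by rewrite !(nb v x y) ?(nb p x y) ?andbF ?mulr0 ?mul0r ?mulr0 //; lia.
move: nc; rewrite !inE !negb_or => /and4P[n1 n2 n3 n4].
rewrite /defect.
have [-> _] := aux p b b' pI ltac:(by rewrite (inj_eq pI)) ltac:(by rewrite (inj_eq pI)).
have [_ ->] := aux p x y pI ltac:(by rewrite (inj_eq pI)) ltac:(by rewrite (inj_eq pI)).
have [-> _] := aux v x y vI ltac:(by rewrite (inj_eq vI)) ltac:(by rewrite (inj_eq vI)).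
have [_ ->] := aux v b b' vI ltac:(by rewrite (inj_eq vI)) ltac:(by rewrite (inj_eq vI)).
case: (p b < p b')%N; case: (v x < v y)%N; case: (p x < p y)%N; case: (v b < v b')%N => /=;
case: (between p b b' c); case: (between v x y c); case: (between p x y c); case: (between v b b'
  c);
by case: (m c).
Qed.

Definition irregular x y b b' :=
  ~~ (((p x < p y)%N == (v x < v y)%N) && ((p b < p b')%N == (v b < v b')%N)).

Lemma F0_irregular c : F0 p v c <-> exists x y b b',
  [/\ rect p v x y b b', between p x y c, between v b b' c & irregular x y b b'].
Proof.
split=> [/F0P[x [y [b [b' /and4P[R h1 h2 h3]]]]]|[x [y [b [b' [R h1 h2 h3]]]]]].
  by exists x, y, b, b'; rewrite /between h1 h2; split=> //; rewrite /irregular; lia.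
move: h1 h2; rewrite /between.
have [i1 i2 i3 i4] := rectP R; rewrite /inv /inverted in i1 i2 i3 i4.
case/orP=> h1 /orP[]h2; apply/F0P; rewrite /irregular in h3; rewrite /rect /inverted.
- by exists x, y, b, b'; lia.
- by exists x, y, b', b; lia.
- by exists y, x, b, b'; lia.
- by exists y, x, b', b; lia.
Qed.

Lemma F1_irregular c : F1 p v c <-> exists x y b b',
  [/\ rect p v x y b b', between p b b' c, between v x y c & irregular x y b b'].
Proof.
split=> [/F1P[x [y [b [b' /and4P[R h1 h2 h3]]]]]|[x [y [b [b' [R h1 h2 h3]]]]]].
  by exists x, y, b, b'; rewrite /between h1 h2; split=> //; rewrite /irregular; lia.
move: h1 h2; rewrite /between.
have [i1 i2 i3 i4] := rectP R; rewrite /inv /inverted in i1 i2 i3 i4.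
case/orP=> h1 /orP[]h2; apply/F1P; rewrite /irregular in h3; rewrite /rect /inverted.
- by exists x, y, b, b'; lia.
- by exists y, x, b, b'; lia.
- by exists x, y, b', b; lia.
- by exists y, x, b', b; lia.
Qed.

(** If exactly one of the two orders is reversed, the sums of [U] and [V] enter the balance with the
    same sign, and being nonnegative they vanish. If both are reversed, the sums are equal, but a
    marked element counted in [V] and an unmarked one counted in [U] would violate monotonicity, so
    one sum is zero. *)
Lemma irregular_forced x y b b' : monotone p v m -> rect p v x y b b' ->
  x != y -> b != b' -> irregular x y b b' -> balanced x y b b' ->
  (forall c, between p x y c -> between v b b' c -> ~~ m c) /\
  (forall c, between p b b' c -> between v x y c -> m c).
Proof.
move=> mono R xy bb irr /(balanced_defect R).
under eq_bigr => c _ do rewrite (defectE c R).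
have [i1 i2 i3 i4] := rectP R; rewrite /inv /inverted in i1 i2 i3 i4.
have ne (f : T -> nat) (a a' : T) : injective f -> a != a' -> f a != f a' :> nat by move=> fI;
    rewrite (inj_eq fI).
have [[[n1 n2] n3] n4] := (ne _ _ _ pI xy, ne _ _ _ vI xy, ne _ _ _ pI bb, ne _ _ _ vI bb).
pose U c := ⟦ ~~ m c ⟧ * ⟦ between p b b' c && between v x y c ⟧.
pose V c := ⟦ m c ⟧ * ⟦ between p x y c && between v b b' c ⟧.
have U0 c : 0 <= U c by rewrite /U; case: (m c); case: (_ && _).
have V0 c : 0 <= V c by rewrite /V; case: (m c); case: (_ && _).
suff H : (\sum_c U c = 0 /\ \sum_c V c = 0) -> \sum_c U c = 0 /\ \sum_c V c = 0.
  move=> S; have [sU sV] : \sum_c U c = 0 /\ \sum_c V c = 0.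
    move: S; rewrite -/(U _) -/(V _).
    set e1 := (if _ then 1 else -1); set e2 := (if _ then 1 else -1).
    rewrite sumrB -!mulr_suml -/(\sum_c U c) -/(\sum_c V c).
    have [/eqP e12|/eqP e12] := boolP (e1 == e2); last first.
      have -> : e2 = - e1 by move: e12; rewrite /e1 /e2; do 2 case: ifP.
      have : 0 <= \sum_c U c by apply: sumr_ge0. 
      have : 0 <= \sum_c V c by apply: sumr_ge0.
      by rewrite /e1; case: ifP; lia.
    rewrite -e12 -mulrBl => /eqP; rewrite mulf_eq0 => /orP[|]; last by rewrite /e1; case: ifP.
    rewrite subr_eq0 => /eqP eq.
    have dbl : (p x < p y)%N != (v x < v y)%N /\ (p b < p b')%N != (v b < v b')%N.
      by move: e12 irr; rewrite /e1 /e2 /irregular; case: (p x < p y)%N; case: (v x < v y)%N; case: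
        (p b < p b')%N; case: (v b < v b')%N.
    suff sV0 : \sum_c V c = 0 by rewrite eq sV0.
    case: (pickP (fun c => V c != 0)) => [c Vc|V0']; last by apply: big1 => c _; apply/eqP/negPn;
      rewrite V0'.
    rewrite -eq; apply: big1 => d _; rewrite /U.
    case md: (m d); first by rewrite mul0r.
    case h: (_ && _); last by rewrite mulr0.
    exfalso; move: Vc; rewrite /V; case mc: (m c); last by rewrite mul0r.
    case h2: (_ && _); last by rewrite mulr0.
    suff cd : implies p v c d by have := mono c d cd mc; rewrite md.
    move: h h2; rewrite /between => h h2.
    apply/impliesP; rewrite /ascending; case: dbl => d1 d2.
    case: (ltnP (p x) (p y)) => hx; case: (ltnP (v b) (v b')) => hb.
    - by exists x, b; lia.
    - by exists x, b'; lia.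
    - by exists y, b; lia.
    - by exists y, b'; lia.
  have zU c : U c = 0 by apply/eqP; move/eqP: sU; rewrite psumr_eq0 // => /allP/(_ c); rewrite
      mem_index_enum => /(_ isT).
  have zV c : V c = 0 by apply/eqP; move/eqP: sV; rewrite psumr_eq0 // => /allP/(_ c); rewrite
      mem_index_enum => /(_ isT).
  split=> c h1 h2.
    by apply/negP => mc; have := zV c; rewrite /V mc h1 h2.
  by apply/negPn/negP => /negbTE mc; have := zU c; rewrite /U mc h1 h2.
by [].
Qed.

Definition drawable := exists x y : T -> int, forall a b, inv a b -> y b - x a = (weight a b)%:Z.

Lemma drawable_balanced x y b b' : drawable -> rect p v x y b b' -> balanced x y b b'.
Proof.
move=> [X [Y H]] /rectP[/H h1 /H h2 /H h3 /H h4]; rewrite /balanced.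
by apply/eqP; rewrite -eqz_nat !PoszD -h1 -h2 -h3 -h4; apply/eqP; ring.
Qed.

Lemma cell_rect u : cell p v u -> rect p v (qa u) (qa' u) (qb u) (qb' u).
Proof. by move=> /cellP[? ? ? _ _]; rewrite /rect /inverted; lia. Qed.

Lemma cell_defect u : cell p v u ->
  \sum_c defect (qa u) (qa' u) (qb u) (qb' u) c =
  #|[pred d | high p v u d && ~~ m d]|%:Z - #|[pred c | low p v u c && m c]|%:Z.
Proof.
move=> cu; have R := cell_rect cu; have [h1 h2 h3 _ _] := cellP cu.
under eq_bigr => c _ do rewrite (defectE c R).
have -> : (p (qb u) < p (qb' u))%N == (v (qa u) < v (qa' u))%N by lia.
have -> : (p (qa u) < p (qa' u))%N == (v (qb u) < v (qb' u))%N by lia.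
rewrite sumrB -!sum1_card !(big_morph Posz PoszD (erefl _)) !(big_mkcond (fun c => c \in _)) /=.
have eh c : between p (qb u) (qb' u) c && between v (qa u) (qa' u) c = high p v u c.
  by rewrite /between /high; lia.
have el c : between p (qa u) (qa' u) c && between v (qb u) (qb' u) c = low p v u c.
  by rewrite /between /low; lia.
congr (_ - _); apply: eq_bigr => c _; rewrite inE mulr1 ?eh ?el.
  by case: high; case: (m c).
by case: low; case: (m c).
Qed.

Lemma drawable_admissible : monotone p v m -> drawable -> admissible p v m.
Proof.
move=> mono dr; have irrP x y b b' : rect p v x y b b' -> irregular x y b b' ->
    (forall c, between p x y c -> between v b b' c -> ~~ m c) /\
    (forall c, between p b b' c -> between v x y c -> m c).
  move=> R irr; have [->|xy] := eqVneq x y.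
    by split=> c; rewrite /between; lia.
  have [->|bb] := eqVneq b b'; first by split=> c; rewrite /between; lia.
  by apply: irregular_forced => //; apply: drawable_balanced.
split=> [c /F0_irregular[x [y [b [b' [R h1 h2 h3]]]]]|c /F1_irregular[x [y [b [b' [R h1 h2
  h3]]]]]|u cu].
- by have [H _] := irrP _ _ _ _ R h3; apply: H.
- by have [_ H] := irrP _ _ _ _ R h3; apply: H.
have /(balanced_defect (cell_rect cu)) := drawable_balanced dr (cell_rect cu).
by rewrite cell_defect // => /eqP; rewrite subr_eq0 => /eqP[].
Qed.

Lemma irregular_balanced x y b b' : admissible p v m -> rect p v x y b b' ->
  irregular x y b b' -> balanced x y b b'.
Proof.
move=> [H0 H1 _] R irr; apply/(balanced_defect R); apply: big1 => c _; rewrite (defectE c R).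
have h0 : between p x y c -> between v b b' c -> ~~ m c.
  by move=> h1 h2; apply: H0; apply/F0_irregular; exists x, y, b, b'.
have h1 : between p b b' c -> between v x y c -> m c.
  by move=> h1 h2; apply: H1; apply/F1_irregular; exists x, y, b, b'.
move: h0 h1; case: (between p x y c); case: (between v b b' c);
  case: (between p b b' c); case: (between v x y c); case: (m c) => //= h h';
  rewrite ?mul0r ?subrr //; solve [by have := h isT isT | by have := h' isT isT].
Qed.

(* Adjacent records are compared along the chain of minima separating [b] and
   [b']; the bounding minima are reached through irregular rectangles. *)
Lemma records_balanced a a' b b' : admissible p v m -> next_record p v a a' ->
  rect p v a a' b b' -> balanced a a' b b'.
Proof.
move=> adm nr.
have balC x y c d : balanced x y c d -> balanced x y d c.
  by rewrite /balanced => ->.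
have bal_trans x y c d e : balanced x y c d -> balanced x y d e -> balanced x y c e.
  rewrite /balanced; lia.
have [pa va ra] := next_recordP nr.
pose adj e := inv a e && inv a' e.
have minima : forall k e e', (p e' - p e <= k)%N -> adj e -> adj e' -> (p e <= p e')%N ->
    (forall f, (p e <= p f)%N -> (v e <= v f)%N) -> (forall f, (p e' <= p f)%N -> (v e' <= v f)%N)
      ->
    balanced a a' e e'.
  elim=> [|k IH] e e' le ae ae' pe me me'.
    by have -> : e = e' by apply: pI; lia.
  have [->//|ne] := eqVneq e e'.
  have pe2 : (p e < p e')%N by move: ne; rewrite -(inj_eq pI); lia.
  have [n pn nmin] : exists2 n, (p e < p n)%N & forall f, (p e < p f)%N -> (v n <= v f)%N.
    by case: (@arg_minnP _ e' (fun f => p e < p f)%N v pe2) => n ? ?; exists n.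
  have ven : (v e < v n)%N.
    by rewrite ltn_neqAle me ?(ltnW pn) // andbT (inj_eq vI); apply: contraTneq pn => ->; rewrite
      ltnn.
  have nm : next_minimum p v e n.
    by rewrite /next_minimum pn ven; apply/forallP => f; apply/implyP; apply: nmin.
  have vn : (v n <= v e')%N by apply: nmin.
  have an : adj n by move: ae ae' ; rewrite /adj /inverted; lia.
  have pn' : (p n <= p e')%N by rewrite leqNgt; apply/negP => h; have := me' n (ltnW h); move:
      (inj_eq vI n e'); have := inj_eq pI n e'; lia.
  have cu : cell p v (a, a', e, n).
    by move: ae an; rewrite /cell /qa /qa' /qb /qb' nr nm /adj /inverted /=; lia.
  have bn : balanced a a' e n.
    have [_ _ /(_ _ cu) h] := adm; apply/(balanced_defect (cell_rect cu)).
    by rewrite (cell_defect cu) h subrr.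
  apply: bal_trans bn _; apply: IH => //; first by lia.
  by move=> f; rewrite leq_eqVlt => /orP[/eqP/pI -> //|]; move=> h; apply: nmin; lia.
have to_min e : adj e -> exists n, [/\ adj n, (p e <= p n)%N, (v n <= v e)%N,
    (forall f, (p n <= p f)%N -> (v n <= v f)%N) & balanced a a' e n /\ (forall f, (p e <= p f)%N
      -> (v n <= v f)%N)].
  move=> ae; case: (@arg_minnP _ e (fun f => (p e <= p f)%N) v (leqnn _)) => n pn nmin.
  have vn := nmin e (leqnn _).
  have an : adj n by move: ae; rewrite /adj /inverted; lia.
  exists n; split=> //; first by move=> f h; apply: nmin; lia.
  split=> //; have [->//|ne] := eqVneq e n.
  apply: irregular_balanced => //; first by move: ae an; rewrite /adj /rect; lia.
  by move: ne; rewrite /irregular -(inj_eq pI) => ne; have := inj_eq vI e n; have := inj_eq pI e n;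
    lia.
move=> /rectP[i1 i2 i3 i4].
have ab : adj b by rewrite /adj i1.
have ab' : adj b' by rewrite /adj i2.
wlog le : b b' i1 i2 i3 i4 ab ab' / (p b <= p b')%N => [W|].
  by case: (leqP (p b) (p b')) => [|/ltnW] h; [apply: W | apply/balC/W].
have [n [an pn vn mn [bn nb]]] := to_min b ab.
have [n' [an' pn' vn' mn' [bn' nb']]] := to_min b' ab'.
apply: (bal_trans _ _ _ _ _ bn); apply: (bal_trans _ _ _ n'); last exact: balC.
case: (leqP (p n) (p n')) => h; first exact: (minima (p n' - p n)%N).
apply/balC; apply: (minima (p n - p n')%N) => //; exact: ltnW.
Qed.

(** Rows are added by increasing position. A column that meets the new row [a] and some old row also
    meets the old row [d] of largest value, so consistency concerns only [d] and [a]: either they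
    are consecutive records, or their rectangles are irregular. Each row adds at most one weight to
    [x] and another to [y], whence the factor 2 in the bound. *)
Lemma admissible_drawable : admissible p v m ->
  exists x y : T -> int, [/\ forall a b, inv a b -> y b - x a = (weight a b)%:Z,
     forall a, `|x a| <= (2 * #|T| * #|T|)%:Z & forall a, `|y a| <= (2 * #|T| * #|T|)%:Z].
Proof.
move=> adm.
have wle a b : (weight a b <= #|T|)%N.
  rewrite /weight -sum1_card; apply: leq_sum => c _; by case: passes.
pose Inv k (D : {set T}) (x y : T -> int) := [/\ forall a b, a \in D -> inv a b -> y b - x a =
  (weight a b)%:Z,
     forall a, `|x a| <= (2 * #|T| * k)%:Z & forall a, `|y a| <= (2 * #|T| * k)%:Z].
suff : forall k, (k <= #|T|)%N -> exists (D : {set T}) (x y : T -> int), [/\ #|D| = k, Inv k D x y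
  & forall a e, a \in D -> (p e < p a)%N -> e \in D].
  move=> /(_ _ (leqnn _))[D [x [y [cD [H1 H2 H3] _]]]]; exists x, y; split=> // a b; apply: H1.
  by rewrite (_ : D = setT) ?inE //; apply/eqP; rewrite eqEcard subsetT cardsT cD leqnn.
elim=> [|k IH] kT.
  exists set0, (fun=> 0), (fun=> 0); split; rewrite ?cards0 //; last by move=> a e; rewrite inE.
  by split=> [a b|a|a]; rewrite ?inE ?normr0.
have [D [x [y [cD [H1 H2 H3] Ddown]]]] := IH (ltnW kT).
have [a0 a0D] : exists a, a \notin D.
  by apply/existsP; rewrite -negb_forall; apply/negP => /forallP h; move: kT; rewrite -cD (_ : D =
    setT) ?cardsT ?ltnn //; apply/setP => e; rewrite h inE.
case: (@arg_minnP _ a0 (fun a => a \notin D) p a0D) => a aD amin {a0 a0D}.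
have Dlt e : e \in D -> (p e < p a)%N.
  by move=> eD; rewrite ltnNge; apply/negP => h; have [/pI ea|ne] := eqVneq (p a) (p e);
     [rewrite ea eD in aD | rewrite (Ddown e a eD) in aD => //; lia].
have Dlt' e : (p e < p a)%N -> e \in D.
  by move=> h; apply/negPn/negP => /amin; lia.
pose M := [pick d in D | [forall e, (e \in D) ==> (v e <= v d)%N]].
have MP : (forall d, M = Some d -> d \in D /\ forall e, e \in D -> (v e <= v d)%N) /\ (M = None ->
    D = set0).
  rewrite /M; split.
    by move=> d; case: pickP => // d' /andP[dD /forallP h] [<-]; split=> // e eD; move: (h e);
      rewrite eD.
  case: pickP => // none _; apply/eqP; rewrite -subset0; apply/subsetP => d dD; exfalso.
  case: (@arg_maxnP _ d (mem D) v dD) => d' d'D h; have /negP := none d'; apply.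
  by have -> : d' \in D by []; apply/forallP => e; apply/implyP => eD; apply: h.
case: MP; set Mx := M => Msome Mnone; move: Msome Mnone; rewrite {}/Mx => Msome Mnone.
(* the elements whose height is already determined *)
pose old b := (if M is Some d then inv d b else false) && inv a b.
have oldP b d : d \in D -> inv d b -> inv a b -> old b.
  rewrite /old; case EM: M => [d'|]; last by rewrite (Mnone EM) inE.
  have [d'D h] := Msome _ EM; move=> dD; have := h d dD; have := Dlt d' d'D.
  by rewrite /inverted; lia.
have oldD b : old b -> exists2 d, M = Some d & [/\ d \in D, inv d b & inv a b].
  rewrite /old; case EM: M => [d|] // /andP[db ab]; exists d => //.
  by have [? _] := Msome _ EM.
pose xa := if [pick b | old b] is Some b then y b - (weight a b)%:Z else 0.
(* Balance makes the value of [xa] independent of the old column from which it is read. *)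
have xaP b : old b -> xa = y b - (weight a b)%:Z.
  rewrite /xa => ob; case: pickP => [b0 ob0|/(_ b)]; last by rewrite ob.
  have [d EM [dD db ab]] := oldD b ob; have [d' EM' [_ db0 ab0]] := oldD b0 ob0.
  move: EM'; rewrite EM => -[e]; subst d'.
  have R : rect p v d a b b0 by rewrite /rect db db0 ab.
  have bal : balanced d a b b0.
    have [d'D dmax] := Msome _ EM; have pda := Dlt d dD.
    case: (ltnP (v d) (v a)) => vda; last first.
      have [->|nb] := eqVneq b b0; first by rewrite /balanced.
      apply: irregular_balanced => //; rewrite /irregular; lia.
    apply: records_balanced => //; rewrite /next_record pda vda.
    by apply/forallP => e; apply/implyP => pe; apply: dmax; apply: Dlt'.
  have := H1 d b dD db; have := H1 d b0 dD db0; move: bal; rewrite /balanced; lia.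
pose x' e := if e == a then xa else x e.
pose y' b := if inv a b && ~~ old b then xa + (weight a b)%:Z else y b.
exists (a |: D), x', y'; split.
- by rewrite cardsU1 aD cD.
- split=> [d b|e|e].
  + rewrite !inE /x' /y'; case: eqVneq => [->|da] /= h ib.
      rewrite ib /=; case ob: (old b) => /=; last by lia.
      by rewrite (xaP _ ob); lia.
    case: ifP => [/andP[ia /negP no]|_]; last exact: H1.
    by case: no; apply: oldP h ib ia.
  + rewrite /x'; case: ifP => _; last by have := H2 e; lia.
    rewrite /xa; case: pickP => [b0 _|_]; last by rewrite normr0; lia.
    by have := H3 b0; have := wle a b0; lia.
  + rewrite /y'; case: ifP => _; last by have := H3 e; lia.
    have := wle a e; rewrite /xa; case: pickP => [b0 _|_]; last by lia.
    by have := H3 b0; have := wle a b0; lia.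
move=> d e; rewrite !inE => /orP[/eqP ->|dD] pe; first by rewrite Dlt' ?orbT.
by rewrite (Ddown d e) ?orbT.
Qed.
End Lines.

(** * Crossings and inversions *)

Section Swaps.
Variable n : nat.
Implicit Types (pi rho : 'S_n) (i j : 'I_n.-1) (s : seq 'I_n.-1).

Definition posn pi (x : 'I_n) : nat := (pi^-1)%g x.

Lemma posnK pi (x : 'I_n) (q : 'I_n) : pi q = x -> posn pi x = q.
Proof. by move=> <-; rewrite /posn permK. Qed.

Lemma posn_inj pi : injective (posn pi).
Proof. by move=> x y /ord_inj /perm_inj. Qed.

Lemma swapE pi i q : swap pi i q =
  if q == left_pos i then pi (right_pos i) else if q == right_pos i then pi (left_pos i) else pi q.
Proof.
rewrite /swap permM; case: tpermP => [->|->|/eqP/negbTE -> /eqP/negbTE ->] //; first by rewrite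
  eqxx.
by rewrite eqxx; case: eqP => // h; have := congr1 val h; rewrite /= => ?; lia.
Qed.

Lemma foldl_swap s pi : pairwise (@apart n) s ->
  (forall i, i \in s -> foldl (@swap n) pi s (left_pos i) = pi (right_pos i) /\
                        foldl (@swap n) pi s (right_pos i) = pi (left_pos i)) /\
  (forall q, (forall i, i \in s -> q != left_pos i /\ q != right_pos i) ->
     foldl (@swap n) pi s q = pi q).
Proof.
elim: s pi => [|j s IH] pi //= /andP[/allP js ps].
have [H1 H2] := IH (swap pi j) ps.
have nej i : apart j i -> [/\ left_pos i != left_pos j, left_pos i != right_pos j,
    right_pos i != left_pos j & right_pos i != right_pos j].
  by rewrite /apart -!val_eqE /= => h; split; lia.
split=> [i|q hq].
  rewrite inE; case: eqVneq => [->|ne] /= si.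
    have h q : q = left_pos j \/ q = right_pos j -> forall i0, i0 \in s -> q != left_pos i0 /\ q !=
        right_pos i0.
      by move=> hq i0 /js /nej[a b c d]; case: hq => ->; split; rewrite eq_sym.
    rewrite !H2 ?swapE ?eqxx; try by apply: h; auto.
    by split=> //; case: eqP => // h'; have := congr1 val h'; rewrite /= => ?; lia.
  have [-> ->] := H1 i si; have [a b c d] := nej i (js i si).
  by rewrite !swapE (negbTE a) (negbTE b) (negbTE c) (negbTE d).
rewrite H2 => [|i si]; last by apply: hq; rewrite inE si orbT.
by have [a b] := hq j (mem_head _ _); rewrite swapE (negbTE a) (negbTE b).
Qed.

Definition local_move pi rho := forall x : 'I_n, posn rho x = posn pi x \/
  exists y, [/\ posn rho x = posn pi y, posn rho y = posn pi x &
     posn pi y = (posn pi x).+1 \/ posn pi x = (posn pi y).+1].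

Lemma adjacent_local pi rho : adjacent pi rho -> local_move pi rho.
Proof.
have sw a b : obtained_by_swaps a b -> local_move a b.
  case=> s ps -> x; have [H1 H2] := foldl_swap a ps.
  set q := (a^-1)%g x; have ax : a q = x by rewrite permKV.
  case: (pickP (fun i => (i \in s) && ((q == left_pos i) || (q == right_pos i)))) => [i|none].
    case/andP=> /H1[h1 h2] /orP[]/eqP e; right.
      exists (a (right_pos i)); rewrite (posnK h1) -ax e (posnK h2) !(posnK (erefl _)) /=.
      by split=> //; left.
    exists (a (left_pos i)); rewrite (posnK h2) -ax e (posnK h1) !(posnK (erefl _)) /=.
    by split=> //; right.
  left; rewrite (@posnK _ x q); first by rewrite /posn.
  by rewrite H2 // => i si; move: (none i); rewrite si /= => /norP.
case=> /sw // h x; case: (h x) => [->|[y [e1 e2 e3]]]; [by left | right].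
by exists y; rewrite e1 e2; split=> //; case: e3; auto.
Qed.

Definition inversions pi : {set 'I_n * 'I_n} :=
  [set ab | inverted (posn pi) (@nat_of_ord n) ab.1 ab.2].

Lemma position_posn (T : seq 'S_n) x t : position T x t = posn (at_time T t) x :> nat.
Proof. by []. Qed.

Lemma posn1 (x : 'I_n) : posn 1%g x = x.
Proof. by rewrite /posn invg1 perm1. Qed.

Lemma crossing_exists (T : seq 'S_n) (a b : 'I_n) :
  (posn (at_time T 0) a < posn (at_time T 0) b) -> at_time T (duration T) = 1%g -> b < a ->
  exists2 t, t < duration T & crosses_at T a b t.
Proof.
move=> h0 h1 ba.
have ex : exists t, (t <= duration T) && (posn (at_time T t) b < posn (at_time T t) a).
  by exists (duration T); rewrite leqnn h1 !posn1.
case: (ex_minnP ex) => t /andP[tD lt] mn.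
case: t tD lt mn => [|t] tD lt mn; first by lia.
exists t => //; rewrite /crosses_at !position_posn lt andbT.
have := mn t; rewrite (ltnW tD) /= ltnn => h.
have nb : ~~ (posn (at_time T t) b < posn (at_time T t) a).
  by apply/negP => /h.
have ne : posn (at_time T t) a != posn (at_time T t) b.
  by apply: contraTneq ba => /posn_inj ->; rewrite ltnn.
lia.
Qed.

Lemma crossingsE (T : seq 'S_n) : crossings T =
  \sum_(xy : 'I_n * 'I_n) \sum_(t < duration T) (crosses_at T xy.1 xy.2 t : nat).
Proof.
rewrite exchange_big; apply: eq_bigr => t _.
by rewrite -sum1_card big_mkcond; apply: eq_bigr => xy _; rewrite inE; case: crosses_at.
Qed.

Lemma inversions_le_crossings pi (T : seq 'S_n) : solves pi T -> #|inversions pi| <= crossings T.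
Proof.
move=> [_ [h0 h1] _ _ _]; rewrite crossingsE -sum1_card big_mkcond.
apply: leq_sum => -[a b] _ /=; rewrite inE /=; case: ifP => // /andP[/= pab ba].
have [|t tD ct] := @crossing_exists T a b _ h1 ba; first by rewrite h0.
by rewrite (bigD1 (Ordinal tD)) //= ct.
Qed.

Lemma descent pi : pi != 1%g -> exists i : 'I_n.-1, pi (right_pos i) < pi (left_pos i).
Proof.
move=> p1; apply/existsP; apply: contraR p1; rewrite negb_exists => /forallP H.
have mono : forall k (q r : 'I_n), r = k + q :> nat -> pi q + k <= pi r.
  elim=> [|k IH] q r e; first by rewrite addn0 (_ : q = r) //; apply: val_inj; rewrite /= e.
  have lt : (k + q) < n.-1 by have := ltn_ord r; lia.
  have := IH q (left_pos (Ordinal lt)) (erefl _); move: (H (Ordinal lt)).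
  have -> : right_pos (Ordinal lt) = r by apply: val_inj; rewrite /= e.
  have : pi (left_pos (Ordinal lt)) != pi r :> nat.
    rewrite (inj_eq (@ord_inj _)) (inj_eq perm_inj) -val_eqE /= e; lia.
  rewrite /= -leqNgt; lia.
apply/eqP/permP => q; rewrite perm1; apply: ord_inj; apply/eqP; rewrite eqn_leq.
have n0 : 0 < n by have := ltn_ord q; lia.
have l : n.-1 < n by lia.
have := mono (n.-1 - q) q (Ordinal l) ltac:(have := ltn_ord q; rewrite /=; lia).
have := mono q (Ordinal n0) q ltac:(rewrite /=; lia).
have := ltn_ord (pi (Ordinal l)); lia.
Qed.

Lemma posn_swap pi i x : posn (swap pi i) x = tperm (left_pos i) (right_pos i) ((pi^-1)%g x).
Proof. by rewrite /posn /swap invMg permM tpermV. Qed.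

Lemma crossings_cons pi (T : seq 'S_n) : 0 < size T -> crossings (pi :: T) =
  #|[set xy : 'I_n * 'I_n | (posn pi xy.1 < posn pi xy.2) && (posn (at_time T 0) xy.2 < posn
    (at_time T 0) xy.1)]| + crossings T.
Proof.
rewrite /crossings /duration; case: T => [|rho T] //= _.
by rewrite big_ord_recl.
Qed.

(** Bubble sort: exchanging a descent costs one crossing and removes an inversion. *)
Lemma sorting_tangle k pi : #|inversions pi| <= k -> exists T : seq 'S_n,
  [/\ tangle T, at_time T 0 = pi, at_time T (duration T) = 1%g & crossings T <= k].
Proof.
elim: k pi => [|k IH] pi; have [->|p1] := eqVneq pi 1%g.
- by exists [:: 1%g]; split=> //; solve [by split | by rewrite /crossings big_ord0].
- have [i di] := descent p1; rewrite leqn0 cards_eq0 => /eqP/setP/(_ (pi (left_pos i), pi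
    (right_pos i))).
  by rewrite !inE /inverted !(posnK (erefl _)) /= leqnn di.
- by exists [:: 1%g]; split=> //; solve [by split | by rewrite /crossings big_ord0].
have [i di] := descent p1; set ab := (pi (left_pos i), pi (right_pos i)) => le.
have key x y : x != y -> (x, y) != ab -> (y, x) != ab ->
    (posn (swap pi i) x < posn (swap pi i) y) = (posn pi x < posn pi y).
  move=> xy n1 n2; rewrite !posn_swap /posn; set q := (pi^-1)%g x; set r := (pi^-1)%g y.
  have e1 : x = pi q by rewrite permKV.
  have e2 : y = pi r by rewrite permKV.
  have qr : q != r by apply: contraNneq xy => e; rewrite e1 e2 e.
  move: n1 n2; rewrite e1 e2 /ab !xpair_eqE !(inj_eq perm_inj).
  move: qr; case: tpermP => [->|->|/eqP+ /eqP+]; case: tpermP => [->|->|/eqP+ /eqP+];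
    rewrite -?val_eqE /= ?eqxx //=; lia.
have abswap : ~~ (posn (swap pi i) ab.1 < posn (swap pi i) ab.2).
  by rewrite !posn_swap /ab /= !permK tpermL tpermR /=; lia.
have abpi : posn pi ab.1 < posn pi ab.2 by rewrite /ab !(posnK (erefl _)) /=.
have sub : inversions (swap pi i) \proper inversions pi.
  apply/properP; split; last first.
    by exists ab; rewrite !inE /inverted ?(negbTE abswap) // abpi.
  apply/subsetP => -[x y]; rewrite !inE /inverted /= => /andP[h1 h2]; rewrite h2 andbT.
  have xy : x != y by apply: contraTneq h2 => ->; rewrite ltnn.
  have [e|n1] := eqVneq (x, y) ab; first by move: abswap; rewrite -e /= h1.
  have [e|n2] := eqVneq (y, x) ab; last by rewrite -key.
  by move: e h2 di; rewrite /ab => -[-> ->]; lia.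
have [T [tT T0 T1 cT]] := IH (swap pi i) ltac:(have := proper_card sub; lia).
have sT : 0 < size T by case: tT.
exists (pi :: T); split=> //.
- split=> // -[|t] /=; last by move=> h; case: tT => _; apply; move: h; rewrite /duration /=; lia.
  by move=> _; left; exists [:: i].
- by move: T1 sT; rewrite /duration /at_time; case: (T).
rewrite crossings_cons // T0 -addn1 addnC leq_add //.
rewrite -(cards1 ab); apply: subset_leq_card; apply/subsetP => -[x y]; rewrite !inE /= => /andP[h1
  h2].
have xy : x != y by apply: contraTneq h1 => ->; rewrite ltnn.
apply/negPn/negP => n1; have [e|n2] := eqVneq (y, x) ab.
  by move: h1 abpi; rewrite -e /=; lia.
by move: h2; rewrite key // ?(eq_sym y) //; lia.
Qed.

(** The lower bound by inversions is attained by bubble sort, once its first and last permutations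
    are repeated as the convention on tangles demands. *)
Lemma simple_crossings pi (T : seq 'S_n) : simple_tangle pi T <-> solves pi T /\ crossings T =
    #|inversions pi|.
Proof.
split=> [[sT mT]|[sT cT]]; last first.
  by split=> // T' /inversions_le_crossings; rewrite cT.
split=> //; apply/eqP; rewrite eqn_leq inversions_le_crossings // andbT.
have [T0 [[s0 tT] h0 h1 cT]] := sorting_tangle (leqnn #|inversions pi|).
pose T1 := pi :: rcons T0 1%g.
have at0 : nth 1%g T0 0 = pi by [].
have atl : nth 1%g T0 (size T0).-1 = 1%g by [].
have atT1 t : at_time T1 t = if t == 0 then pi else at_time T0 t.-1.
  by case: t => //= t; rewrite /at_time /T1 /= nth_rcons; case: (ltnP t (size T0)) => h //; rewrite
    [RHS]nth_default //; case: eqP.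
have dT1 : duration T1 = (size T0).+1 by rewrite /duration /= size_rcons.
have at_l : at_time T0 (size T0) = 1%g by rewrite /at_time nth_default.
have sol : solves pi T1.
  split; rewrite ?dT1 ?atT1 //.
  - split=> // t; rewrite dT1 => tl; rewrite !atT1.
    case: t tl => [|t] tl /=; first by left; exists [::].
    case: (ltnP t (duration T0)) => h; first exact: tT.
    have e : t = duration T0 by move: h tl; rewrite /duration; lia.
    have e2 : at_time T0 t.+1 = at_time T0 t.
      by rewrite e h1 -at_l; congr (at_time T0 _); rewrite /duration; lia.
    by left; exists [::].
  - rewrite /= at_l; case E: (size T0) s0 => [|k] //= _.
    by move: h1; rewrite /duration E.
apply: leq_trans (mT _ sol) _; apply: leq_trans cT.
rewrite /T1 crossings_cons ?size_rcons //.
have -> : [set xy : 'I_n * 'I_n | (posn pi xy.1 < posn pi xy.2) && (posn (at_time (rcons T0 1%g) 0)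
    xy.2 < posn (at_time (rcons T0 1%g) 0) xy.1)] = set0.
  apply/setP => xy; rewrite !inE; have -> : at_time (rcons T0 1%g) 0 = pi by rewrite /at_time
    nth_rcons s0.
  lia.
rewrite cards0 add0n /crossings /duration size_rcons /=.
case E: (size T0) s0 => [|k] //= _; rewrite big_ord_recr /=.
have -> : [set xy : 'I_n * 'I_n | crosses_at (rcons T0 1%g) xy.1 xy.2 k] = set0.
  apply/setP => xy; rewrite !inE /crosses_at !position_posn /at_time !nth_rcons E ltnSn ltnn eqxx.
  have -> : nth 1%g T0 k = 1%g by move: h1; rewrite /at_time /duration E.
  lia.
rewrite cards0 addn0; apply: leq_sum => t _; apply: eq_leq; congr (#|pred_of_set _|).
apply/setP => xy; rewrite !inE /crosses_at !position_posn /at_time !nth_rcons E.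
by have lt := ltn_ord t; rewrite !ltnS (ltnW lt) lt.
Qed.
End Swaps.

(** * Realization of a marking *)

Section Schedule.
Variables (n : nat) (pi : 'S_n) (R L tR tL : 'I_n -> nat) (K : nat).

Definition moveR x t := tR x <= t < tR x + R x.
Definition moveL x t := tL x <= t < tL x + L x.
(** The differences inside the minima are truncated on purpose: a path waits until its segment
    starts. The outer one is not, by [Lpos]. *)
Definition place x t := posn pi x + minn (t - tR x) (R x) - minn (t - tL x) (L x).

Hypothesis K0 : 0 < K.
Hypothesis tR0 : forall x, 0 < tR x.
Hypothesis tL0 : forall x, 0 < tL x.
Hypothesis tRK : forall x, tR x + R x < K.
Hypothesis tLK : forall x, tL x + L x < K.
Hypothesis Lpos : forall x, L x <= posn pi x.
Hypothesis RL_end : forall x, posn pi x + R x = x + L x.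
Hypothesis disjoint : forall x t, moveR x t -> moveL x t -> False.
Hypothesis partnerR : forall x t, moveR x t ->
  exists2 y, moveL y t & place y t = (place x t).+1.
Hypothesis partnerL : forall y t, moveL y t ->
  exists2 x, moveR x t & place y t = (place x t).+1.
Hypothesis Rsum : \sum_x R x = #|inversions pi|.

Lemma place_step x t : [/\ moveR x t -> place x t.+1 = (place x t).+1,
  moveL x t -> place x t = (place x t.+1).+1 &
  ~~ moveR x t -> ~~ moveL x t -> place x t.+1 = place x t].
Proof.
have := Lpos x; have := @disjoint x t; rewrite /moveR /moveL /place => h1 h2.
split=> [h|h|h h']; move: h1; rewrite ?h; lia.
Qed.

Lemma place0 x t : t <= 1 -> place x t = posn pi x.
Proof. by have := tR0 x; have := tL0 x; rewrite /place; lia. Qed.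

Lemma place_end x t : K.-1 <= t -> place x t = x.
Proof.
have := tRK x; have := tLK x; have := Lpos x; have := RL_end x; rewrite /place; lia.
Qed.

(** By induction on [t]: moving paths come in neighbouring pairs that exchange places, so paths
    neither collide nor leave the range. *)
Lemma place_valid t : injective (place^~ t) /\ forall x, place x t < n.
Proof.
elim: t => [|t [inj bnd]].
  by split=> [x y|x]; rewrite !place0 //; [exact: posn_inj | exact: ltn_ord].
have bR x : moveR x t -> (place x t).+1 < n.
  by move=> /partnerR[y _ <-].
split=> [x y|x]; last first.
  have [hR hL h0] := place_step x t; have := bnd x.
  case mR: (moveR x t); first by rewrite hR // => _; apply: bR.
  case mL: (moveL x t); first by have := hL mL; lia.
  by rewrite h0 ?mR ?mL.
have [xR xL x0] := place_step x t; have [yR yL y0] := place_step y t.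
have clashR a b : moveR a t -> place b t = (place a t).+1 -> moveL b t.
  by move=> /partnerR[c cL e] e'; rewrite -(inj c b) // e e'.
have clashL a b : moveL a t -> place a t = (place b t).+1 -> moveR b t.
  by move=> /partnerL[c cL e] e'; rewrite -(inj c b) //; move: e; rewrite e' => -[].
case mxR: (moveR x t); case mxL: (moveL x t); try by case: (disjoint mxR mxL).
all: case myR: (moveR y t); case myL: (moveL y t); try by case: (disjoint myR myL).
all: rewrite ?(xR mxR) ?(yR myR) ?(x0 (negbT mxR) (negbT mxL)) ?(y0 (negbT myR) (negbT myL)).
- by move=> [] /inj.
- have := yL myL; move=> h e; have [c cR e2] := partnerL myL.
  have [d dL e3] := partnerR mxR.
  have ecd : c = d by apply: inj; lia.
  by case: (@disjoint c t); rewrite // ecd.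
- by move=> e; have := clashR x y mxR (esym e); rewrite myL.
- have := xL mxL; move=> h e; have [c cR e2] := partnerL mxL.
  have [d dL e3] := partnerR myR.
  have ecd : c = d by apply: inj; lia.
  by case: (@disjoint c t); rewrite // ecd.
- by have := xL mxL; have := yL myL; move=> h h' e; apply: inj; lia.
- have := xL mxL; move=> h e; have := clashL x y mxL; rewrite myR h -e => /(_ (erefl _)) //.
- by move=> e; have := clashR y x myR e; rewrite mxL.
- have := yL myL; move=> h e; have := clashL y x myL; rewrite mxR h -e => /(_ (erefl _)) //.
- by move/inj.
Qed.

Lemma perm_at t : {rho : 'S_n | forall x, posn rho x = place x t}.
Proof.
have [inj bnd] := place_valid t.
have fI : injective (fun x => Ordinal (bnd x)) by move=> x y [] /inj.
by exists (perm fI)^-1%g => x; rewrite /posn invgK permE.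
Qed.

Lemma schedule_adjacent rho rho' t : (forall x, posn rho x = place x t) ->
  (forall x, posn rho' x = place x t.+1) -> adjacent rho rho'.
Proof.
move=> h h'; have [inj bnd] := place_valid t; left.
pose s := [seq i <- enum 'I_n.-1 | moveR (rho (left_pos i)) t].
have pl i : place (rho i) t = i by rewrite -h /posn permK.
have sR i : i \in s -> moveR (rho (left_pos i)) t by rewrite mem_filter => /andP[].
have sL i : i \in s -> moveL (rho (right_pos i)) t.
  move=> /sR /partnerR[y yL e]; have -> // : rho (right_pos i) = y.
  by apply: inj; rewrite e !pl.
have ap : pairwise (@apart n) s.
  have us : uniq s by rewrite filter_uniq // enum_uniq.
  have : pairwise (fun i j : 'I_n.-1 => i != j) s by rewrite -uniq_pairwise.
  have no (a b : 'I_n.-1) : a \in s -> b \in s -> b = a.+1 :> nat -> False.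
    move=> sa sb e; apply: (disjoint (sR b sb)).
    by have -> : left_pos b = right_pos a; [apply: val_inj | apply: sL].
  have sub : {in s &, forall i j, i != j -> apart i j}.
    move=> i j si sj; have := no i j si sj; have := no j i sj si; rewrite /apart -val_eqE /=; lia.
  by apply: (sub_in_pairwise sub); apply/allP.
exists s => //; have [H1 H2] := foldl_swap rho ap.
apply/permP => q; set x := rho' q.
have qx : place x t.+1 = q by rewrite -h' /posn permK.
have e0 : rho' q = x by [].
have [xR xL x0] := place_step x t.
case mR: (moveR x t).
  have lt : place x t < n.-1 by have := xR mR; have := ltn_ord q; lia.
  have ex : rho (left_pos (Ordinal lt)) = x by apply: inj; rewrite pl.
  have si : Ordinal lt \in s by rewrite mem_filter ex mR mem_enum.
  have eq : q = right_pos (Ordinal lt) by apply: val_inj; rewrite /= -qx xR.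
  by have [_ h1] := H1 _ si; rewrite [in RHS]eq h1 ex.
case mL: (moveL x t).
  have [y yR e] := partnerL mL; have exL := xL mL.
  have lt : place y t < n.-1 by have := ltn_ord q; have := bnd x; lia.
  have ey : rho (left_pos (Ordinal lt)) = y by apply: inj; rewrite pl.
  have si : Ordinal lt \in s by rewrite mem_filter ey yR mem_enum.
  have eq : q = left_pos (Ordinal lt) by apply: val_inj; rewrite /=; lia.
  have [h1 _] := H1 _ si; rewrite [in RHS]eq h1; apply: inj.
  by rewrite pl e.
have ex : rho q = x by apply: inj; rewrite pl -qx x0 ?mR ?mL.
rewrite H2 // => i si; split; apply/eqP => eq.
  by have := sR i si; rewrite -eq ex mR.
by have := sL i si; rewrite -eq ex mL.
Qed.

Lemma posn_ext (rho rho' : 'S_n) : (forall x, posn rho x = posn rho' x) -> rho = rho'.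
Proof.
by move=> h; apply: invg_inj; apply/permP => x; apply: ord_inj; apply: h.
Qed.

Theorem schedule_perfect : exists T : seq 'S_n,
  [/\ size T = K.+1, forall t x, t <= K -> posn (at_time T t) x = place x t & perfect_tangle pi T].
Proof.
pose rho t := sval (perm_at t).
have rhoP t x : posn (rho t) x = place x t by rewrite /rho; case: (perm_at t).
pose T := mkseq rho K.+1.
have atT t : t <= K -> at_time T t = rho t by move=> tK; rewrite /at_time nth_mkseq.
have dT : duration T = K by rewrite /duration size_mkseq.
have posT t x : t <= K -> position T x t = place x t :> nat.
  by move=> tK; rewrite position_posn atT.
have stepT t x : t < K -> step T x t = ((moveR x t)%:Z - (moveL x t)%:Z)%R.
  move=> tK; rewrite /step !posT // ?(ltnW tK) //.
  have [hR hL h0] := place_step x t; have d := @disjoint x t.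
  case mR: (moveR x t); case mL: (moveL x t) => //=.
  - by case: d.
  - by rewrite hR //; lia.
  - by have := hL mL; lia.
  - by rewrite h0 ?mR ?mL //; lia.
exists T; split; rewrite ?size_mkseq //.
  have sol : solves pi T.
    split; rewrite ?dT //.
    - split; first by rewrite size_mkseq.
      move=> t; rewrite dT => tK; rewrite !atT ?(ltnW tK) //.
      by apply: (@schedule_adjacent _ _ t) => x; apply: rhoP.
    - rewrite !atT //; split; apply: posn_ext => x; rewrite rhoP.
        by rewrite place0.
      by rewrite place_end ?posn1 // leq_pred.
    - by rewrite !atT //; apply: posn_ext => x; rewrite !rhoP !place0.
    - by rewrite !atT ?leq_pred //; apply: posn_ext => x; rewrite !rhoP !place_end //; lia.
  split.
    apply/simple_crossings; split=> //; apply/eqP; rewrite eqn_leq inversions_le_crossings // andbT.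
    rewrite -Rsum /crossings dT.
    (* A crossing at time [t] is determined by its path moving right, so the crossings are at most
       the total length of the R-segments, which is the number of inversions. *)
    apply: (@leq_trans (\sum_(t < K) \sum_x (moveR x t : nat))).
      apply: leq_sum => t _; have tK := ltn_ord t.
      have cr x y : crosses_at T x y t -> moveR x t /\ place y t = (place x t).+1.
        rewrite /crosses_at !posT // ?(ltnW tK) // => /andP[lt1 lt2].
        have [hR hL h0] := place_step x t; have [kR kL k0] := place_step y t.
        have dx := @disjoint x t; have dy := @disjoint y t.
        have ub : place y t <= (place y t.+1).+1.
          case nL: (moveL y t); first by rewrite kL.
          by case nR: (moveR y t); rewrite ?kR ?k0 ?nR ?nL //; lia.
        case mR: (moveR x t); last first.
          have : place x t.+1 <= place x t.
            by case mL: (moveL x t); [rewrite hL | rewrite h0 ?mR ?mL].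
          lia.
        by split=> //; have := hR mR; lia.
      have [inj _] := place_valid t.
      rewrite (_ : \sum_x _ = #|[set x | moveR x t]|); last first.
        by rewrite -sum1_card [RHS]big_mkcond; apply: eq_bigr => x _; rewrite inE; case: moveR.
      rewrite -(@card_in_imset _ _ fst).
        by apply: subset_leq_card; apply/subsetP => x /imsetP[xy]; rewrite !inE => /cr[h _] ->.
      move=> [x y] [x' y']; rewrite !inE => /cr /= [_ e] /cr /= [_ e'] ex.
      by subst x'; congr pair; apply: inj; rewrite e e'.
    rewrite exchange_big /=; apply: leq_sum => x _; rewrite -(big_mkord xpredT (fun t => (moveR x t
      : nat))).
    have b1 : tR x <= K by have := tRK x; lia.
    rewrite (@big_cat_nat _ _ _ (tR x)) //= [X in X + _]big_nat_cond big1 ?add0n; last by rewrite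
      /moveR => i; lia.
    rewrite (@big_cat_nat _ _ _ (tR x + R x)) //= ?leq_addr //; last by have := tRK x; lia.
    rewrite [X in _ + X]big_nat_cond [X in _ + X]big1 ?addn0; last by rewrite /moveR => i; lia.
    rewrite (_ : \sum_(_ <= _ < _) _ = \sum_(tR x <= i < tR x + R x) 1); last first.
      by apply: eq_big_nat => i; rewrite /moveR => ->.
    by rewrite sum_nat_const_nat; lia.
  (* The steps equal to [c] fill one interval, so a segment with this slope lies in it and by
     maximality is all of it. *)
  have seg (mv : 'I_n -> nat -> bool) (s0 l : 'I_n -> nat) (c : int) x :
      (forall t, mv x t = (s0 x <= t < s0 x + l x)) -> s0 x + l x < K ->
      (forall t, t < K -> (step T x t == c) = mv x t) ->
      forall s e, segment T x s e -> step T x s = c -> s = s0 x /\ e = s0 x + l x.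
    move=> mvE lK st s e [[/andP[se eD] h] mx] sc; rewrite dT in eD.
    have inr t : s <= t < e -> s0 x <= t < s0 x + l x.
      by move=> te; rewrite -mvE -st ?h ?sc //; lia.
    have [i1 i2] := (inr s ltac:(lia), inr e.-1 ltac:(lia)).
    suff [e1 e2] : s0 x = s /\ s0 x + l x = e by split.
    apply: mx; try lia; split; first by rewrite dT; lia.
    have cst t : s0 x <= t < s0 x + l x -> step T x t = c.
      by move=> ht; apply/eqP; rewrite st ?mvE //; lia.
    by move=> t ht; rewrite !cst //; lia.
  move=> x; split.
    have u := seg moveL tL L (-1)%R x (fun t => erefl) (tLK x).
    have stL t : t < K -> (step T x t == (-1)%R) = moveL x t.
      by move=> tK; rewrite stepT //; have := @disjoint x t; case: moveR; case: moveL => //= d;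
        case: d.
    have neg s e : L_segment T x s e -> step T x s = (-1)%R.
      move=> [[[/andP[se eD] _] _]]; rewrite stepT; last by rewrite dT in eD; lia.
      by case: moveR; case: moveL.
    move=> s e s' e' h h'; have [-> ->] := u stL s e h.1 (neg _ _ h).
    by have [-> ->] := u stL s' e' h'.1 (neg _ _ h').
  have u := seg moveR tR R 1%R x (fun t => erefl) (tRK x).
  have stR t : t < K -> (step T x t == 1%R) = moveR x t.
    by move=> tK; rewrite stepT //; have := @disjoint x t; case: moveR; case: moveL => //= d; case:
      d.
  have pos s e : R_segment T x s e -> step T x s = 1%R.
    move=> [[[/andP[se eD] _] _]]; rewrite stepT; last by rewrite dT in eD; lia.
    by case: moveR; case: moveL.
  move=> s e s' e' h h'; have [-> ->] := u stR s e h.1 (pos _ _ h).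
  by have [-> ->] := u stR s' e' h'.1 (pos _ _ h').
Qed.
End Schedule.

(** * The order of crossings along a segment *)

Section Ranks.
Variables (T : finType) (p v : T -> nat).
Hypotheses (pI : injective p) (vI : injective v).
Variable m : T -> bool.
Hypothesis mono : monotone p v m.
Local Notation inv := (inverted p v).
Local Notation ll := (ascending p v).
Local Notation passes := (passes p v m).
Local Notation weight := (weight p v m).

Definition cntR a := #|[pred b | inv a b]|.
Definition cntL b := #|[pred a | inv a b]|.
Definition cntN c := #|[pred e | ll e c]|.

(* [before d b]: a path inverted with both crosses [d] before [b]. *)
Definition before d b :=
  (p d < p b) && ~~ ((v b < v d) && m d) || [&& p b < p d, v d < v b & m b].
Definition rank a b := #|[pred d | inv a d && before d b]|.

Lemma card_sum (P : pred T) : #|P| = \sum_c (P c : nat).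
Proof. by rewrite -sum1_card big_mkcond; apply: eq_bigr => c _; rewrite unfold_in; case: (P c). Qed.

Lemma same_point c d : (p c == p d) = (v c == v d).
Proof. by rewrite (inj_eq pI) (inj_eq vI). Qed.

(** Increased by [m a * cntL a], both sides are the position of the crossing: on the left by
    counting the paths to its left, on the right by following the R-segment of [a] from its start.
    The identity holds for each [c] separately. *)
Lemma rank_weight a b : inv a b -> weight a b + m b * cntR b = cntN a + rank a b.
Proof.
move=> /andP[h1 h2]; rewrite /weight /cntR /cntN /rank !card_sum big_distrr -!big_split /=.
apply: eq_bigr => c _; rewrite /passes /before /mid /inverted /ascending.
have ea := same_point c a; have eb := same_point c b.
case: (ltngtP (p c) (p a)) ea => h3; case: (ltngtP (v c) (v a)) => h4 //= _;
case: (ltngtP (p c) (p b)) eb => h5; case: (ltngtP (v c) (v b)) => h6 //= _; try lia.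
all: by case: (m b); case: (m c).
Qed.

Lemma before_irr d : ~~ before d d.
Proof. by rewrite /before !ltnn. Qed.

Lemma before_total d e : d != e -> before d e || before e d.
Proof.
rewrite -(inj_eq pI) /before; have := same_point d e.
case: (ltngtP (p d) (p e)) => // _; case: (ltngtP (v d) (v e)) => //= _ _ _; case: (m d); case: (m
  e) => //.
Qed.

(** In a cyclic configuration one of the three elements would imply another, with [a] and the third
    one as witnesses, against monotonicity. *)
Lemma before_trans a x y z : inv a x -> inv a y -> inv a z ->
  before x y -> before y z -> before x z.
Proof.
move=> ax ay az.
have mono' c d b : p a < p c -> v d < v a -> p c < p d < p b -> v b < v c < v d -> m c -> m d.
  by move=> *; apply: (@mono c d) => //; apply/impliesP; exists a, b; rewrite /ascending; lia.
have exy := same_point x y; have eyz := same_point y z; have exz := same_point x z.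
have m1 := mono' x y z; have m2 := mono' z x y; have m3 := mono' y z x.
move: ax ay az; rewrite /inverted /before => /andP[a1 a2] /andP[a3 a4] /andP[a5 a6].
case/orP=> [/andP[h1 h2]|/and3P[h1 h2 h3]] /orP[/andP[k1 k2]|/and3P[k1 k2 k3]].
- rewrite (ltn_trans h1 k1) /=; apply/orP; left; apply/negP => /andP[w1 w2].
  move: h2 k2; rewrite w2 andbT -leqNgt => le; rewrite negb_and.
  have lt : v x < v y by move: exy; lia.
  by rewrite (ltn_trans w1 lt) (m1 a1 a4 _ _ w2) // ?h1 ?k1 ?w1.
- case: (ltngtP (p x) (p z)) exz => hx exz.
  + apply/orP; left; apply/negP => /andP[w1 w2].
    by move: h2; rewrite w2 (ltn_trans k2 w1).
  + rewrite k3 andbT /= ltn_neqAle -exz /= leqNgt; apply/negP => w.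
    by move: h2; rewrite (ltn_trans k2 w) (m2 a5 a2 _ _ k3) ?hx ?h1 ?k2 ?w.
  + have e : x = z by apply: pI.
    by move: h2; rewrite e k2 k3.
- have lt : v y < v z by move: k2 eyz; rewrite h3; lia.
  have lt2 := ltn_trans h2 lt.
  case: (ltngtP (p x) (p z)) exz => hx exz.
  + by rewrite ltnNge (ltnW lt2).
  + by rewrite lt2 (m3 a3 a6 _ _ h3) // ?k1 ?hx ?h2.
  + by move: exz => /esym/eqP; lia.
- by rewrite (ltn_trans k1 h1) (ltn_trans h2 k2) k3 orbT.
Qed.

Lemma rank_lt a b : inv a b -> rank a b < cntR a.
Proof.
move=> ab; apply: proper_card; apply/properP; split.
  by apply/subsetP => d; rewrite !inE => /andP[].
by exists b; rewrite !inE ?ab // (negbTE (before_irr b)) andbF.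
Qed.

Lemma rank_before a b d : inv a b -> inv a d -> before b d -> rank a b < rank a d.
Proof.
move=> ab ad bd; apply: proper_card; apply/properP; split.
  by apply/subsetP => e; rewrite !inE => /andP[ae eb]; rewrite ae (before_trans ae ab ad eb bd).
by exists b; rewrite !inE ?ab ?bd // (negbTE (before_irr b)).
Qed.

Lemma rank_onto a i : i < cntR a -> exists2 b, inv a b & rank a b = i.
Proof.
move=> ia; have inj : {in [pred b | inv a b] &, injective (rank a)}.
  move=> b d; rewrite !inE => ab ad e; apply/eqP/negPn/negP => /before_total/orP[]h.
    by have := rank_before ab ad h; rewrite e ltnn.
  by have := rank_before ad ab h; rewrite e ltnn.
have c1 := count_rank_lt inj (fun d ad => rank_lt ad) ia.
have c2 := count_rank_lt inj (fun d ad => rank_lt ad) (ltnW ia).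
case: (pickP [pred b | inv a b & rank a b == i]) => [b /andP[ab /eqP e]|none]; first by exists b.
suff : i.+1 = i by lia.
rewrite -[LHS]c1 -[RHS]c2; apply: eq_card => b; rewrite !inE ltnS leq_eqVlt.
by have := none b; rewrite /=; case: (inv a b) => //= ->.
Qed.

Lemma mark_weight_true a b c e : mid p v a b c -> m c ->
  passes a b e + ll e c <= passes a c e + passes c b e.
Proof.
rewrite /mid /inverted => /andP[/andP[h1 h2] /andP[h3 h4]] mc.
have me : p c < p e < p b -> v c < v e < v a -> m e.
  by move=> *; apply: (@mono c e) => //; apply/impliesP; exists a, b; rewrite /ascending; lia.
move: me; rewrite /passes /mid /inverted /ascending.
have ea := same_point e a; have eb := same_point e b; have ec := same_point e c.
case: (ltngtP (p e) (p c)) ec => k1; case: (ltngtP (v e) (v c)) => k2 //= _.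
all: case: (ltngtP (p e) (p a)) ea => k3; case: (ltngtP (v e) (v a)) => k4 //= _; try (exfalso;
  lia).
all: case: (ltngtP (p e) (p b)) eb => k5; case: (ltngtP (v e) (v b)) => k6 //= _; try (exfalso;
  lia).
all: try by case: (m e).
all: try by move=> /(_ isT isT) ->.
all: by have ecc : e = c by [apply: pI]; rewrite ecc mc.
Qed.

Lemma mark_weight_false a b c e : mid p v a b c -> ~~ m c ->
  passes a c e + passes c b e + (e == c) <= passes a b e + ll e c.
Proof.
rewrite /mid /inverted => /andP[/andP[h1 h2] /andP[h3 h4]] mc.
have me : p a < p e < p c -> v b < v e < v c -> ~~ m e.
  move=> *; apply: contra mc; apply: (@mono e c) => //.
  by apply/impliesP; exists a, b; rewrite /ascending; lia.
rewrite -(inj_eq pI); move: me; rewrite /passes /mid /inverted /ascending.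
have ea := same_point e a; have eb := same_point e b; have ec := same_point e c.
case: (ltngtP (p e) (p c)) ec => k1; case: (ltngtP (v e) (v c)) => k2 //= _.
all: case: (ltngtP (p e) (p a)) ea => k3; case: (ltngtP (v e) (v a)) => k4 //= _; try (exfalso;
  lia).
all: case: (ltngtP (p e) (p b)) eb => k5; case: (ltngtP (v e) (v b)) => k6 //= _; try (exfalso;
  lia).
all: try by case: (m e).
all: try by move=> /(_ isT isT) /negbTE ->.
all: by have ecc : e = c by [apply: pI]; rewrite ecc (negbTE mc).
Qed.

(** The right side minus [weight a b] is [Y c - X c] in a solution. Together with
    [weight_mark_false], comparing it with [cntN c] recovers the mark of [c], which is how
    [lines_order] finds the segments of [c] in the marked order. *)
Lemma weight_mark_true a b c : mid p v a b c -> m c ->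
  weight a b + cntN c <= weight a c + weight c b.
Proof.
move=> h mc; rewrite /weight /cntN card_sum -!big_split /=.
by apply: leq_sum => e _; apply: mark_weight_true.
Qed.

Lemma weight_mark_false a b c : mid p v a b c -> ~~ m c ->
  weight a c + weight c b < weight a b + cntN c.
Proof.
move=> h mc; rewrite /weight /cntN card_sum -!big_split /= -addn1.
apply: (@leq_trans (\sum_e (passes a c e + passes c b e + (e == c)))).
  by rewrite [X in _ <= X]big_split /= leq_add2l (bigD1 c) //= eqxx leq_addr.
by apply: leq_sum => e _; apply: mark_weight_false.
Qed.
End Ranks.

(** * Reversal of time, which exchanges [p] with [v] and L with R and keeps the marking *)

Section Swap.
Variables (T : finType) (p v : T -> nat).

Lemma inv_swap a b : inverted v p a b = inverted p v b a.
Proof. by rewrite /inverted andbC. Qed.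

Lemma ll_swap a b : ascending v p a b = ascending p v a b.
Proof. by rewrite /ascending andbC. Qed.

Lemma weight_swap m a b : weight v p m b a = weight p v m a b.
Proof.
by apply: eq_bigr => c _; rewrite /passes /mid !inv_swap (andbC (inverted p v c b)) andbCA.
Qed.

Lemma monotone_swap m : monotone p v m -> monotone v p m.
Proof.
move=> h c d /impliesP[a [b H]]; apply: h; apply/impliesP; exists b, a.
by move: H; rewrite ll_swap; case/and5P=> -> -> -> -> ->.
Qed.

Lemma cntN_swap c : cntN v p c = cntN p v c.
Proof. by apply: eq_card => e; rewrite !inE ll_swap. Qed.

Lemma cntR_swap c : cntR v p c = cntL p v c.
Proof. by apply: eq_card => e; rewrite !inE inv_swap. Qed.
End Swap.

Section Realize.
Variables (n : nat) (pi : 'S_n).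
Local Notation p := (posn pi).
Local Notation v := (@nat_of_ord n).
Variable m : 'I_n -> bool.
Hypothesis mono : monotone p v m.
Variables (X Y : 'I_n -> nat).
Hypothesis XY : forall a b, inverted p v a b -> Y b = X a + weight p v m a b.
Local Notation L := (cntL p v).
Local Notation R := (cntR p v).
Local Notation N := (cntN p v).

(** Undoing [mark_drawable], the line of the R-segment is [t - pos = 2 * (X a - m a * L a)], entered
    at position [N a + m a * L a]; that of the L-segment is [t + pos = 2 * (Y b + m b * R b) + 1],
    entered at [N b + L b + m b * R b]. All times are delayed by [n + 1] to make them positive. *)
Definition startR a := n.+1 + 2 * X a + N a - m a * L a.
Definition startL b := n.+2 + 2 * Y b + m b * R b - N b - L b.

Let pI : injective p := @posn_inj n pi.
Let vI : injective v := @ord_inj n.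

Lemma card_below (f : 'I_n -> nat) k : injective f -> (forall e, f e < n) -> k <= n ->
  #|[pred e | f e < k]| = k.
Proof.
move=> fI fn kn; have h : #|[pred d | predT d && (f d < k)]| = k.
  by apply: count_rank_lt; rewrite ?card_ord // => x y _ _ /fI.
by apply: etrans h; apply: eq_card => e; rewrite !inE.
Qed.

Lemma posn_count x : p x = N x + L x.
Proof.
have h : #|[pred e | p e < p x]| = p x := card_below pI (fun e => ltn_ord _) (ltnW (ltn_ord _)).
rewrite -{1}h.
rewrite /cntN /cntL !card_sum -big_split; apply: eq_bigr => e _ /=.
rewrite /ascending /inverted; have := inj_eq pI e x; have := inj_eq vI e x.
by case: (ltngtP (v e) (v x)); case: (ltngtP (p e) (p x)) => // _ _ <-.
Qed.

Lemma val_count (x : 'I_n) : x = N x + R x :> nat.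
Proof.
have h : #|[pred e | v e < v x]| = v x := card_below vI (@ltn_ord n) (ltnW (ltn_ord x)).
rewrite -{1}h.
rewrite /cntN /cntR !card_sum -big_split; apply: eq_bigr => e _ /=.
rewrite /ascending /inverted; have := inj_eq pI e x; have := inj_eq vI e x.
by case: (ltngtP (v e) (v x)); case: (ltngtP (p e) (p x)) => // _ _ <-.
Qed.

Lemma NL_lt x : N x + L x < n.
Proof. by rewrite -posn_count; apply: ltn_ord. Qed.

Lemma NR_lt x : N x + R x < n.
Proof. by rewrite -val_count; apply: ltn_ord. Qed.

(** Choose [a] and [b] that cross [c]: the equations for [(a, c)], [(c, b)] and [(a, b)] express
    [Y c - X c] by weights alone. *)
Lemma lines_order c : 0 < L c -> 0 < R c ->
  if m c then startR c + R c <= startL c else startL c + L c <= startR c.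
Proof.
move=> /card_gt0P[a]; rewrite inE => ac /card_gt0P[b]; rewrite inE => cb.
have ab : inverted p v a b by move: ac cb; rewrite /inverted; lia.
have md : mid p v a b c by rewrite /mid ac cb.
have e1 := XY ac; have e2 := XY cb; have e3 := XY ab.
have := NL_lt c; have := NR_lt c; rewrite /startR /startL.
case mc: (m c).
  by have := weight_mark_true pI vI mono md mc; lia.
by have := weight_mark_false pI vI mono md (negbT mc); lia.
Qed.

(** By time reversal, this counts the crossings on the L-segment of [b] from its end. *)
Definition lrank b a := rank v p m b a.

Lemma lrank_weight a b : inverted p v a b -> weight p v m a b + m a * L a = N b + lrank b a.
Proof.
move=> ab; have ba : inverted v p b a by rewrite inv_swap.
by have := rank_weight vI pI m ba; rewrite weight_swap cntR_swap cntN_swap.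
Qed.

Lemma crossing_time a b : inverted p v a b ->
  startR a + rank p v m a b + lrank b a + 1 = startL b + L b.
Proof.
move=> ab; have := rank_weight pI vI m ab; have := lrank_weight ab; have := XY ab.
have := NL_lt a; have := NR_lt b; have := NL_lt b; rewrite /startR /startL.
by case: (m a); case: (m b); lia.
Qed.

Lemma lrank_lt a b : inverted p v a b -> lrank b a < L b.
Proof. by rewrite -inv_swap -cntR_swap; apply: rank_lt. Qed.

Lemma meeting a b t : inverted p v a b -> t = startR a + rank p v m a b ->
  [/\ moveR R startR a t, moveL L startL b t &
      place pi R L startR startL b t = (place pi R L startR startL a t).+1].
Proof.
move=> ab et; have ct := crossing_time ab; have rl := rank_lt m ab; have ascending := lrank_lt ab.
have Ra : 0 < R a by lia.
have Lb : 0 < L b by lia.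
have w1 := rank_weight pI vI m ab; have w2 := lrank_weight ab.
split; rewrite /moveR /moveL; try lia.
have pa : place pi R L startR startL a t = N a + m a * L a + rank p v m a b.
  rewrite /place posn_count; case: (posnP (L a)) => La; first by rewrite La; lia.
  by have := lines_order La Ra; case: (m a); lia.
have pb : place pi R L startR startL b t = N b + m b * R b + lrank b a + 1.
  rewrite /place posn_count; case: (posnP (R b)) => Rb; first by rewrite Rb; lia.
  by have := lines_order Lb Rb; case: (m b); lia.
by rewrite pa pb; lia.
Qed.

(** Every step of a segment is the crossing of some rank ([rank_onto]), and [meeting] shows that the
    other path is there at that time. *)
Theorem realize K : (forall x, 2 * X x + 2 * Y x + 5 * n + 5 < K) -> 0 < K ->
  exists T : seq 'S_n, [/\ size T = K.+1,
    forall t x, t <= K -> posn (at_time T t) x = place pi R L startR startL x t & perfect_tangle pi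
      T].
Proof.
move=> hK K0; apply: schedule_perfect => //.
- by move=> x; have := NL_lt x; rewrite /startR; case: (m x); lia.
- by move=> x; have := NL_lt x; rewrite /startL; lia.
- by move=> x; have := NL_lt x; have := NR_lt x; have := hK x; rewrite /startR; lia.
- by move=> x; have := NL_lt x; have := NR_lt x; have := hK x; rewrite /startL; case: (m x); lia.
- by move=> x; rewrite posn_count leq_addl.
- by move=> x; rewrite posn_count; have := val_count x; lia.
- move=> x t; rewrite /moveR /moveL => h1 h2.
  have Lx : 0 < L x by lia.
  have Rx : 0 < R x by lia.
  by have := lines_order Lx Rx; case: (m x); lia.
- move=> a t; rewrite /moveR => h.
  have [|b ab rb] := rank_onto pI vI mono (a := a) (i := t - startR a); first by lia.
  have [|_ h1 h2] := @meeting a b t ab; first by lia.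
  by exists b.
- move=> b t; rewrite /moveL => h.
  have [|a] := rank_onto vI pI (monotone_swap mono) (a := b) (i := startL b + L b - t.+1).
    by rewrite cntR_swap; lia.
  rewrite inv_swap => ab ra.
  have [|h1 _ h2] := @meeting a b t ab; last by exists a.
  by have := crossing_time ab; rewrite /lrank ra; lia.
rewrite /inversions -sum1dep_card.
rewrite (eq_bigr (fun a => \sum_(b | inverted p v a b) 1)); last first.
  by move=> a _; rewrite /cntR -sum1_card; apply: eq_bigl => b; rewrite inE.
by rewrite pair_big_dep /=; apply: eq_bigl => -[a b].
Qed.
End Realize.

(** * The marking of a perfect tangle *)

Section Necessity.
Variables (n : nat) (pi : 'S_n) (T : seq 'S_n).
Hypothesis perfT : perfect_tangle pi T.
Local Notation p := (posn pi).
Local Notation v := (@nat_of_ord n).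
Local Notation D := (duration T).
Local Notation inv := (inverted p v).

Definition pos (x : 'I_n) t := posn (at_time T t) x.
Definition right_move x t := (t < D) && (pos x t.+1 == (pos x t).+1).
Definition left_move x t := (t < D) && (pos x t == (pos x t.+1).+1).

Let pI : injective p := @posn_inj n pi.
Let vI : injective v := @ord_inj n.

Lemma pos_inj t : injective (pos^~ t).
Proof. exact: posn_inj. Qed.

Lemma pos0 x : pos x 0 = p x.
Proof. by case: perfT => [[[_ [h _] _ _ _] _] _]; rewrite /pos h. Qed.

Lemma pos_local t x : t < D -> pos x t.+1 = pos x t \/
  exists y, [/\ pos x t.+1 = pos y t, pos y t.+1 = pos x t &
     pos y t = (pos x t).+1 \/ pos x t = (pos y t).+1].
Proof. by case: perfT => [[[[_ h] _ _ _ _] _] _] tD; apply: (adjacent_local (h t tD)). Qed.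

(** Every inversion needs at least one crossing, and the totals agree in a simple tangle, so
    equality holds for each pair. *)
Lemma crosses_inv x y : \sum_(t < D) (crosses_at T x y t : nat) = inv x y.
Proof.
case: perfT => /simple_crossings[sol]; rewrite crossingsE => e _.
pose g (xy : 'I_n * 'I_n) : nat := inv xy.1 xy.2.
have le xy : g xy <= \sum_(t < D) (crosses_at T xy.1 xy.2 t : nat).
  rewrite /g; case: xy => a b /=; case i: (inv a b) => //; case/andP: i => h1 h2.
  case: sol => _ [h0 hD] _ _ _.
  have [|t tD ct] := @crossing_exists n T a b _ hD h2; first by rewrite h0.
  by rewrite (bigD1 (Ordinal tD)) //= ct.
have eg : \sum_xy g xy = #|inversions pi|.
  by rewrite -sum1_card [RHS]big_mkcond; apply: eq_bigr => xy _; rewrite inE /g; case: (inv _ _).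
have lf xy : true -> (g xy <= \sum_(t < D) (crosses_at T xy.1 xy.2 t : nat)
     ?= iff (g xy == \sum_(t < D) (crosses_at T xy.1 xy.2 t : nat)))%N by move=> _; split.
have [_] := leqif_sum lf; rewrite eg e eqxx => /esym/forall_inP/(_ (x, y) isT)/eqP <- //.
Qed.

Lemma crossing_between x y t t' : t <= t' -> pos x t < pos y t -> pos y t' < pos x t' ->
  exists2 s, t <= s < t' & crosses_at T x y s.
Proof.
move=> tt' h h'.
have ex : exists s, (t <= s <= t') && (pos y s < pos x s) by exists t'; rewrite tt' leqnn h'.
case: (ex_minnP ex) => s /andP[st lt] mn.
case: s st lt mn => [|s] st lt mn.
  have e : t = 0 by move: st; clear; lia.
  by move: h lt; rewrite e; clear; lia.
have ts : t <= s.
  rewrite leqNgt; apply/negP => gt; have e : t = s.+1 by move: st gt; clear; lia.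
  by move: h lt; rewrite e; clear; lia.
exists s; first by lia.
rewrite /crosses_at !position_posn -!/(pos _ _) lt andbT.
have nb : ~~ (pos y s < pos x s) by apply/negP => h1; have := mn s; rewrite h1; lia.
have ne : pos x s != pos y s by apply: contraTneq h => /pos_inj ->; rewrite ltnn.
lia.
Qed.

Lemma crosses_sub x y t : t < D -> crosses_at T x y t -> inv x y.
Proof.
move=> tD ct; have := crosses_inv x y; rewrite (bigD1 (Ordinal tD)) //= ct.
by case: (inv x y).
Qed.

Lemma order_kept x y t : t <= D -> p x < p y -> v x < v y -> pos x t < pos y t.
Proof.
move=> tD h1 h2; have ne : pos x t != pos y t.
  by apply: contraTneq h1 => /pos_inj ->; rewrite ltnn.
rewrite ltn_neqAle ne leqNgt; apply/negP => h3.
have [|s sD cs] := @crossing_between x y 0 t isT _ h3; first by rewrite !pos0.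
have := crosses_sub _ cs; rewrite /inverted; lia.
Qed.

Lemma crossing_time_ex x y : inv x y -> exists2 t, t < D &
  [/\ crosses_at T x y t & forall s, s <= D -> (pos x s < pos y s) = (s <= t)].
Proof.
move=> i; have := crosses_inv x y; rewrite i => e.
have [t ct] : exists t : 'I_D, crosses_at T x y t.
  case: (pickP (fun t : 'I_D => crosses_at T x y t)) => [t ct|none]; first by exists t.
  by move: e; rewrite big1 // => t _; rewrite none.
have uniq_t s : s < D -> crosses_at T x y s -> s = t.
  move=> sD cs; apply/eqP/negPn/negP => ne; move: e.
  rewrite (bigD1 t) //= ct (bigD1 (Ordinal sD)) //= ?cs //.
exists t => //; split=> // s sD.
have := ct; rewrite /crosses_at !position_posn -!/(pos _ _) => /andP[c1 c2].
case: (leqP s t) => st.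
  have ne : pos x s != pos y s.
    by apply: contraTneq i => /pos_inj ->; rewrite /inverted ltnn.
  rewrite ltn_neqAle ne leqNgt; apply/negP => h.
  have [|r rs cr] := @crossing_between x y 0 s isT _ h; first by rewrite !pos0; case/andP: i.
  by have := uniq_t r ltac:(have := ltn_ord t; lia) cr; lia.
apply/negP => h; have [r rs cr] := @crossing_between y x t.+1 s st c2 h.
have := @crosses_sub y x r ltac:(lia) cr; move: i; rewrite /inverted; lia.
Qed.

Lemma crosses_moves x y t : t < D -> crosses_at T x y t ->
  [/\ right_move x t, left_move y t & pos y t = (pos x t).+1].
Proof.
move=> tD; rewrite /crosses_at !position_posn -!/(pos _ _) /right_move /left_move tD /=.
have bx : pos x t.+1 <= (pos x t).+1.
  by have [->|[z [-> _ [->|->]]]] := pos_local x tD; lia.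
have by_ : pos y t <= (pos y t.+1).+1.
  by have [->|[z [-> _ [->|->]]]] := pos_local y tD; lia.
move=> /andP[h1 h2].
have ne : pos x t != pos y t by apply: contraTneq h1 => ->; rewrite ltnn.
have e1 : pos x t.+1 = (pos x t).+1 by lia.
split; rewrite ?e1 //; lia.
Qed.

Lemma moves_excl x t : right_move x t -> left_move x t -> False.
Proof. rewrite /right_move /left_move; lia. Qed.

Lemma run_segment (c : int) x t : t < D -> step T x t = c ->
  exists s e, [/\ segment T x s e, s <= t < e & step T x s = c].
Proof.
move=> tD st.
pose good s := [forall u : 'I_D, (s <= u <= t) ==> (step T x u == c)].
have exs : exists s, good s.
  exists t; apply/forallP => u; apply/implyP => h; have -> : (u = t :> nat) by lia.
  by rewrite st.
case: (ex_minnP exs) => s /forallP gs mns.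
have stle : s <= t.
  apply: mns; apply/forallP => u; apply/implyP => h; have -> : (u = t :> nat) by lia.
  by rewrite st.
pose goode e := (e <= D) && [forall u : 'I_D, (t <= u < e) ==> (step T x u == c)].
have exe : exists e, goode e.
  exists t.+1; rewrite /goode tD; apply/forallP => u; apply/implyP => h.
  have -> : (u = t :> nat) by lia.
  by rewrite st.
case: (@ex_maxnP goode D exe) => [e /andP[]//|e /andP[eD /forallP ge] mxe].
have te : t < e.
  apply: mxe; rewrite /goode tD; apply/forallP => u; apply/implyP => h.
  have -> : (u = t :> nat) by lia.
  by rewrite st.
have all u : s <= u < e -> step T x u = c.
  move=> h; have uD : u < D by lia.
  case: (leqP u t) => ut.
    by move: (gs (Ordinal uD)); rewrite /= ut => /implyP h2; apply/eqP/h2; lia.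
  by move: (ge (Ordinal uD)); rewrite /= => /implyP h2; apply/eqP/h2; lia.
exists s, e; split; last by apply: all; lia.
  split; first by split; [lia | move=> u h; rewrite !all //; lia].
  move=> s' e' [/andP[se' eD'] h] ss ee.
  have cst u : s' <= u < e' -> step T x u = c.
    by move=> hu; rewrite (h u hu) -(h t) //; lia.
  split; apply/eqP; rewrite eqn_leq ?ss ?ee ?andbT //=.
    apply: mns; apply/forallP => u; apply/implyP => hu; apply/eqP/cst; lia.
  apply: mxe; rewrite /goode eD' /=; apply/forallP => u; apply/implyP => hu.
  by apply/eqP/cst; lia.
by rewrite stle te.
Qed.

Lemma step_right x t : t < D -> right_move x t = (step T x t == 1%R).
Proof. rewrite /right_move /step !position_posn -!/(pos _ _) => ->; lia. Qed.

Lemma step_left x t : t < D -> left_move x t = (step T x t == (-1)%R).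
Proof. rewrite /left_move /step !position_posn -!/(pos _ _) => ->; lia. Qed.

Lemma right_convex x t1 t2 t : right_move x t1 -> right_move x t2 -> t1 <= t <= t2 -> right_move x
    t.
Proof.
move=> h1 h2 tt; have [d1 d2] : t1 < D /\ t2 < D by case/andP: h1; case/andP: h2.
move: h1 h2; rewrite (step_right _ d1) (step_right _ d2) => /eqP s1 /eqP s2.
have [s [e [sg i1 c1]]] := run_segment d1 s1.
have [s' [e' [sg' i2 c2]]] := run_segment d2 s2.
have [_ /(_ x)[_ U]] := perfT.
have RS : R_segment T x s e by split; rewrite ?c1.
have RS' : R_segment T x s' e' by split; rewrite ?c2.
have [es ee] := U _ _ _ _ RS RS'; subst s' e'.
have [[_ h] _] := sg.
rewrite step_right; last by lia.
by rewrite h ?c1 //; lia.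
Qed.

Lemma left_convex x t1 t2 t : left_move x t1 -> left_move x t2 -> t1 <= t <= t2 -> left_move x t.
Proof.
move=> h1 h2 tt; have [d1 d2] : t1 < D /\ t2 < D by case/andP: h1; case/andP: h2.
move: h1 h2; rewrite (step_left _ d1) (step_left _ d2) => /eqP s1 /eqP s2.
have [s [e [sg i1 c1]]] := run_segment d1 s1.
have [s' [e' [sg' i2 c2]]] := run_segment d2 s2.
have [_ /(_ x)[U _]] := perfT.
have LS : L_segment T x s e by split; rewrite ?c1.
have LS' : L_segment T x s' e' by split; rewrite ?c2.
have [es ee] := U _ _ _ _ LS LS'; subst s' e'.
have [[_ h] _] := sg.
rewrite step_left; last by lia.
by rewrite h ?c1 //; lia.
Qed.

Definition mark c := [exists t1 : 'I_D, exists t2 : 'I_D,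
  [&& right_move c t1, left_move c t2 & t1 < t2]].

Lemma markE c t1 t2 : right_move c t1 -> left_move c t2 -> mark c = (t1 < t2).
Proof.
move=> r1 l2; have [d1 d2] : t1 < D /\ t2 < D by case/andP: r1; case/andP: l2.
have ne a b : right_move c a -> left_move c b -> a != b.
  by move=> ha hb; apply/eqP => e; subst b; apply: (moves_excl ha hb).
apply/existsP/idP => [[u1 /existsP[u2 /and3P[ru lu lt]]]|lt].
  rewrite ltn_neqAle ne //= leqNgt; apply/negP => gt.
  have n1 := ne _ _ ru l2; have n2 := ne _ _ ru lu; have n3 := ne _ _ r1 l2.
  case: (ltnP u1 t2) => h.
    by apply: (@moves_excl c t2) => //; apply: (right_convex ru r1); lia.
  by apply: (@moves_excl c u1) => //; apply: (left_convex l2 lu); lia.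
by exists (Ordinal d1); apply/existsP; exists (Ordinal d2); rewrite /= r1 l2.
Qed.

(** [a] and [b] are then neighbours, so [c] has already crossed exactly one of them: [a], by moving
    left, if it is to their left, and [b], by moving right, otherwise. *)
Lemma mid_side a b c t : mid p v a b c -> t < D -> crosses_at T a b t ->
  (pos c t < pos a t) = ~~ mark c.
Proof.
case/andP=> ac cb tD ct; have [_ _ eb] := crosses_moves tD ct.
have [t1 d1 [c1 h1]] := crossing_time_ex ac; have [t2 d2 [c2 h2]] := crossing_time_ex cb.
have [_ l1 _] := crosses_moves d1 c1; have [r2 _ _] := crosses_moves d2 c2.
rewrite (markE r2 l1).
have nca : pos c t != pos a t by apply: contraTneq ac => /pos_inj ->; rewrite /inverted ltnn.
have ncb : pos c t != pos b t by apply: contraTneq cb => /pos_inj ->; rewrite /inverted ltnn.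
have := h1 t (ltnW tD); have := h2 t (ltnW tD); lia.
Qed.

Lemma mark_monotone : monotone p v mark.
Proof.
move=> c d /impliesP[a [b H]]; rewrite /ascending in H.
have ab : inv a b by rewrite /inverted; lia.
have mc : mid p v a b c by rewrite /mid /inverted; lia.
have md : mid p v a b d by rewrite /mid /inverted; lia.
have [t tD [ct _]] := crossing_time_ex ab.
have hc := mid_side mc tD ct; have hd := mid_side md tD ct.
have cd : pos c t < pos d t by apply: order_kept; lia.
by apply: contraTT; rewrite -hd -hc => h; apply: ltn_trans cd h.
Qed.

(** The position is the number of paths to the left. A path inverted with [a] from the left is still
    there iff the L-segment of [a] is yet to come; one inverted with [b] from the right has arrived
    iff the R-segment of [b] is over. *)
Lemma crossing_position a b t : inv a b -> t < D -> crosses_at T a b t ->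
  pos a t = weight p v mark a b + mark a * cntL p v a + mark b * cntR p v b.
Proof.
move=> ab tD ct; have [ra lb eb] := crosses_moves tD ct.
have -> : pos a t = #|[pred c | pos c t < pos a t]|.
  by rewrite card_below //; [exact: pos_inj | move=> e; apply: ltn_ord | apply: ltnW; apply:
    ltn_ord].
rewrite /weight /cntL /cntR !card_sum !big_distrr -!big_split /=; apply: eq_bigr => c _.
have sp := same_point pI vI.
have [->|ca] := eqVneq c a.
  by move: ab; rewrite ltnn /passes /inverted !ltnn ?andbF /= ?muln0; case: (mark b) => //; lia.
have [->|cb] := eqVneq c b.
  by move: ab; rewrite eb /passes /inverted !ltnn ?andbF /= ?muln0; case: (mark a) => //; lia.
have pca := inj_eq pI c a; have pcb := inj_eq pI c b.
have vca := inj_eq vI c a; have vcb := inj_eq vI c b.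
rewrite (negbTE ca) in pca vca; rewrite (negbTE cb) in pcb vcb.
have nca : pos c t != pos a t by rewrite (inj_eq (@pos_inj t)).
have ncb : pos c t != pos b t by rewrite (inj_eq (@pos_inj t)).
have adj : (pos c t < pos a t) = (pos c t < pos b t) by lia.
case/andP: (ab) => ab1 ab2.
case ica : (inv c a).
  have [s sD [cs hs]] := crossing_time_ex ica; have [_ la _] := crosses_moves sD cs.
  have -> : passes p v mark a b c = false.
    by move: ica ab1 ab2; rewrite /passes /inverted; clear; lia.
  have -> : inv b c = false by move: ica ab1 ab2; rewrite /inverted; clear; lia.
  rewrite (hs t (ltnW tD)) (markE ra la) muln0 muln1 addn0 add0n.
  by congr nat_of_bool; have := @moves_excl a t ra; case: (ltngtP t s) => // e; subst s => /(_ la).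
case ibc : (inv b c).
  have [s sD [cs hs]] := crossing_time_ex ibc; have [rb _ _] := crosses_moves sD cs.
  have -> : passes p v mark a b c = false by move: ibc ab1 ab2; rewrite /passes /inverted; clear;
      lia.
  rewrite adj (markE rb lb) muln0 muln1 !add0n; congr nat_of_bool.
  by have := hs t (ltnW tD); move: ncb; clear; lia.
rewrite !muln0 !addn0.
case imid : (mid p v a b c).
  rewrite (mid_side imid tD ct) /passes imid; case/andP: imid => h1 h2.
  by move: h1 h2; rewrite /inverted => /andP[_ ->] /andP[-> _] /=; case: mark.
rewrite /passes imid /= andbT.
move: ica ibc imid; rewrite /mid /inverted => h1 h2 h3.
case: (boolP ((p c < p b) && (v c < v a))) => h4.
  case: (ltnP (p c) (p a)) => h5; first by rewrite (@order_kept c a t) // ?(ltnW tD); lia.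
  by rewrite adj (@order_kept c b t) // ?(ltnW tD); lia.
case: (ltnP (v c) (v a)) => h5.
  by have := @order_kept b c t (ltnW tD); lia.
by have := @order_kept a c t (ltnW tD); lia.
Qed.

Lemma right_run x t1 t2 : right_move x t1 -> right_move x t2 -> t1 <= t2 ->
  pos x t2 = pos x t1 + (t2 - t1).
Proof.
move=> r1 r2 le; rewrite -{1}(subnKC le).
have : forall k, k <= t2 - t1 -> pos x (t1 + k) = pos x t1 + k.
  elim=> [|k IH] hk; first by rewrite !addn0.
  have /andP[_ /eqP] : right_move x (t1 + k) by apply: (right_convex r1 r2); lia.
  by rewrite addnS => ->; rewrite IH ?addnS // ltnW.
by apply.
Qed.

Lemma left_run x t1 t2 : left_move x t1 -> left_move x t2 -> t1 <= t2 ->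
  pos x t1 = pos x t2 + (t2 - t1).
Proof.
move=> r1 r2 le; rewrite -{1}(subnKC le).
have : forall k, k <= t2 - t1 -> pos x t1 = pos x (t1 + k) + k.
  elim=> [|k IH] hk; first by rewrite !addn0.
  have /andP[_ /eqP] : left_move x (t1 + k) by apply: (left_convex r1 r2); lia.
  by have := IH (ltnW hk); rewrite (addnS t1 k); clear; lia.
by move=> /(_ _ (leqnn _)); rewrite subnKC.
Qed.

(** [r] and [l] are the constants of the two lines. At a crossing, [l b - r a = 2 * pos a t + 1], so
    [l b - 1] and [r a] have the same parity and the integer divisions round alike. *)
Lemma mark_drawable : drawable p v mark.
Proof.
pose r a : int := if [pick t : 'I_D | right_move a t] is Some t then (t%:Z - (pos a t)%:Z)%R else
  0%R.
pose l b : int := if [pick t : 'I_D | left_move b t] is Some t then (t%:Z + (pos b t)%:Z)%R else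
  0%R.
exists (fun a => (r a %/ 2)%Z + (mark a * cntL p v a)%:Z)%R,
  (fun b => ((l b - 1) %/ 2)%Z - (mark b * cntR p v b)%:Z)%R.
move=> a b ab; have [t tD [ct _]] := crossing_time_ex ab.
have [ra lb eb] := crosses_moves tD ct.
have er : r a = (t%:Z - (pos a t)%:Z)%R.
  rewrite /r; case: pickP => [s rs|/(_ (Ordinal tD))]; last by rewrite /= ra.
  case: (leqP s t) => h; first by have := right_run rs ra h; lia.
  by have := right_run ra rs (ltnW h); lia.
have el : l b = (t%:Z + (pos b t)%:Z)%R.
  rewrite /l; case: pickP => [s ls|/(_ (Ordinal tD))]; last by rewrite /= lb.
  case: (leqP s t) => h; first by have := left_run ls lb h; lia.
  by have := left_run lb ls (ltnW h); lia.
have := crossing_position ab tD ct; rewrite er el eb.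
move: (weight _ _ _ _ _) (mark a * _) (mark b * _) => w x y -> ; lia.
Qed.
End Necessity.

(** * Programs *)

(* A total combinator language with loops of fixed length; [N] is the length of
   every loop.  A loop body is applied to ((environment, accumulator), index). *)
Inductive hexpr : Type :=
| HId
| HNum of nat
| HFst of hexpr
| HSnd of hexpr
| HIsPair of hexpr
| HPair of hexpr & hexpr
| HAdd of hexpr & hexpr
| HSub of hexpr & hexpr
| HIf of hexpr & hexpr & hexpr
| HComp of hexpr & hexpr
| HFor of hexpr & hexpr.

Definition vnum (x : value) : nat := if x is VNum k then k else 0.
Definition vfst (x : value) : value := if x is VPair a _ then a else VNum 0.
Definition vsnd (x : value) : value := if x is VPair _ b then b else VNum 0.
Definition vispair (x : value) : value := if x is VPair _ _ then VNum 1 else VNum 0.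

Fixpoint den (N : nat) (e : hexpr) (v : value) : value :=
  match e with
  | HId => v
  | HNum k => VNum k
  | HFst e => vfst (den N e v)
  | HSnd e => vsnd (den N e v)
  | HIsPair e => vispair (den N e v)
  | HPair e1 e2 => VPair (den N e1 v) (den N e2 v)
  | HAdd e1 e2 => VNum (vnum (den N e1 v) + vnum (den N e2 v))
  | HSub e1 e2 => VNum (vnum (den N e1 v) - vnum (den N e2 v))
  | HIf e e1 e2 => if vnum (den N e v) != 0 then den N e1 v else den N e2 v
  | HComp e1 e2 => den N e2 (den N e1 v)
  | HFor e0 b =>
      foldl (fun acc i => den N b (VPair (VPair v acc) (VNum i))) (den N e0 v) (iota 0 N)
  end.

(** 40 is a generous bound for the overhead of one construct, and both branches of a test are paid
    for, so that the cost depends on [N] only. *)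
Fixpoint cost (N : nat) (e : hexpr) : nat :=
  match e with
  | HId | HNum _ => 40
  | HFst e | HSnd e | HIsPair e => cost N e + 40
  | HPair e1 e2 | HAdd e1 e2 | HSub e1 e2 | HComp e1 e2 => cost N e1 + cost N e2 + 40
  | HIf e e1 e2 => cost N e + cost N e1 + cost N e2 + 40
  | HFor e0 b => cost N e0 + N * (cost N b + 40) + 40
  end.

Lemma cost_poly e : exists c k, forall n, cost n.+2 e <= c * n ^ k + c.
Proof.
have add c1 k1 c2 k2 n : c1 * n ^ k1 + c1 + (c2 * n ^ k2 + c2) <= (2 * (c1 + c2)) * n ^ (k1 + k2) +
    2 * (c1 + c2).
  have z k : 0 ^ k <= 1 by case: k => // k; rewrite exp0n.
  case: n => [|n]; first by have := z k1; have := z k2; move: (0 ^ k1) (0 ^ k2) (0 ^ _) => x y w;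
    nia.
  have h k : 0 < n.+1 ^ k by rewrite expn_gt0.
  have h1 : n.+1 ^ k1 <= n.+1 ^ (k1 + k2) by rewrite leq_pexp2l // leq_addr.
  have h2 : n.+1 ^ k2 <= n.+1 ^ (k1 + k2) by rewrite leq_pexp2l // leq_addl.
  nia.
have bin (f g h : nat -> nat) a : (exists c k, forall n, f n <= c * n ^ k + c) ->
   (exists c k, forall n, g n <= c * n ^ k + c) -> (forall n, h n <= f n + g n + a) ->
   exists c k, forall n, h n <= c * n ^ k + c.
  move=> [c1 [k1 h1]] [c2 [k2 h2]] hh; exists (2 * (c1 + c2) + a), (k1 + k2) => n.
  have := add c1 k1 c2 k2 n; have := h1 n; have := h2 n; have := hh n.
  move: (n ^ k1) (n ^ k2) (n ^ (k1 + k2)) => x y z; nia.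
have one (f h : nat -> nat) a : (exists c k, forall n, f n <= c * n ^ k + c) ->
   (forall n, h n <= f n + a) -> exists c k, forall n, h n <= c * n ^ k + c.
  by move=> hf hh; apply: (bin f (fun=> 0) h a hf) => [|n]; [exists 0, 0 | rewrite addn0].
elim: e => /= [|k|e IH|e IH|e IH|e1 IH1 e2 IH2|e1 IH1 e2 IH2|e1 IH1 e2 IH2|e IH e1 IH1 e2 IH2|e1
  IH1 e2 IH2|e1 IH1 e2 IH2].
1,2: by exists 40, 0 => n; lia.
1-3: by apply: (one _ _ 40 IH).
1-3: by apply: (bin _ _ _ 40 IH1 IH2).
- apply: (bin _ _ _ 40 (bin _ _ (fun n => cost n.+2 e + cost n.+2 e1) 0 IH IH1 _) IH2) => n; lia.
- by apply: (bin _ _ _ 40 IH1 IH2).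
apply: (bin _ (fun n => n.+2 * (cost n.+2 e2 + 40)) _ 40 IH1) => //.
(* For [n > 0], [n + 2 <= 3 * n], and a round costs at most [2 * (c + 40) * n ^ k]. *)
have [c [k h]] := IH2; exists (6 * (c + 40)), k.+1 => n.
have h1 := h n; rewrite expnS.
case: n h1 => [|n] h1.
  rewrite mul0n muln0 add0n; move: h1; case: k {h} => [|k]; rewrite ?expn0 ?exp0n //; nia.
have h2 : 0 < n.+1 ^ k by rewrite expn_gt0.
move: (n.+1 ^ k) h1 h2 => z; nia.
Qed.

Fixpoint hsize (e : hexpr) : nat :=
  match e with
  | HId | HNum _ => 1
  | HFst e | HSnd e | HIsPair e => (hsize e).+1
  | HPair e1 e2 | HAdd e1 e2 | HSub e1 e2 | HComp e1 e2 => (hsize e1 + hsize e2).+1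
  | HIf e e1 e2 => (hsize e + (hsize e1 + hsize e2)).+1
  | HFor e0 b => (hsize e0 + hsize b).+2
  end.

Definition self := EVar 0.
Definition as_num (e : expr) := ECase e (EVar 0) (ENum 0).
Definition fuel_of := ECase self (ENum 0) (EVar 0).

(** The argument is [((F, v), (fuel, (i, acc)))]. Each round consumes one cell of [fuel]; when a
    number is reached, that case binds it too, which shifts [acc] to [EVar 2]. *)
Definition loop_code (g b : nat) : expr :=
  ECase self (ENum 0) (ECase (EVar 1) (ENum 0) (ECase (EVar 1) (ENum 0)
   (ECase (EVar 2) (EVar 2) (ECase (EVar 6) (ENum 0)
     (ECall g (EPair (EVar 8) (EPair (EVar 3) (EPair (EAdd (EVar 4) (ENum 1))
        (ECall b (EPair (EVar 0) (EPair (EPair (EVar 1) (EVar 5)) (EVar 4))))))))))))%N.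

(* The code of [e] when it is placed at function index [k].  The argument of every
   function is paired with the fuel of the loops. *)
Fixpoint compile (e : hexpr) (k : nat) : seq expr :=
  match e with
  | HId => [:: ECase self (ENum 0) (EVar 1)]
  | HNum j => [:: ENum j]
  | HFst e => ECase (ECall k.+1 self) (ENum 0) (EVar 0) :: compile e k.+1
  | HSnd e => ECase (ECall k.+1 self) (ENum 0) (EVar 1) :: compile e k.+1
  | HIsPair e => ECase (ECall k.+1 self) (ENum 0) (ENum 1) :: compile e k.+1
  | HPair e1 e2 => EPair (ECall k.+1 self) (ECall (k.+1 + hsize e1) self)
      :: compile e1 k.+1 ++ compile e2 (k.+1 + hsize e1)
  | HAdd e1 e2 => EAdd (as_num (ECall k.+1 self)) (as_num (ECall (k.+1 + hsize e1) self))
      :: compile e1 k.+1 ++ compile e2 (k.+1 + hsize e1)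
  | HSub e1 e2 => ESub (as_num (ECall k.+1 self)) (as_num (ECall (k.+1 + hsize e1) self))
      :: compile e1 k.+1 ++ compile e2 (k.+1 + hsize e1)
  | HIf e e1 e2 => EIf (as_num (ECall k.+1 self)) (ECall (k.+1 + hsize e) self)
        (ECall (k.+1 + hsize e + hsize e1) self)
      :: compile e k.+1 ++ (compile e1 (k.+1 + hsize e) ++ compile e2 (k.+1 + hsize e + hsize e1))
  | HComp e1 e2 => ECall (k.+1 + hsize e1) (EPair fuel_of (ECall k.+1 self))
      :: compile e1 k.+1 ++ compile e2 (k.+1 + hsize e1)
  | HFor e0 b => ECall k.+1 (EPair self (EPair fuel_of (EPair (ENum 0) (ECall k.+2 self))))
      :: loop_code k.+1 (k.+2 + hsize e0) :: compile e0 k.+2 ++ compile b (k.+2 + hsize e0)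
  end.

Lemma size_compile e k : size (compile e k) = hsize e.
Proof.
by elim: e k => //= [e IH|e IH|e IH|e1 IH1 e2 IH2|e1 IH1 e2 IH2|e1 IH1 e2 IH2|e IH e1 IH1 e2 IH2|e1
  IH1 e2 IH2|e1 IH1 e2 IH2] k;
   rewrite ?size_cat ?IH ?IH1 ?IH2.
Qed.

Fixpoint spine (x : value) : nat := if x is VPair _ b then (spine b).+1 else 0.

Section Correct.
Variable p : program.

Definition ev env e v B := exists2 t, eval p env e v t & t <= B.

Lemma ev_le env e v B B' : ev env e v B -> B <= B' -> ev env e v B'.
Proof. by move=> [t h le] le'; exists t => //; apply: leq_trans le'. Qed.

Lemma ev_var env i : i < size env -> ev env (EVar i) (nth (VNum 0) env i) 1.
Proof. by move=> h; exists 1 => //; apply: eval_Var. Qed.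

Lemma ev_at env i x : nth (VNum 0) env i = x -> i < size env -> ev env (EVar i) x 1.
Proof. by move=> <-; apply: ev_var. Qed.

Lemma ev_num env k : ev env (ENum k) (VNum k) 1.
Proof. by exists 1 => //; apply: eval_Num. Qed.

Lemma ev_add env e1 e2 k1 k2 B1 B2 : ev env e1 (VNum k1) B1 -> ev env e2 (VNum k2) B2 ->
  ev env (EAdd e1 e2) (VNum (k1 + k2)) (B1 + B2).+1.
Proof. by move=> [t1 h1 l1] [t2 h2 l2]; exists (t1 + t2).+1; [apply: eval_Add | rewrite ltnS
  leq_add]. Qed.

Lemma ev_sub env e1 e2 k1 k2 B1 B2 : ev env e1 (VNum k1) B1 -> ev env e2 (VNum k2) B2 ->
  ev env (ESub e1 e2) (VNum (k1 - k2)) (B1 + B2).+1.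
Proof. by move=> [t1 h1 l1] [t2 h2 l2]; exists (t1 + t2).+1; [apply: eval_Sub | rewrite ltnS
  leq_add]. Qed.

Lemma ev_pair env e1 e2 v1 v2 B1 B2 : ev env e1 v1 B1 -> ev env e2 v2 B2 ->
  ev env (EPair e1 e2) (VPair v1 v2) (B1 + B2).+1.
Proof. by move=> [t1 h1 l1] [t2 h2 l2]; exists (t1 + t2).+1; [apply: eval_Pair | rewrite ltnS
  leq_add]. Qed.

Lemma ev_if env e e1 e2 k v B B' : ev env e (VNum k) B -> ev env (if k != 0 then e1 else e2) v B' ->
  ev env (EIf e e1 e2) v (B + B').+1.
Proof. by move=> [t1 h1 l1] [t2 h2 l2]; exists (t1 + t2).+1; [apply: eval_If h1 h2 | rewrite ltnS
  leq_add]. Qed.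

Lemma ev_casenum env e e1 e2 k v B B' : ev env e (VNum k) B -> ev (VNum k :: env) e1 v B' ->
  ev env (ECase e e1 e2) v (B + B').+1.
Proof. by move=> [t1 h1 l1] [t2 h2 l2]; exists (t1 + t2).+1; [apply: eval_CaseNum h1 h2 | rewrite
  ltnS leq_add]. Qed.

Lemma ev_casepair env e e1 e2 v1 v2 v B B' : ev env e (VPair v1 v2) B ->
  ev (v1 :: v2 :: env) e2 v B' -> ev env (ECase e e1 e2) v (B + B').+1.
Proof. by move=> [t1 h1 l1] [t2 h2 l2]; exists (t1 + t2).+1; [apply: eval_CasePair h1 h2 | rewrite
  ltnS leq_add]. Qed.

Lemma ev_call env f e v1 v B B' : f < size p -> ev env e v1 B ->
  ev [:: v1] (nth (ENum 0) p f) v B' -> ev env (ECall f e) v (B + B').+1.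
Proof. by move=> h [t1 h1 l1] [t2 h2 l2]; exists (t1 + t2).+1; [apply: eval_Call h h1 h2 | rewrite
  ltnS leq_add]. Qed.

Lemma ev_as_num env e v B : ev env e v B -> ev env (as_num e) (VNum (vnum v)) (B + 1).+1.
Proof.
case: v => [k|a b] h; first exact: (ev_casenum _ h (@ev_var (VNum k :: env) 0 isT)).
exact: (ev_casepair _ h (ev_num _ 0)).
Qed.

Variables (F : value) (N : nat).

Definition placed (c : seq expr) (k : nat) := exists pre post, p = pre ++ c ++ post /\ size pre = k.

Lemma placed_head c cs k : placed (c :: cs) k -> nth (ENum 0) p k = c /\ k < size p.
Proof.
move=> [pre [post [-> <-]]]; rewrite nth_cat ltnn subnn /= !size_cat /=; split=> //; lia.
Qed.

Lemma placed_tail c cs k : placed (c :: cs) k -> placed cs k.+1.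
Proof.
case=> pre [post [e1 e2]]; exists (rcons pre c), post.
by rewrite size_rcons -cats1 -catA e2.
Qed.

Lemma placed_cat c d k : placed (c ++ d) k -> placed c k /\ placed d (k + size c).
Proof.
case=> pre [post [e1 e2]]; split.
  by exists pre, (d ++ post); rewrite e1 -catA.
by exists (pre ++ c), post; rewrite size_cat -!catA e2 e1 -!catA.
Qed.

Lemma placed_lt e k : placed (compile e k) k -> k < size p.
Proof.
case=> pre [post [-> <-]]; rewrite !size_cat size_compile; case: e => /= *; lia.
Qed.

Lemma loop_correct (g h : nat) (f : value -> value) C v :
  g < size p -> h < size p -> nth (ENum 0) p g = loop_code g h ->
  (forall w, ev [:: VPair F w] (nth (ENum 0) p h) (f w) C) ->
  forall fuel i acc,
  ev [:: VPair (VPair F v) (VPair fuel (VPair (VNum i) acc))] (nth (ENum 0) p g)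
    (foldl (fun acc i => f (VPair (VPair v acc) (VNum i))) acc (iota i (spine fuel)))
    (spine fuel * (C + 40) + 20).
Proof.
move=> gp hp ge hb.
elim=> [j|a _ r IH] i acc /=; rewrite ge /loop_code.
  apply: ev_le.
    do 3 (apply: ev_casepair; first exact: ev_at).
    apply: ev_casenum; exact: ev_at.
  lia.
rewrite -(addn1 i); apply: ev_le.
  do 5 (apply: ev_casepair; first exact: ev_at).
  apply: (ev_call gp); last exact: IH.
  apply: ev_pair; first exact: ev_at.
  apply: ev_pair; first exact: ev_at.
  apply: ev_pair; first (apply: ev_add; [exact: ev_at|exact: ev_num]).
  apply: (ev_call hp); last exact: hb.
  apply: ev_pair; first exact: ev_at.
  apply: ev_pair; last exact: ev_at.
  apply: ev_pair; exact: ev_at.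
nia.
Qed.

Theorem compile_correct e k v : spine F = N -> placed (compile e k) k ->
  ev [:: VPair F v] (nth (ENum 0) p k) (den N e v) (cost N e).
Proof.
move=> spineF.
have slf w : ev [:: w] self w 1 by exact: (@ev_var [:: w] 0 isT).
have fl w : ev [:: VPair F w] fuel_of F 3.
  exact: (ev_casepair _ (slf _) (@ev_var [:: F; w; VPair F w] 0 isT)).
have call f w r B : f < size p -> ev [:: VPair F w] (nth (ENum 0) p f) r B -> ev [:: VPair F w]
    (ECall f self) r (1 + B).+1.
  by move=> fp h; apply: (ev_call fp (slf _) h).
elim: e k v => /= [|j|e IH|e IH|e IH|e1 IH1 e2 IH2|e1 IH1 e2 IH2|e1 IH1 e2 IH2|e IH e1 IH1 e2
  IH2|e1 IH1 e2 IH2|e1 IH1 e2 IH2] k v pl;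
  have [-> _] := placed_head pl.
- apply: ev_le (ev_casepair _ (slf _) (@ev_var [:: F; v; VPair F v] 1 isT)) _ => //.
- by apply: ev_le (ev_num _ _) _.
1-3: have h := IH k.+1 v (placed_tail pl);
  have kp := placed_lt (placed_tail pl).
- have c := call _ _ _ _ kp h; case E: (den N e v) c => [j|a b] c /=.
    by apply: ev_le (ev_casenum _ c (ev_num _ 0)) _; lia.
  by apply: ev_le (ev_casepair _ c (@ev_var (a :: b :: _) 0 isT)) _; lia.
- have c := call _ _ _ _ kp h; case E: (den N e v) c => [j|a b] c /=.
    by apply: ev_le (ev_casenum _ c (ev_num _ 0)) _; lia.
  by apply: ev_le (ev_casepair _ c (@ev_var (a :: b :: _) 1 isT)) _; lia.
- have c := call _ _ _ _ kp h; case E: (den N e v) c => [j|a b] c /=.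
    by apply: ev_le (ev_casenum _ c (ev_num _ 0)) _; lia.
  by apply: ev_le (ev_casepair _ c (ev_num _ 1)) _; lia.
1-3: have [pl1 pl2] := placed_cat (placed_tail pl); rewrite size_compile in pl2;
  have c1 := call _ _ _ _ (placed_lt pl1) (IH1 _ v pl1);
  have c2 := call _ _ _ _ (placed_lt pl2) (IH2 _ v pl2).
- by apply: ev_le (ev_pair c1 c2) _; lia.
- by apply: ev_le (ev_add (ev_as_num c1) (ev_as_num c2)) _; lia.
- by apply: ev_le (ev_sub (ev_as_num c1) (ev_as_num c2)) _; lia.
- have [pl0 pl'] := placed_cat (placed_tail pl); rewrite size_compile in pl'.
  have [pl1 pl2] := placed_cat pl'; rewrite size_compile in pl2.
  have c0 := call _ _ _ _ (placed_lt pl0) (IH _ v pl0).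
  have c1 := call _ _ _ _ (placed_lt pl1) (IH1 _ v pl1).
  have c2 := call _ _ _ _ (placed_lt pl2) (IH2 _ v pl2).
  apply: ev_le; first apply: (ev_if (ev_as_num c0) (B' := cost N e1 + cost N e2 + 3)).
    by case: ifP => _; [apply: ev_le c1 _ | apply: ev_le c2 _]; lia.
  lia.
- have [pl1 pl2] := placed_cat (placed_tail pl); rewrite size_compile in pl2.
  have c1 := call _ _ _ _ (placed_lt pl1) (IH1 _ v pl1).
  apply: ev_le (ev_call (placed_lt pl2) (ev_pair (fl v) c1) (IH2 _ _ pl2)) _; lia.
have [pl1 pl2] := placed_cat (placed_tail (placed_tail pl)); rewrite size_compile in pl2.
have [ge gp] := placed_head (placed_tail pl).
have c1 := call _ _ _ _ (placed_lt pl1) (IH1 _ v pl1).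
have h := loop_correct v gp (placed_lt pl2) ge (fun w => IH2 _ w pl2) F 0 (den N e1 v).
rewrite spineF in h.
apply: ev_le (ev_call gp (ev_pair (slf _) (ev_pair (fl v) (ev_pair (ev_num _ 0) c1))) h) _.
lia.
Qed.
End Correct.

Definition start := ECall 1 (EPair (EPair (ENum 0) (EPair (ENum 0) (EVar 0))) (EVar 0)).

(* The fuel is the input list lengthened by two: loops of length [N >= 2] can be
   nested so as to exceed any given polynomial in [size s]. *)
Theorem run_compile e s : exists2 t,
  runs (start :: compile e 1) (enc_seq s) (den (size s).+2 e (enc_seq s)) t &
  t <= cost (size s).+2 e + 40.
Proof.
set p := start :: _; set F := VPair (VNum 0) (VPair (VNum 0) (enc_seq s)).
have sF : spine F = (size s).+2 by rewrite /F /=; congr _.+2; elim: s {p F} => //= a s ->.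
have pl : placed p (compile e 1) 1 by exists [:: start], [::]; rewrite cats0.
have lt1 := placed_lt pl.
have [t h le] := compile_correct (enc_seq s) sF pl.
suff : ev p [:: enc_seq s] (ECall 0 (EVar 0)) (den (size s).+2 e (enc_seq s)) (cost (size s).+2 e +
  40).
  by move=> [t' h' le']; exists t'.
apply: ev_le.
  apply: (@ev_call p _ 0) => //; first exact: ev_at.
  apply: (@ev_call p _ 1); first exact: lt1; last by (exists t; [exact: h | exact: le]).
  apply: ev_pair; last exact: ev_at.
  apply: ev_pair; first exact: ev_num.
  apply: ev_pair; [exact: ev_num | exact: ev_at].
lia.
Qed.

(** * Families of functions computed by a single expression *)

Class Enc (A : nat -> Type) := enc : forall n, A n -> value.
#[export] Instance enc_value : Enc (fun=> value) := fun _ x => x.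
#[export] Instance enc_nat : Enc (fun=> nat) := fun _ k => VNum k.
#[export] Instance enc_bool : Enc (fun=> bool) := fun _ b => VNum b.
#[export] Instance enc_ord : Enc (fun n => 'I_n) := fun _ x => VNum x.
#[export] Instance enc_option : Enc (fun n => option 'I_n) :=
  fun _ o => VNum (if o is Some x then x.+1 else 0).
#[export] Instance enc_pair A B {eA : Enc A} {eB : Enc B} : Enc (fun n => (A n * B n)%type) :=
  fun n z => VPair (enc z.1) (enc z.2).
#[export] Instance enc_list A {eA : Enc A} : Enc (fun n => seq (A n)) :=
  fun n s => enc_seq (map (@enc _ eA n) s).
(** The format of [enc_perm]: permutations can be read as functions, and the computed frames are
    output as they are. *)
#[export] Instance enc_ffun B {eB : Enc B} : Enc (fun n => {ffun 'I_n -> B n}) :=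
  fun n f => enc_seq [seq enc (f x) | x <- enum 'I_n].
#[export] Instance enc_sym : Enc (fun n => 'S_n) := @enc_perm.

(* A single expression computes all the [f n], the loops having length [n.+2]. *)
Inductive comp (A B : nat -> Type) {eA : Enc A} {eB : Enc B} (f : forall n, A n -> B n) : Prop :=
  Comp e of forall n a, den n.+2 e (enc a) = enc (f n a).

Section Closure.
Context {A : nat -> Type} {eA : Enc A}.
Implicit Types (f g : forall n, A n -> nat) (b c : forall n, A n -> bool).

Lemma comp_enc_ext B {eB : Enc B} (f : forall n, A n -> B n) (g : forall n, A n -> value) :
  comp g -> (forall n a, enc (f n a) = g n a) -> comp f.
Proof. by move=> [e h] fg; exists e => n a; rewrite h fg. Qed.

Lemma comp_ext B {eB : Enc B} (f g : forall n, A n -> B n) :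
  comp g -> (forall n a, f n a = g n a) -> comp f.
Proof. by move=> [e h] fg; exists e => n a; rewrite h fg. Qed.

Lemma comp_id : comp (fun n (a : A n) => a).
Proof. by exists HId. Qed.

Lemma comp_enc B {eB : Enc B} (f : forall n, A n -> B n) :
  comp f -> comp (fun n a => enc (f n a) : value).
Proof. by case=> e h; exists e. Qed.

Lemma comp_const_nat (k : nat) : comp (fun n (a : A n) => k).
Proof. by exists (HNum k). Qed.

Lemma comp_const_bool (k : bool) : comp (fun n (a : A n) => k).
Proof. by exists (HNum k). Qed.

Lemma comp_none : comp (fun n (a : A n) => @None 'I_n).
Proof. by exists (HNum 0). Qed.

Lemma comp_nil B {eB : Enc B} : comp (fun n (a : A n) => @nil (B n)).
Proof. by exists (HNum 0). Qed.

Lemma comp_pair B C {eB : Enc B} {eC : Enc C} (f : forall n, A n -> B n) (g : forall n, A n -> C n)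
    :
  comp f -> comp g -> comp (fun n a => (f n a, g n a)).
Proof. by move=> [e1 h1] [e2 h2]; exists (HPair e1 e2) => n a /=; rewrite h1 h2. Qed.

Lemma comp_cons B {eB : Enc B} (f : forall n, A n -> B n) (g : forall n, A n -> seq (B n)) :
  comp f -> comp g -> comp (fun n a => f n a :: g n a).
Proof. by move=> [e1 h1] [e2 h2]; exists (HPair e1 e2) => n a /=; rewrite h1 h2. Qed.

Lemma comp_vpair (f g : forall n, A n -> value) :
  comp f -> comp g -> comp (fun n a => VPair (f n a) (g n a)).
Proof. by move=> [e1 h1] [e2 h2]; exists (HPair e1 e2) => n a /=; rewrite h1 h2. Qed.

Lemma comp_vfst (f : forall n, A n -> value) : comp f -> comp (fun n a => vfst (f n a)).
Proof. by move=> [e h]; exists (HFst e) => n a /=; rewrite h. Qed.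

Lemma comp_vsnd (f : forall n, A n -> value) : comp f -> comp (fun n a => vsnd (f n a)).
Proof. by move=> [e h]; exists (HSnd e) => n a /=; rewrite h. Qed.

Lemma comp_fst B C {eB : Enc B} {eC : Enc C} (f : forall n, A n -> B n * C n) :
  comp f -> comp (fun n a => (f n a).1).
Proof. by move=> [e h]; exists (HFst e) => n a /=; rewrite h. Qed.

Lemma comp_snd B C {eB : Enc B} {eC : Enc C} (f : forall n, A n -> B n * C n) :
  comp f -> comp (fun n a => (f n a).2).
Proof. by move=> [e h]; exists (HSnd e) => n a /=; rewrite h. Qed.

Lemma comp_call B C {eB : Enc B} {eC : Enc C} (g : forall n, B n -> C n) (f : forall n, A n -> B n)
    :
  comp g -> comp f -> comp (fun n a => g n (f n a)).
Proof. by move=> [e1 h1] [e2 h2]; exists (HComp e2 e1) => n a /=; rewrite h2 h1. Qed.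

Lemma comp_add f g : comp f -> comp g -> comp (fun n a => f n a + g n a).
Proof. by move=> [e1 h1] [e2 h2]; exists (HAdd e1 e2) => n a /=; rewrite h1 h2. Qed.

Lemma comp_sub f g : comp f -> comp g -> comp (fun n a => f n a - g n a).
Proof. by move=> [e1 h1] [e2 h2]; exists (HSub e1 e2) => n a /=; rewrite h1 h2. Qed.

Lemma comp_S f : comp f -> comp (fun n a => (f n a).+1).
Proof. by move=> h; apply: (comp_ext (comp_add h (comp_const_nat 1))) => n a; rewrite addn1. Qed.

Lemma comp_double f : comp f -> comp (fun n a => 2 * f n a).
Proof. by move=> h; apply: (comp_ext (comp_add h h)) => n a; rewrite mul2n addnn. Qed.

Lemma comp_if B {eB : Enc B} b (f g : forall n, A n -> B n) :
  comp b -> comp f -> comp g -> comp (fun n a => if b n a then f n a else g n a).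
Proof.
move=> [e h] [e1 h1] [e2 h2]; exists (HIf e e1 e2) => n a /=; rewrite h h1 h2 /=.
by case: (b n a).
Qed.

Lemma comp_not b : comp b -> comp (fun n a => ~~ b n a).
Proof. by move=> h; apply: (comp_if h (comp_const_bool false) (comp_const_bool true)). Qed.

Lemma comp_and b c : comp b -> comp c -> comp (fun n a => b n a && c n a).
Proof. by move=> hb hc; apply: (comp_if hb hc (comp_const_bool false)). Qed.

Lemma comp_or b c : comp b -> comp c -> comp (fun n a => b n a || c n a).
Proof. by move=> hb hc; apply: (comp_if hb (comp_const_bool true) hc). Qed.

Lemma comp_imp b c : comp b -> comp c -> comp (fun n a => b n a ==> c n a).
Proof. by move=> hb hc; apply: (comp_if hb hc (comp_const_bool true)). Qed.

Lemma comp_val (x : forall n, A n -> 'I_n) : comp x -> comp (fun n a => nat_of_ord (x n a)).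
Proof. by case=> e h; exists e. Qed.

Lemma comp_b2n b : comp b -> comp (fun n a => nat_of_bool (b n a)).
Proof. by case=> e h; exists e. Qed.

Lemma comp_mulb b f : comp b -> comp f -> comp (fun n a => b n a * f n a).
Proof.
move=> hb hf; apply: (comp_ext (comp_if hb hf (comp_const_nat 0))) => n a.
by case: (b n a); rewrite ?mul1n.
Qed.

Lemma comp_leq f g : comp f -> comp g -> comp (fun n a => f n a <= g n a).
Proof.
move=> [e1 h1] [e2 h2]; exists (HIf (HSub e1 e2) (HNum 0) (HNum 1)) => n a /=.
by rewrite h1 h2 /= subn_eq0; case: leqP.
Qed.

Lemma comp_eq_nat f g : comp f -> comp g -> comp (fun n a => f n a == g n a).
Proof.
move=> hf hg; apply: (comp_ext (comp_and (comp_leq hf hg) (comp_leq hg hf))) => n a.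
by rewrite eqn_leq.
Qed.

Lemma comp_eq_ord (x y : forall n, A n -> 'I_n) : comp x -> comp y -> comp (fun n a => x n a == y n
    a).
Proof. by move=> /comp_val hx /comp_val hy; apply: comp_eq_nat. Qed.

Lemma comp_eq_bool b c : comp b -> comp c -> comp (fun n a => b n a == c n a).
Proof.
move=> hb hc; apply: (comp_ext (comp_eq_nat (comp_b2n hb) (comp_b2n hc))) => n a.
by case: (b n a); case: (c n a).
Qed.

Lemma comp_eq_option (x y : forall n, A n -> option 'I_n) :
  comp x -> comp y -> comp (fun n a => x n a == y n a).
Proof.
pose code n (o : option 'I_n) : nat := if o is Some i then i.+1 else 0.
have hc z : comp z -> comp (fun n a => code n (z n a)) by case=> e h; exists e.
move=> /hc hx /hc hy; apply: (comp_ext (comp_eq_nat hx hy)) => n a.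
by case: (x n a) => [i|]; case: (y n a) => [j|].
Qed.

Lemma comp_min f g : comp f -> comp g -> comp (fun n a => minn (f n a) (g n a)).
Proof. by move=> hf hg; apply: (comp_if (comp_leq (comp_S hf) hg) hf hg). Qed.

Lemma comp_max f g : comp f -> comp g -> comp (fun n a => maxn (f n a) (g n a)).
Proof. by move=> hf hg; apply: (comp_if (comp_leq (comp_S hf) hg) hg hf). Qed.

Lemma comp_some (x : forall n, A n -> 'I_n) : comp x -> comp (fun n a => Some (x n a)).
Proof.
move=> hx; apply: (comp_enc_ext (comp_enc (comp_S (comp_val hx)))) => n a.
by [].
Qed.

Lemma comp_odflt (o : forall n, A n -> option 'I_n) (x : forall n, A n -> 'I_n) :
  comp o -> comp x -> comp (fun n a => odflt (x n a) (o n a)).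
Proof.
move=> [e h] [e1 h1]; exists (HIf e (HSub e (HNum 1)) e1) => n a /=; rewrite h h1 /=.
by case: (o n a) => //= i; rewrite subn1.
Qed.

End Closure.

Section Loops.
Context {A : nat -> Type} {eA : Enc A}.

Lemma comp_case_option B {eB : Enc B} (o : forall n, A n -> option 'I_n)
    (f : forall n, A n -> 'I_n -> B n) (g : forall n, A n -> B n) :
  comp o -> comp (fun n (z : A n * 'I_n) => f n z.1 z.2) -> comp g ->
  comp (fun n a => if o n a is Some x then f n a x else g n a).
Proof.
move=> [e h] [e1 h1] [e2 h2].
exists (HIf e (HComp (HPair HId (HSub e (HNum 1))) e1) e2) => n a /=; rewrite h h2 /=.
case: (o n a) => //= i; rewrite subn1 /=.
exact: (h1 n (a, i)).
Qed.

Lemma comp_foldN B {eB : Enc B} (f : forall n, A n -> B n -> nat -> B n) (g : forall n, A n -> B n)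
    :
  comp (fun n (z : A n * B n * nat) => f n z.1.1 z.1.2 z.2) -> comp g ->
  comp (fun n a => foldl (f n a) (g n a) (iota 0 n.+2)).
Proof.
move=> [e h] [e1 h1]; exists (HFor e1 e) => n a.
rewrite -[LHS]/(foldl (fun acc i => den n.+2 e (VPair (VPair (enc a) acc) (VNum i))) (den n.+2 e1
  (enc a)) (iota 0 n.+2)) h1.
by elim: (iota 0 n.+2) (g n a) => //= i s IH acc; rewrite -IH -(h n (a, acc, i)).
Qed.

Lemma foldl_const T (f : T -> T) x (s : seq nat) : foldl (fun y _ => f y) x s = iter (size s) f x.
Proof. by elim: s x => //= i s IH x; rewrite IH -iterSr. Qed.

Lemma comp_iter B {eB : Enc B} (f : forall n, A n -> B n -> B n) (g : forall n, A n -> B n) :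
  comp (fun n (z : A n * B n) => f n z.1 z.2) -> comp g ->
  comp (fun n a => iter n.+2 (f n a) (g n a)).
Proof.
move=> hf hg; apply: (comp_ext (comp_foldN (f := fun n a x i => f n a x) _ hg)) => [|n a].
  exact: (comp_ext (comp_call hf (comp_fst comp_id))).
by rewrite foldl_const size_iota.
Qed.

Lemma iter_mul T (f : T -> T) k l x : iter (k * l) f x = iter k (iter l f) x.
Proof. by elim: k => //= k IH; rewrite mulSn iterD IH. Qed.

End Loops.

Section Loops2.
Context {A : nat -> Type} {eA : Enc A}.

Lemma comp_iterX B {eB : Enc B} k (f : forall n, A n -> B n -> B n) (g : forall n, A n -> B n) :
  comp (fun n (z : A n * B n) => f n z.1 z.2) -> comp g ->
  comp (fun n a => iter (n.+2 ^ k) (f n a) (g n a)).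
Proof.
move=> hf hg; enough (h : comp (fun n (z : A n * B n) => iter (n.+2 ^ k) (f n z.1) z.2)).
  have h2 := comp_call h (comp_pair comp_id hg); exact: h2.
elim: k => [|k IH]; first exact: hf.
apply: (comp_ext (comp_iter (f := fun n (z : A n * B n) x => iter (n.+2 ^ k) (f n z.1) x) (g := fun
  n z => z.2) _ _)).
- by apply: (comp_ext (comp_call IH (comp_pair (comp_fst (comp_fst comp_id)) (comp_snd comp_id)))).
- exact: comp_snd comp_id.
by move=> n z; rewrite expnS iter_mul.
Qed.

(** An expression has no access to [n], but it can count the rounds of a loop. *)
Lemma comp_N : comp (fun n (a : A n) => n.+2).
Proof.
apply: (comp_ext (comp_iter (f := fun n a k => k.+1) (g := fun n a => 0) _ _)).
- exact: comp_S (comp_snd comp_id).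
- exact: comp_const_nat.
by move=> n _; rewrite iter_succn_0.
Qed.

Lemma comp_n : comp (fun n (a : A n) => n).
Proof. by apply: (comp_ext (comp_sub comp_N (comp_const_nat 2))) => n a; lia. Qed.

Lemma comp_NX k : comp (fun n (a : A n) => n.+2 ^ k).
Proof.
apply: (comp_ext (comp_iterX k (f := fun n a k => k.+1) (g := fun n a => 0) _ _)).
- exact: comp_S (comp_snd comp_id).
- exact: comp_const_nat.
by move=> n _; rewrite iter_succn_0.
Qed.

End Loops2.

Section Loops3.
Context {A : nat -> Type} {eA : Enc A}.

(** In the last two rounds the index is outside ['I_n], and the accumulator is kept. *)
Lemma comp_foldO B {eB : Enc B} (f : forall n, A n -> B n -> 'I_n -> B n) (g : forall n, A n -> B
    n) :
  comp (fun n (z : A n * B n * 'I_n) => f n z.1.1 z.1.2 z.2) -> comp g ->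
  comp (fun n a => foldl (f n a) (g n a) (enum 'I_n)).
Proof.
move=> [e h] hg; pose F n (a : A n) (x : B n) (i : nat) := if insub i is Some j then f n a x j else
  x.
apply: (comp_ext (comp_foldN (f := F) _ hg)) => [|n a].
  have [en hn] := @comp_n (fun n => (A n * B n * nat)%type) _.
  exists (HIf (HSub (HAdd (HSnd HId) (HNum 1)) en) (HSnd (HFst HId)) e) => n [[a x] i].
  rewrite -[LHS]/(if vnum (VNum (i + 1 - vnum (den n.+2 en (enc (a, x, i))))) != 0 then enc x else
    den n.+2 e (enc (a, x, i))).
  rewrite hn /F /=; case: insubP => [j ij e'|]; last by rewrite -leqNgt => le; case: eqP => //; lia.
  have -> : (i + 1 - n != 0) = false by apply/negbTE; rewrite negbK; apply/eqP; lia.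
  by rewrite -(h n (a, x, j)); congr (den _ _ (VPair _ (VNum _))).
have -> : n.+2 = n + 2 by lia.
rewrite iotaD foldl_cat -val_enum_ord add0n.
have -> : foldl (F n a) (g n a) (map val (enum 'I_n)) = foldl (f n a) (g n a) (enum 'I_n).
  by elim: (enum _) (g n a) => //= j s IH x; rewrite -IH /F valK.
by rewrite /= /F !insubF //; lia.
Qed.

End Loops3.

Section Derived.
Context {A : nat -> Type} {eA : Enc A}.

(** Both boolean quantifiers unfold to [FiniteQuant.quant0b], up to negations. *)
Lemma comp_quant (Q : forall n, A n -> 'I_n -> 'I_n -> FiniteQuant.quantified) :
  comp (fun n (z : A n * 'I_n) => let: FiniteQuant.Quantified F := Q n z.1 z.2 z.2 in F) ->
  comp (fun n a => FiniteQuant.quant0b (Q n a)).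
Proof.
pose P n (z : A n * 'I_n) := let: FiniteQuant.Quantified F := Q n z.1 z.2 z.2 in F.
move=> h; apply: (comp_ext (comp_foldO (f := fun n a b x => b && ~~ P n (a, x)) (g := fun n a =>
  true) _ _)).
- apply: comp_and; first exact: comp_snd (comp_fst comp_id).
  apply: comp_not; exact: (comp_ext (comp_call h (comp_pair (comp_fst (comp_fst comp_id)) (comp_snd
    comp_id)))).
- exact: comp_const_bool.
move=> n a; transitivity (true && all (fun x => ~~ P n (a, x)) (enum 'I_n)).
  apply/pred0P/allP => [H x _|H x]; first by rewrite /P /=; move: (H x) => /= ->.
  by apply/negbTE; apply: (H x); rewrite mem_enum.
by elim: (enum _) true => [|x s IH] b /=; rewrite ?andbT // -IH andbA.
Qed.

Lemma comp_sum (F : forall n, A n -> 'I_n -> nat) :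
  comp (fun n (z : A n * 'I_n) => F n z.1 z.2) -> comp (fun n a => \sum_(x < n) F n a x).
Proof.
move=> h; apply: (comp_ext (comp_foldO (f := fun n a k x => k + F n a x) (g := fun n a => 0) _ _)).
- apply: comp_add; first exact: comp_snd (comp_fst comp_id).
  exact: (comp_ext (comp_call h (comp_pair (comp_fst (comp_fst comp_id)) (comp_snd comp_id)))).
- exact: comp_const_nat.
move=> n a; have gen s b : b + \sum_(x <- s) F n a x = foldl (fun k x => k + F n a x) b s.
  by elim: s b => [|x s IH] b /=; rewrite ?big_nil ?addn0 // big_cons addnA IH.
by rewrite -gen big_enum.
Qed.

Lemma comp_bigmax (F : forall n, A n -> 'I_n -> nat) :
  comp (fun n (z : A n * 'I_n) => F n z.1 z.2) -> comp (fun n a => \max_(x < n) F n a x).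
Proof.
move=> h; apply: (comp_ext (comp_foldO (f := fun n a k x => maxn k (F n a x)) (g := fun n a => 0) _
  _)).
- apply: comp_max; first exact: comp_snd (comp_fst comp_id).
  exact: (comp_ext (comp_call h (comp_pair (comp_fst (comp_fst comp_id)) (comp_snd comp_id)))).
- exact: comp_const_nat.
move=> n a; have gen s b : maxn b (\max_(x <- s) F n a x) = foldl (fun k x => maxn k (F n a x)) b s.
  by elim: s b => [|x s IH] b /=; rewrite ?big_nil ?maxn0 // big_cons maxnA IH.
by rewrite -gen big_enum max0n.
Qed.

Lemma comp_card (P : forall n, A n -> 'I_n -> bool) :
  comp (fun n (z : A n * 'I_n) => P n z.1 z.2) -> comp (fun n a => #|[pred x | P n a x]|).
Proof.
move=> h; apply: (comp_ext (comp_sum (F := fun n a x => P n a x : nat) (comp_b2n h))) => n a.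
by rewrite -sum1_card big_mkcond; apply: eq_bigr => x _; rewrite inE /=; case: (P n a x).
Qed.

Lemma comp_pick (P : forall n, A n -> 'I_n -> bool) :
  comp (fun n (z : A n * 'I_n) => P n z.1 z.2) -> comp (fun n a => [pick x | P n a x]).
Proof.
move=> h; apply: (comp_ext (comp_foldO
  (f := fun n a (o : option 'I_n) x => if P n a x then Some (odflt x o) else o) (g := fun n a =>
    None) _ _)).
- apply: comp_if.
  + exact: (comp_ext (comp_call h (comp_pair (comp_fst (comp_fst comp_id)) (comp_snd comp_id)))).
  + apply: comp_some; apply: comp_odflt; [exact: comp_snd (comp_fst comp_id) | exact: comp_snd
      comp_id].
  + exact: comp_snd (comp_fst comp_id).
- exact: comp_none.
move=> n a; rewrite /pick /enum_mem -enumT.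
have some s y : foldl (fun o x => if P n a x then Some (odflt x o) else o) (Some y) s = Some y.
  by elim: s => //= x s IH; case: ifP.
elim: (enum _) => //= x s IH; rewrite -topredE /=; case: ifP => //= _; by rewrite some.
Qed.

(** Lists are built from their end, so the loop visits the indices through [rev_ord]. *)
Lemma comp_ffun B {eB : Enc B} (F : forall n, A n -> 'I_n -> B n) :
  comp (fun n (z : A n * 'I_n) => F n z.1 z.2) -> comp (fun n a => [ffun x => F n a x]).
Proof.
move=> [e h].
have hr : comp (fun n (x : 'I_n) => rev_ord x).
  apply: (comp_enc_ext (comp_enc (comp_sub comp_n (comp_S (comp_val comp_id))))) => n x //.
have h' : comp (fun n (z : A n * 'I_n) => enc (F n z.1 z.2) : value) by exists e.
apply: (comp_enc_ext (comp_foldO (f := fun n a w x => VPair (enc (F n a (rev_ord x))) w) (g := fun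
  n a => VNum 0) _ _)).
- apply: comp_vpair; last exact: comp_snd (comp_fst comp_id).
  exact: (comp_ext (comp_call h' (comp_pair (comp_fst (comp_fst comp_id)) (comp_call hr (comp_snd
    comp_id))))).
- by exists (HNum 0).
move=> n a; rewrite /enc /enc_ffun.
have en : enum 'I_n = rev [seq rev_ord x | x <- enum 'I_n].
  have ve : [seq nat_of_ord i | i <- enum 'I_n] = iota 0 n := val_enum_ord n.
  apply: (inj_map (@ord_inj n)); rewrite map_rev -map_comp ve.
  apply: (@eq_from_nth _ 0) => [|i]; first by rewrite size_rev size_map size_iota size_enum_ord.
  rewrite size_iota => lt; rewrite nth_rev size_map size_enum_ord // nth_iota //.
  have lt' : n - i.+1 < n by lia.
  rewrite (nth_map (Ordinal lt)) ?size_enum_ord //= nth_enum_ord //; lia.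
rewrite [in LHS]en map_rev -map_comp /enc_seq.
rewrite -(foldl_rev (fun w x => VPair x w)) revK.
elim: (enum _) (VNum 0) => //= x s IH w; rewrite IH. by rewrite ffunE.
Qed.

Lemma comp_app B {eB : Enc B} (f : forall n, A n -> {ffun 'I_n -> B n}) (x : forall n, A n -> 'I_n)
    :
  comp f -> comp x -> comp (fun n a => f n a (x n a)).
Proof.
move=> hf hx.
apply: (comp_enc_ext (comp_vfst (comp_foldN (f := fun n a w i => if i < x n a then vsnd w else w)
  (g := fun n a => enc (f n a)) _ (comp_enc hf)))).
- apply: comp_if; first apply: comp_leq.
  + exact: comp_S (comp_snd comp_id).
  + exact: (comp_ext (comp_val (comp_call hx (comp_fst (comp_fst comp_id))))).
  + exact: comp_vsnd (comp_snd (comp_fst comp_id)).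
  + exact: comp_snd (comp_fst comp_id).
move=> n a; move: (f n a) (x n a) => F y.
have drop_ s k : foldl (fun w i => if i < y then vsnd w else w) (enc_seq s) (iota 0 k) = enc_seq
    (drop (minn y k) s).
  elim: k => [|k IH]; first by rewrite minn0 drop0.
  rewrite -[in LHS]addn1 iotaD foldl_cat IH add0n /=.
  have tl r : vsnd (enc_seq r) = enc_seq (behead r) by case: r.
  case: ltnP => h; last by congr (enc_seq (drop _ _)); lia.
  by rewrite tl -drop1 drop_drop; congr (enc_seq (drop _ _)); lia.
rewrite [in RHS]/enc /enc_ffun drop_.
have -> : minn y n.+2 = y by have := ltn_ord y; lia.
rewrite (drop_nth (VNum 0)) ?size_map ?size_enum_ord //=.
by rewrite (nth_map y) ?size_enum_ord // nth_ord_enum.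
by rewrite -enumT size_enum_ord.
Qed.

Lemma comp_perm (f : forall n, A n -> 'S_n) (x : forall n, A n -> 'I_n) :
  comp f -> comp x -> comp (fun n a => f n a (x n a)).
Proof.
move=> [e h]; have hf : comp (fun n a => [ffun y => f n a y]).
  exists e => n a; rewrite h /enc /enc_ffun /enc_sym /enc_perm; congr enc_seq.
  by apply: eq_map => y; rewrite ffunE.
by move=> hx; apply: (comp_ext (comp_app hf hx)) => n a; rewrite ffunE.
Qed.

End Derived.

Lemma comp_quant4 A {eA : Enc A}
    (Q : forall n, A n -> 'I_n * 'I_n * 'I_n * 'I_n -> 'I_n * 'I_n * 'I_n * 'I_n ->
      FiniteQuant.quantified) :
  comp (fun n (z : A n * ('I_n * 'I_n * 'I_n * 'I_n)) => let: FiniteQuant.Quantified F := Q n z.1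
    z.2 z.2 in F) ->
  comp (fun n a => FiniteQuant.quant0b (Q n a)).
Proof.
pose P n (z : A n * ('I_n * 'I_n * 'I_n * 'I_n)) := let: FiniteQuant.Quantified F := Q n z.1 z.2
  z.2 in F.
move=> h; change (comp P) in h.
enough (h1 : comp (fun n a => ~~ [exists x, exists y, exists z, exists w, P n (a, (x, y, z, w))])).
  apply: (comp_ext h1) => n a; apply/pred0P/negP => [H|H [[[x y] z] w]].
    by case/existsP=> x /existsP[y /existsP[z /existsP[w]]]; move: (H (x, y, z, w)); rewrite /P /=
      => ->.
  apply/negbTE/negP => /= hP; case: H; apply/existsP; exists x; apply/existsP; exists y.
  by apply/existsP; exists z; apply/existsP; exists w.
apply: comp_not; do 4 (apply: comp_not;
  match goal with |- comp (fun n a => FiniteQuant.quant0b (@?R n a)) => refine (comp_quant (Q := R)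
    _) end;
  cbv beta iota delta [FiniteQuant.ex]).
exact: (comp_call h (comp_pair (comp_fst (comp_fst (comp_fst (comp_fst comp_id))))
  (comp_pair (comp_pair (comp_pair (comp_snd (comp_fst (comp_fst (comp_fst comp_id))))
    (comp_snd (comp_fst (comp_fst comp_id)))) (comp_snd (comp_fst comp_id))) (comp_snd comp_id)))).
Qed.

Lemma comp_call2 A {eA : Enc A} B {eB : Enc B} C {eC : Enc C} D {eD : Enc D}
    (g : forall n, B n -> C n -> D n) (x : forall n, A n -> B n) (y : forall n, A n -> C n) :
  comp (fun n (z : B n * C n) => g n z.1 z.2) -> comp x -> comp y ->
  comp (fun n a => g n (x n a) (y n a)).
Proof. by move=> h hx hy; apply: (comp_ext (comp_call h (comp_pair hx hy))). Qed.

(* Extended below with the functions already shown to be computable. *)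
Ltac comp_hook := fail.

Ltac comp_step :=
  cbv beta iota delta [FiniteQuant.all FiniteQuant.ex FiniteQuant.all_in FiniteQuant.ex_in];
  lazymatch goal with
  | |- comp (fun n a => a) => exact comp_id
  | |- comp (fun n a => n) => exact comp_n
  | |- comp (fun n a => n.+2 ^ ?k) => exact (comp_NX k)
  | |- comp (fun n a => (@?f n a).1) => refine (comp_fst (f := f) _)
  | |- comp (fun n a => (@?f n a).2) => refine (comp_snd (f := f) _)
  | |- comp (fun n a => (@?f n a, @?g n a)) => refine (comp_pair (f := f) (g := g) _ _)
  | |- comp (fun n a => @?f n a :: @?g n a) => refine (comp_cons (f := f) (g := g) _ _)
  | |- comp (fun n a => nil) => exact comp_nil
  | |- comp (fun n a => None) => exact comp_none
  | |- comp (fun n a => 0) => exact (comp_const_nat 0)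
  | |- comp (fun n a => true) => exact (comp_const_bool true)
  | |- comp (fun n a => false) => exact (comp_const_bool false)
  | |- comp (fun n a => @?f n a + @?g n a) => refine (comp_add (f := f) (g := g) _ _)
  | |- comp (fun n a => @?f n a - @?g n a) => refine (comp_sub (f := f) (g := g) _ _)
  | |- comp (fun n a => S (@?f n a)) => refine (comp_S (f := f) _)
  | |- comp (fun n a => 2 * @?f n a) => refine (comp_double (f := f) _)
  | |- comp (fun n a => nat_of_bool (@?b n a) * @?f n a) => refine (comp_mulb (b := b) (f := f) _ _)
  | |- comp (fun n a => minn (@?f n a) (@?g n a)) => refine (comp_min (f := f) (g := g) _ _)
  | |- comp (fun n a => maxn (@?f n a) (@?g n a)) => refine (comp_max (f := f) (g := g) _ _)
  | |- comp (fun n a => leq (@?f n a) (@?g n a)) => refine (comp_leq (f := f) (g := g) _ _)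
  | |- comp (fun n a => negb (@?b n a)) => refine (comp_not (b := b) _)
  | |- comp (fun n a => andb (@?b n a) (@?c n a)) => refine (comp_and (b := b) (c := c) _ _)
  | |- comp (fun n a => orb (@?b n a) (@?c n a)) => refine (comp_or (b := b) (c := c) _ _)
  | |- comp (fun n a => implb (@?b n a) (@?c n a)) => refine (comp_imp (b := b) (c := c) _ _)
  | |- comp (fun n a => nat_of_ord (@?x n a)) => refine (comp_val (x := x) _)
  | |- comp (fun n a => nat_of_bool (@?b n a)) => refine (comp_b2n (b := b) _)
  | |- comp (fun n a => @?f n a == @?g n a) =>
      first [refine (comp_eq_nat (f := f) (g := g) _ _) | refine (comp_eq_ord (x := f) (y := g) _ _)
            | refine (comp_eq_bool (b := f) (c := g) _ _) | refine (comp_eq_option (x := f) (y :=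
              g) _ _)]
  | |- comp (fun n a => Some (@?x n a)) => refine (comp_some (x := x) _)
  | |- comp (fun n a => odflt (@?x n a) (@?o n a)) => refine (comp_odflt (o := o) (x := x) _ _)
  | |- comp (fun n a => FiniteQuant.quant0b (@?Q n a)) => first [refine (comp_quant (Q := Q) _) |
    refine (comp_quant4 (Q := Q) _)]
  | |- comp (fun n a => [pick x | @?P n a x]) => refine (comp_pick (P := P) _)
  | |- comp (fun n a => #|[pred x | @?P n a x]|) => refine (comp_card (P := P) _)
  | |- comp (fun n a => \sum_x @?F n a x) => refine (comp_sum (F := F) _)
  | |- comp (fun n a => \max_x @?F n a x) => refine (comp_bigmax (F := F) _)
  | |- comp (fun n a => [ffun x => @?F n a x]) => refine (comp_ffun (F := F) _)
  | |- comp (fun n a => fun_of_fin (@?f n a) (@?x n a)) => refine (comp_app (f := f) (x := x) _ _)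
  | |- comp (fun n a => fun_of_perm (@?f n a) (@?x n a)) => refine (comp_perm (f := f) (x := x) _ _)
  | |- comp (fun n a => iter (n.+2 ^ ?k) (@?f n a) (@?g n a)) => refine (comp_iterX k (f := f) (g
    := g) _ _)
  | |- comp (fun n a => iter n.+2 (@?f n a) (@?g n a)) => refine (comp_iter (f := f) (g := g) _ _)
  | |- comp (fun n a => foldl (@?f n a) (@?g n a) (enum 'I_n)) => refine (comp_foldO (f := f) (g :=
    g) _ _)
  | |- _ => first [comp_hook | match goal with
     | H : comp _ |- _ => refine (comp_call2 H _ _)
     | H : comp _ |- _ => refine (comp_call H _)
     end | refine (comp_if _ _ _) | refine (comp_case_option _ _ _)]
  end.
Ltac comp_auto := repeat comp_step.

Lemma comp_tabulate A {eA : Enc A} B {eB : Enc B} k (f : forall n, A n -> nat -> B n) :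
  comp (fun n (z : A n * nat) => f n z.1 z.2) ->
  comp (fun n a => [seq f n a t | t <- iota 0 (n.+2 ^ k)]).
Proof.
move=> h.
apply: (comp_ext (comp_fst (comp_iterX k
  (f := fun n a (z : seq (B n) * nat) => (f n a (n.+2 ^ k - z.2.+1) :: z.1, z.2.+1))
  (g := fun n a => ([::], 0)) _ _))).
- comp_auto.
- comp_auto.
move=> n a; set K := n.+2 ^ k.
have gen j : j <= K -> iter j (fun z : seq (B n) * nat => (f n a (K - z.2.+1) :: z.1, z.2.+1))
    ([::], 0)
   = ([seq f n a t | t <- iota (K - j) j], j).
  elim: j => [//|j IH] lt; rewrite iterS IH 1?ltnW //=; congr (_ :: _, _).
  by congr (map _ (iota _ _)); lia.
by rewrite gen // subnn.
Qed.


Lemma comp_posn : comp (fun n (z : 'S_n * 'I_n) => posn z.1 z.2).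
Proof.
enough (h : comp (fun n (z : 'S_n * 'I_n) => \sum_(y < n) (z.1 y == z.2) * y)).
  apply: (comp_ext h) => n [pi x] /=.
  rewrite (bigD1 ((pi^-1)%g x)) //= permKV eqxx mul1n big1 ?addn0 // => y ne.
  by case: eqP => [e|]; rewrite ?mul0n //; rewrite -e permK eqxx in ne.
comp_auto.
Qed.

Ltac comp_hook ::= lazymatch goal with
  | |- comp (fun n a => posn (@?pi n a) (@?x n a)) => refine (comp_call (f := fun n a => (pi n a, x
    n a)) comp_posn _)
  end.

Lemma comp_F0 : comp (fun n (z : 'S_n * 'I_n) => F0 (posn z.1) (@nat_of_ord n) z.2).
Proof. rewrite /F0 /rect /inverted; comp_auto. Qed.

Lemma comp_F1 : comp (fun n (z : 'S_n * 'I_n) => F1 (posn z.1) (@nat_of_ord n) z.2).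
Proof. rewrite /F1 /rect /inverted; comp_auto. Qed.

(** * The algorithm *)

Section Algorithm.
Variables (n : nat) (pi : 'S_n).
Local Notation p := (posn pi).
Local Notation v := (@nat_of_ord n).

Local Notation auction := ({ffun 'I_n -> option 'I_n} * {ffun 'I_n -> nat})%type.
(* A state of the auction consists of the owners and of the prices. *)
Definition bid (B : rel 'I_n) (s : auction) : auction :=
  if [pick x | [forall y, s.1 y != Some x]] is Some x then
    if [pick y | [&& B x y, s.2 y <= n & [forall z, B x z ==> (s.2 y <= s.2 z)]]] is Some y then
      ([ffun w => if w == y then Some x else s.1 w],
       [ffun w => if w == y then (s.2 w).+1 else s.2 w])
    else s
  else s.
(** Each effective bid raises the sum of the prices, which is at most [n * (n + 1)]; hence the state
    is final after these rounds. *)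
Definition auctioned : auction :=
  iter (n.+2 ^ 3) (bid (pairable p v)) ([ffun=> None], [ffun=> 0]).
Definition winner x := odflt x [pick y | auctioned.1 y == Some x].
Definition owner y := odflt y (auctioned.1 y).
Definition solvable := [forall x, [exists y, auctioned.1 y == Some x]].

(** The smallest element of the orbit of [x] under [winner], used as a root of the orbit; [parity]
    is that of the number of steps from [x] to this root. *)
Definition least (x : 'I_n) : nat :=
  (iter n.+2 (fun s : 'I_n * nat => (winner s.1, minn s.2 s.1)) (x, nat_of_ord x)).2.
Definition parity (x : 'I_n) : bool :=
  (iter n.+2 (fun s : 'I_n * bool => if least s.1 == s.1 then s else (winner s.1, ~~ s.2))
     (x, false)).2.
(* Nontrivial orbits of [winner] have even length by [pairable_bipartite], so that
   pairing alternate elements makes an involution of it. *)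
Definition partner x := if parity x then winner x else owner x.

Definition first_marks := [ffun c => mark0 p v partner c].
Definition marks := [ffun c => sorted_mark p v first_marks c].

(* Starting from 0, the iterates stay below every nonnegative solution of
   [Y b = X a + weight a b], and [admissible_drawable] provides a bounded one. *)
Definition relax (s : {ffun 'I_n -> nat} * {ffun 'I_n -> nat}) :=
  ([ffun a => maxn (s.1 a) (\max_b (if inverted p v a b then s.2 b - weight p v marks a b else 0))],
   [ffun b => maxn (s.2 b) (\max_a (if inverted p v a b then s.1 a + weight p v marks a b else
     0))]).
(** A round that changes something raises a sum bounded by [8 * n ^ 3]. The same power serves as the
    number of [frames], so the duration exceeds [16 * n ^ 2 + 5 * n + 5]. *)
Definition relaxed := iter (n.+2 ^ 6) relax ([ffun=> 0], [ffun=> 0]).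

Definition frame (t : nat) := [ffun q : 'I_n => odflt q [pick x |
  place pi (cntR p v) (cntL p v) (startR pi marks relaxed.1) (startL pi marks relaxed.2) x t == q]].
Definition frames := [seq frame t | t <- iota 0 (n.+2 ^ 6)].
End Algorithm.

(** * Computability of the algorithm *)

Ltac hook_F1 := first [lazymatch goal with
  | |- comp (fun n a => posn (@?pi n a) (@?x n a)) => refine (comp_call (f := fun n a => (pi n a, x
    n a)) comp_posn _)
  | |- comp (fun n a => F0 (posn (@?pi n a)) _ (@?x n a)) => refine (comp_call (f := fun n a => (pi
    n a, x n a)) comp_F0 _)
  | |- comp (fun n a => F1 (posn (@?pi n a)) _ (@?x n a)) => refine (comp_call (f := fun n a => (pi
    n a, x n a)) comp_F1 _)
  end].
Ltac comp_hook ::= hook_F1.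

Lemma comp_cell : comp (fun n (z : 'S_n * ('I_n * 'I_n * 'I_n * 'I_n)) => cell (posn z.1)
    (@nat_of_ord n) z.2).
Proof. rewrite /cell /next_record /next_minimum /qa /qa' /qb /qb' /inverted; comp_auto. Qed.
Lemma comp_low : comp (fun n (z : 'S_n * ('I_n * 'I_n * 'I_n * 'I_n) * 'I_n) => low (posn z.1.1)
    (@nat_of_ord n) z.1.2 z.2).
Proof. rewrite /low /qa /qa' /qb /qb' /inverted; comp_auto. Qed.
Lemma comp_high : comp (fun n (z : 'S_n * ('I_n * 'I_n * 'I_n * 'I_n) * 'I_n) => high (posn z.1.1)
    (@nat_of_ord n) z.1.2 z.2).
Proof. rewrite /high /qa /qa' /qb /qb' /inverted; comp_auto. Qed.

Ltac hook_high := first [hook_F1 | lazymatch goal with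
  | |- comp (fun n a => cell (posn (@?pi n a)) _ (@?x n a)) => refine (comp_call (f := fun n a =>
    (pi n a, x n a)) comp_cell _)
  | |- comp (fun n a => low (posn (@?pi n a)) _ (@?u n a) (@?x n a)) =>
      refine (comp_call (f := fun n a => (pi n a, u n a, x n a)) comp_low _)
  | |- comp (fun n a => high (posn (@?pi n a)) _ (@?u n a) (@?x n a)) =>
      refine (comp_call (f := fun n a => (pi n a, u n a, x n a)) comp_high _)
  end].
Ltac comp_hook ::= hook_high.

Lemma comp_pairable : comp (fun n (z : 'S_n * 'I_n * 'I_n) => pairable (posn z.1.1) (@nat_of_ord n)
    z.1.2 z.2).
Proof. rewrite /pairable /up /ok0 /ok1 /in_high /in_low; comp_auto. Qed.

Ltac hook_pairable := first [hook_high | lazymatch goal with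
  | |- comp (fun n a => pairable (posn (@?pi n a)) _ (@?x n a) (@?y n a)) =>
      refine (comp_call (f := fun n a => (pi n a, x n a, y n a)) comp_pairable _)
  end].
Ltac comp_hook ::= hook_pairable.

Lemma comp_auctioned : comp (fun n (pi : 'S_n) => auctioned pi).
Proof. rewrite /auctioned /bid; comp_auto. Qed.
Ltac hook_auctioned := first [hook_pairable | lazymatch goal with
  | |- comp (fun n a => auctioned (@?pi n a)) => refine (comp_call (f := pi) comp_auctioned _)
  end].
Ltac comp_hook ::= hook_auctioned.

Lemma comp_winner : comp (fun n (z : 'S_n * 'I_n) => winner z.1 z.2).
Proof. rewrite /winner; comp_auto. Qed.
Lemma comp_owner : comp (fun n (z : 'S_n * 'I_n) => owner z.1 z.2).
Proof. rewrite /owner; comp_auto. Qed.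
Lemma comp_solvable : comp (fun n (pi : 'S_n) => solvable pi).
Proof. rewrite /solvable; comp_auto. Qed.
Ltac hook_solvable := first [hook_auctioned | lazymatch goal with
  | |- comp (fun n a => winner (@?pi n a) (@?x n a)) => refine (comp_call (f := fun n a => (pi n a,
    x n a)) comp_winner _)
  | |- comp (fun n a => owner (@?pi n a) (@?x n a)) => refine (comp_call (f := fun n a => (pi n a,
    x n a)) comp_owner _)
  | |- comp (fun n a => solvable (@?pi n a)) => refine (comp_call (f := pi) comp_solvable _)
  end].
Ltac comp_hook ::= hook_solvable.

Lemma comp_least : comp (fun n (z : 'S_n * 'I_n) => least z.1 z.2).
Proof. rewrite /least; comp_auto. Qed.
Ltac hook_least := first [hook_solvable | lazymatch goal with
  | |- comp (fun n a => least (@?pi n a) (@?x n a)) => refine (comp_call (f := fun n a => (pi n a,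
    x n a)) comp_least _)
  end].
Ltac comp_hook ::= hook_least.

Lemma comp_parity : comp (fun n (z : 'S_n * 'I_n) => parity z.1 z.2).
Proof. rewrite /parity; comp_auto. Qed.
Ltac hook_parity := first [hook_least | lazymatch goal with
  | |- comp (fun n a => parity (@?pi n a) (@?x n a)) => refine (comp_call (f := fun n a => (pi n a,
    x n a)) comp_parity _)
  end].
Ltac comp_hook ::= hook_parity.

Lemma comp_partner : comp (fun n (z : 'S_n * 'I_n) => partner z.1 z.2).
Proof. rewrite /partner; comp_auto. Qed.
Ltac hook_partner := first [hook_parity | lazymatch goal with
  | |- comp (fun n a => partner (@?pi n a) (@?x n a)) => refine (comp_call (f := fun n a => (pi n
    a, x n a)) comp_partner _)
  end].
Ltac comp_hook ::= hook_partner.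

Lemma comp_first_marks : comp (fun n (pi : 'S_n) => first_marks pi).
Proof. rewrite /first_marks /mark0 /ok0 /in_high; comp_auto. Qed.
Ltac hook_first_marks := first [hook_partner | lazymatch goal with
  | |- comp (fun n a => first_marks (@?pi n a)) => refine (comp_call (f := pi) comp_first_marks _)
  end].
Ltac comp_hook ::= hook_first_marks.

Lemma comp_marks : comp (fun n (pi : 'S_n) => marks pi).
Proof. rewrite /marks /sorted_mark /twin /unforced; comp_auto. Qed.
Ltac hook_marks := first [hook_first_marks | lazymatch goal with
  | |- comp (fun n a => marks (@?pi n a)) => refine (comp_call (f := pi) comp_marks _)
  end].
Ltac comp_hook ::= hook_marks.

Lemma comp_relaxed : comp (fun n (pi : 'S_n) => relaxed pi).
Proof. rewrite /relaxed /relax /weight /passes /mid /inverted; comp_auto. Qed.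
Ltac hook_relaxed := first [hook_marks | lazymatch goal with
  | |- comp (fun n a => relaxed (@?pi n a)) => refine (comp_call (f := pi) comp_relaxed _)
  end].
Ltac comp_hook ::= hook_relaxed.

Lemma comp_frame : comp (fun n (z : 'S_n * nat) => frame z.1 z.2).
Proof. rewrite /frame /place /startR /startL /cntR /cntL /cntN /inverted /ascending; comp_auto. Qed.

Lemma comp_frames : comp (fun n (pi : 'S_n) => frames pi).
Proof. exact: comp_tabulate comp_frame. Qed.

Definition answer n (pi : 'S_n) : value := if solvable pi then VPair (VNum 1) (enc (frames pi))
    else VNum 0.

Lemma comp_answer : comp (@answer).
Proof.
have num k : @comp (fun n => 'S_n) (fun=> value) _ _ (fun n _ => VNum k) by exists (HNum k).
exact: (comp_if comp_solvable (comp_vpair (num 1) (comp_enc comp_frames)) (num 0)).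
Qed.

(** * Correctness of the algorithm *)

Lemma iter_invariant T (I : T -> Prop) (f : T -> T) k x :
  (forall s, I s -> I (f s)) -> I x -> I (iter k f x).
Proof. by move=> If Ix; elim: k => //= k /If. Qed.

Lemma iter_stable T (I : T -> Prop) (f : T -> T) (mu : T -> nat) M k x :
  (forall s, I s -> I (f s)) -> (forall s, I s -> f s = s \/ mu s < mu (f s)) ->
  (forall s, I s -> mu s <= M) -> I x -> M < k -> f (iter k f x) = iter k f x.
Proof.
move=> If prog bd Ix lt.
suff [//|] : f (iter k f x) = iter k f x \/ k <= mu (iter k f x).
  by have := bd _ (iter_invariant k If Ix); lia.
elim: k {lt} => [|k IH]; first by right.
have [e|h] := IH; first by left; rewrite /= e.
have [e|h'] := prog _ (iter_invariant k If Ix); first by left; rewrite /= e.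
by right; rewrite /=; apply: leq_ltn_trans h h'.
Qed.

Section Auction.
Variables (n : nat) (B : rel 'I_n).
Local Notation auction := ({ffun 'I_n -> option 'I_n} * {ffun 'I_n -> nat})%type.
Record legal (s : auction) : Prop := Legal {
  legal_edge : forall y z, s.1 y = Some z -> B z y;
  legal_price : forall y z, s.1 y = Some z -> forall y', B z y' -> s.2 y <= (s.2 y').+1;
  legal_free : forall y, s.1 y = None -> s.2 y = 0;
  legal_inj : forall y y' z, s.1 y = Some z -> s.1 y' = Some z -> y = y';
  legal_bound : forall y, s.2 y <= n.+1 }.

Variant bid_spec (s : auction) : auction -> Prop :=
| BidDone of (forall x, exists y, s.1 y = Some x) : bid_spec s s
| BidStuck x of (forall y, s.1 y != Some x) & (forall y, B x y -> n < s.2 y) : bid_spec s s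
| BidStep x y of (forall z, s.1 z != Some x) & B x y & s.2 y <= n & (forall z, B x z -> s.2 y <=
  s.2 z) :
    bid_spec s ([ffun w => if w == y then Some x else s.1 w], [ffun w => if w == y then (s.2 w).+1
      else s.2 w]).

Lemma bidP s : bid_spec s (bid B s).
Proof.
rewrite /bid; case: pickP => [x /forallP fx|none]; last first.
  apply: BidDone => x; have /negbT := none x; rewrite negb_forall => /existsP[y /negPn/eqP]; by
    exists y.
case: pickP => [y /and3P[xy le /forallP mn]|none].
  by apply: BidStep => // z xz; move: (mn z); rewrite xz.
apply: (BidStuck (x := x)) => // y xy; rewrite ltnNge; apply/negP => le.
pose P := [pred z | B x z].
have Py : P y by [].
case: (arg_minnP (fun z => s.2 z) Py) => z Pz mz.
have := none z; rewrite (Pz : B x z) (leq_trans (mz y Py) le) /= => /negP[].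
by apply/forallP => w; apply/implyP; apply: mz.
Qed.

Lemma legal_bid s : legal s -> legal (bid B s).
Proof.
case: bidP => // x y fx xy le mn [H1 H2 H3 H4 H5]; split=> [w z|w z|w|w w' z|w] /=; rewrite ?ffunE.
- by case: eqP => [-> [<-]|_ /H1].
- case: eqP => [-> [<-] w' xw'|_ wz w' zw']; rewrite ffunE.
    by have := mn w' xw'; case: eqP => _; lia.
  by have := H2 _ _ wz w' zw'; case: eqP => _; lia.
- by case: eqP => // _ /H3.
- case: eqP => [->|_]; case: eqP => [->|_] //.
  + by move=> [<-] h; move: (fx w'); rewrite h eqxx.
  + by move=> h [e]; move: (fx w); rewrite h e eqxx.
  exact: H4.
by have := H5 w; case: eqP => [->|] //; lia.
Qed.

Lemma bid_progress s : bid B s = s \/ \sum_w s.2 w < \sum_w (bid B s).2 w.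
Proof.
case: bidP => [|x|x y _ _ _ _]; [by left|by left|right].
rewrite (bigD1 y) //= [X in _ < X](bigD1 y) //= ffunE eqxx addSn ltnS leq_add2l.
by apply: leq_sum => w ne; rewrite ffunE (negbTE ne).
Qed.

Definition auction_start : auction := ([ffun=> None], [ffun=> 0]).
Definition auction_end := iter (n.+2 ^ 3) (bid B) auction_start.

Lemma legal_end : legal auction_end.
Proof. by apply: iter_invariant legal_bid _; split=> [y z|y z|y|y y' z|y]; rewrite !ffunE. Qed.

(** The number of rounds suffices to reach a fixed state. There, either everybody is served or a
    bidder finds every acceptable price above [n], and [auction_failure] applies. *)
Lemma auctionP : (forall x, exists y, auction_end.1 y = Some x) \/
  forall tau : 'I_n -> 'I_n, injective tau -> ~ forall z, B z (tau z).
Proof.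
have fixed : bid B auction_end = auction_end.
  apply: (@iter_stable _ legal _ (fun s => \sum_w s.2 w) (n * n.+1)).
  - exact: legal_bid.
  - by move=> s _; apply: bid_progress.
  - move=> s [_ _ _ _ H5]; have : \sum_w s.2 w <= \sum_(w < n) n.+1 by apply: leq_sum => w _.
    by rewrite sum_nat_const card_ord.
  - by split=> [y z|y z|y|y y' z|y]; rewrite !ffunE.
  by rewrite !expnS expn0; nia.
have [H1 H2 H3 H4 H5] := legal_end.
case: bidP fixed => [H _|x fx stuck _|x y fx xy le mn]; first by left.
  right=> tau ti tB; apply: (auction_failure H2 H3 H4 fx _ ti tB) => y; rewrite card_ord; exact:
    stuck.
move=> e; move: (fx y); rewrite -{1}e /= ffunE eqxx; by rewrite eqxx.
Qed.
End Auction.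

Section Orbit.
Variables (n : nat) (f : 'I_n -> 'I_n).
Hypothesis fI : injective f.

Definition orbit_min (x : 'I_n) : nat :=
  (iter n.+2 (fun s : 'I_n * nat => (f s.1, minn s.2 s.1)) (x, nat_of_ord x)).2.

Lemma findex_lt x y : fconnect f x y -> findex f x y < n.
Proof.
move=> xy; apply: leq_trans (findex_max xy) _.
by rewrite -[leqRHS]card_ord; apply: max_card.
Qed.

Lemma orbit_minP x : (forall y, fconnect f x y -> orbit_min x <= y) /\
  exists2 y, fconnect f x y & orbit_min x = y.
Proof.
have gen k : let s := iter k (fun s : 'I_n * nat => (f s.1, minn s.2 s.1)) (x, nat_of_ord x) in
  [/\ s.1 = iter k f x, forall j, j < k -> s.2 <= iter j f x & exists2 y, fconnect f x y & s.2 = y].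
  elim: k => /= [|k [-> le [y xy e]]]; first by split=> //; exists x.
  split=> // [j|].
    by rewrite ltnS leq_eqVlt => /orP[/eqP->|/le]; rewrite geq_min ?leqnn ?orbT // => ->.
  rewrite e; case: (leqP y (iter k f x)) => h; first by exists y => //; lia.
  by exists (iter k f x); [apply: fconnect_iter | lia].
have [_ le ex] := gen n.+2; split=> // y xy.
rewrite -(iter_findex xy); apply: le; have := findex_lt xy; lia.
Qed.

Lemma orbit_min_inv x : orbit_min (f x) = orbit_min x.
Proof.
have [le [y xy e]] := orbit_minP x; have [le' [y' xy' e']] := orbit_minP (f x).
have sym := fconnect_sym fI.
have fx : fconnect f x (f x) by apply: fconnect1.
apply/eqP; rewrite eqn_leq; apply/andP; split.
  by rewrite e; apply: le'; apply: connect_trans xy; rewrite sym.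
by rewrite e'; apply: le; apply: connect_trans xy'.
Qed.

Definition trail (x : 'I_n) (b : bool) k :=
  iter k (fun s : 'I_n * bool => if orbit_min s.1 == s.1 then s else (f s.1, ~~ s.2)) (x, b).

(** A step flips both the bit and the colour, so their sum is invariant; the orbit minimum is met in
    fewer than [n] steps. *)
Lemma trail_end (zeta : 'I_n -> bool) x b : (forall y, f y != y -> zeta (f y) = ~~ zeta y) ->
  let s := trail x b n.+2 in nat_of_ord s.1 = orbit_min x /\ s.2 (+) zeta s.1 = b (+) zeta x.
Proof.
move=> flip; rewrite /trail.
have gen k : let s := trail x b k in
  [/\ orbit_min s.1 = orbit_min x, s.2 (+) zeta s.1 = b (+) zeta x &
      orbit_min s.1 = s.1 \/ s.1 = iter k f x /\ forall j, j < k -> orbit_min x <> iter j f x].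
  elim: k => [|k [e1 e2 h]]; first by split=> //; right.
  rewrite /trail iterS -/(trail x b k) /=; case: eqP => e; first by split=> //; left.
  case: h => [//|[h1 h2]]; split=> /=; first by rewrite orbit_min_inv.
    rewrite flip; first by rewrite addNb addbN negbK.
    apply/eqP => ef; apply: e.
    have fix_ j : iter j f (trail x b k).1 = (trail x b k).1 by elim: j => //= j ->.
    have [le [y xy ->]] := orbit_minP (trail x b k).1.
    by rewrite -(iter_findex xy) fix_.
  right; rewrite h1; split=> // j; rewrite ltnS leq_eqVlt => /orP[/eqP-> e'|/h2//].
  by apply: e; rewrite e1 h1.
have [e1 e2 h] := gen n.+2; split=> //; case: h => [<-//|[_ h]].
have [_ [y xy e]] := orbit_minP x; case: (h (findex f x y)); last by rewrite iter_findex.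
have := findex_lt xy; lia.
Qed.

Lemma trail_flip (zeta : 'I_n -> bool) x : (forall y, f y != y -> zeta (f y) = ~~ zeta y) ->
  f x != x -> (trail (f x) false n.+2).2 = ~~ (trail x false n.+2).2.
Proof.
move=> flip ne; have [a1 a2] := trail_end x false flip; have [b1 b2] := trail_end (f x) false flip.
have e : (trail (f x) false n.+2).1 = (trail x false n.+2).1 by apply: ord_inj; rewrite a1 b1
    orbit_min_inv.
move: a2 b2; rewrite e (flip x ne); move: (trail x _ _) (trail (f x) _ _) => [r c] [r' d] /=.
by case: (zeta r) (zeta x) c d => [] [] [] [].
Qed.
End Orbit.

Lemma ffun_leq_sum n (f g : {ffun 'I_n -> nat}) :
  (forall x, f x <= g x) -> f = g \/ \sum_x f x < \sum_x g x.
Proof.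
move=> le; case: (altP (@forallP _ (fun x => f x == g x))) => [H|].
  by left; apply/ffunP => x; apply/eqP.
rewrite negb_forall => /existsP[x ne]; right.
rewrite (bigD1 x) //= [X in _ < X](bigD1 x) //= -addSn leq_add //; last by apply: leq_sum.
by rewrite ltn_neqAle ne le.
Qed.

Lemma admissible_ext (T : finType) (p v : T -> nat) m m' :
  m =1 m' -> admissible p v m -> admissible p v m'.
Proof.
move=> e [H0 H1 Hc]; split=> [c|c|u cu]; rewrite -?e; [exact: H0|exact: H1|].
transitivity #|[pred c | low p v u c && m c]|; first by apply: eq_card => c; rewrite !inE e.
by rewrite Hc //; apply: eq_card => c; rewrite !inE e.
Qed.

Section Correctness.
Variables (n : nat) (pi : 'S_n).
Local Notation p := (posn pi).
Local Notation v := (@nat_of_ord n).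
Let pI : injective p := @posn_inj n pi.
Let vI : injective v := @ord_inj n.

Lemma partnerP : (forall x, exists y, (auctioned pi).1 y = Some x) ->
  involutive (partner pi) /\ forall c, pairable p v c (partner pi c).
Proof.
move=> own_all; have [H1 _ _ H4 _] : legal (pairable p v) (auctioned pi) := legal_end _.
have own_win x : (auctioned pi).1 (winner pi x) = Some x.
  rewrite /winner; case: pickP => [y /eqP //|none].
  by have [y e] := own_all x; move: (none y); rewrite e eqxx.
have winK x : owner pi (winner pi x) = x by rewrite /owner own_win.
have wI : injective (winner pi) := can_inj winK.
have ownK y : winner pi (owner pi y) = y by have [g _ Kg] := injF_bij wI; rewrite -{1}(Kg y) winK
    Kg.
have win_pair x : pairable p v x (winner pi x) by apply: H1.
have pair_sym c d : pairable p v c d -> pairable p v d c.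
  rewrite /pairable => /or3P[->|->|/andP[/eqP-> ->]]; rewrite ?orbT ?eqxx ?orbT //.
have [zeta zP] := pairable_bipartite pI vI.
have flip y : winner pi y != y -> zeta (winner pi y) = ~~ zeta y.
  move=> ne; have := win_pair y; rewrite /pairable eq_sym (negbTE ne) orbF.
  by case/orP=> /zP -> //; rewrite negbK.
have par_flip x : winner pi x != x -> parity pi (winner pi x) = ~~ parity pi x.
  exact: (trail_flip wI flip).
split=> c; last first.
  rewrite /partner; case: ifP => _ //.
  by apply: pair_sym; rewrite -{2}(ownK c).
rewrite {2}/partner; case: ifP => pc.
  case: (eqVneq (winner pi c) c) => e; first by rewrite e /partner pc.
  by rewrite /partner par_flip // pc /= winK.
case: (eqVneq (owner pi c) c) => e; first by rewrite e /partner pc.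
have e' : winner pi (owner pi c) != owner pi c by rewrite ownK eq_sym.
have := par_flip _ e'; rewrite ownK pc /partner => /esym/negbFE ->.
by rewrite ownK.
Qed.

Lemma marksP : solvable pi -> admissible p v (marks pi) /\ monotone p v (marks pi).
Proof.
move=> /forallP own_all.
have own x : exists y, (auctioned pi).1 y = Some x by have /existsP[y /eqP] := own_all x; exists y.
have [tK tp] := partnerP own.
have a0 : admissible p v (first_marks pi).
  have e0 : mark0 p v (partner pi) =1 first_marks pi by move=> c; rewrite ffunE.
  exact: admissible_ext e0 (mark0_admissible pI vI tK tp).
have ext : sorted_mark p v (first_marks pi) =1 marks pi by move=> c; rewrite ffunE.
split; first exact: admissible_ext ext (sorted_admissible vI a0).
by move=> c d cd; rewrite -!ext; apply: sorted_monotone cd.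
Qed.

Lemma relaxedP : admissible p v (marks pi) ->
  (forall a b, inverted p v a b -> (relaxed pi).2 b = (relaxed pi).1 a + weight p v (marks pi) a b)
    /\
  forall x, (relaxed pi).1 x <= 4 * n * n /\ (relaxed pi).2 x <= 4 * n * n.
Proof.
move=> /(admissible_drawable pI vI)[x [y []]]; rewrite card_ord => xy bx by_.
pose c : int := (2 * n * n)%N.
pose X a := `|(x a + c)%R|%N; pose Y b := `|(y b + c)%R|%N.
have XE a : (X a : int) = (x a + c)%R by rewrite /X; have := bx a; lia.
have YE a : (Y a : int) = (y a + c)%R by rewrite /Y; have := by_ a; lia.
have XY a b : inverted p v a b -> Y b = X a + weight p v (marks pi) a b.
  by move=> /xy; have := XE a; have := YE b; lia.
have XB a : X a <= 4 * n * n by have := bx a; have := XE a; rewrite /c; lia.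
have YB a : Y a <= 4 * n * n by have := by_ a; have := YE a; rewrite /c; lia.
pose I (s : {ffun 'I_n -> nat} * {ffun 'I_n -> nat}) := (forall a, s.1 a <= X a) /\ (forall b, s.2
  b <= Y b).
have I0 : I ([ffun=> 0], [ffun=> 0]) by split=> a; rewrite ffunE.
have If s : I s -> I (relax pi s).
  move=> [h1 h2]; split=> a; rewrite ffunE geq_max ?h1 ?h2 /=; apply/bigmax_leqP => b _;
    case: ifP => // /XY e; first by rewrite leq_subLR addnC -e h2.
  by rewrite e leq_add2r h1.
have fixed : relax pi (relaxed pi) = relaxed pi.
  apply: (@iter_stable _ I _ (fun s => \sum_a s.1 a + \sum_a s.2 a) (n * (4 * n * n) + n * (4 * n *
    n))) => //.
  - move=> s _; have l1 a : s.1 a <= (relax pi s).1 a by rewrite ffunE leq_maxl.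
    have l2 a : s.2 a <= (relax pi s).2 a by rewrite ffunE leq_maxl.
    have [e1|h1] := ffun_leq_sum l1; have [e2|h2] := ffun_leq_sum l2.
    + by left; rewrite [LHS]surjective_pairing -e1 -e2; case: (s).
    + by right; rewrite e1 ltn_add2l.
    + by right; rewrite e2 ltn_add2r.
    by right; apply: (leq_trans (n := (\sum_a (relax pi s).1 a) + \sum_a s.2 a)); rewrite
      ?ltn_add2r // leq_add2l ltnW.
  - move=> s [h1 h2].
    have s1 : \sum_a s.1 a <= \sum_(a < n) 4 * n * n by apply: leq_sum => a _; apply: leq_trans (h1
        a) (XB a).
    have s2 : \sum_a s.2 a <= \sum_(a < n) 4 * n * n by apply: leq_sum => a _; apply: leq_trans (h2
        a) (YB a).
    by rewrite !sum_nat_const card_ord in s1 s2; apply: leq_add.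
  have -> : n.+2 ^ 6 = (n.+2 * n.+2 * n.+2) * (n.+2 * n.+2 * n.+2) by rewrite !expnS expn0; lia.
  have h : 8 <= n.+2 * n.+2 * n.+2 by nia.
  have h' : n * n * n < n.+2 * n.+2 * n.+2 by nia.
  have -> : n * (4 * n * n) + n * (4 * n * n) = 8 * (n * n * n) by nia.
  by apply: leq_trans (leq_mul h (leqnn _)); rewrite ltn_pmul2l.
have [h1 h2] : I (relaxed pi) by apply: iter_invariant.
split=> [a b ab|a]; last by split; [apply: leq_trans (h1 a) _ | apply: leq_trans (h2 a) _].
(* Each component of the fixed point equation gives one of the two inequalities. *)
have eY : (relaxed pi).1 a + weight p v (marks pi) a b <= (relaxed pi).2 b.
  rewrite -[in leqRHS]fixed [leqRHS]ffunE leq_max; apply/orP; right.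
  apply: leq_trans (leq_bigmax a); by rewrite ab.
have eX : (relaxed pi).2 b - weight p v (marks pi) a b <= (relaxed pi).1 a.
  rewrite -[in leqRHS]fixed [leqRHS]ffunE leq_max; apply/orP; right.
  apply: leq_trans (leq_bigmax b); by rewrite ab.
lia.
Qed.

Lemma frames_perfect : solvable pi ->
  exists2 T : seq 'S_n, enc (frames pi) = enc_tangle T & perfect_tangle pi T.
Proof.
move=> /marksP[adm mono]; have [XY bd] := relaxedP adm.
set M := n.+2 ^ 6.
have big : 16 * n * n + 5 * n + 5 < M.-1.
  have -> : M = (n.+2 * n.+2 * n.+2 * n.+2) * (n.+2 * n.+2) by rewrite /M !expnS expn0; lia.
  have h : 16 <= n.+2 * n.+2 * n.+2 * n.+2 by nia.
  have := leq_mul h (leqnn (n.+2 * n.+2)); move: (_ * _ * _ * _ * _) => q; nia.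
have [|//|T [sT TE perf]] := realize mono XY (K := M.-1) _ _.
  by move=> x; have [] := bd x; lia.
exists T => //; have M0 : M.-1.+1 = M by lia.
rewrite M0 in sT.
rewrite /enc_tangle -(mkseq_nth 1%g T) /mkseq sT -map_comp.
rewrite /enc /enc_list /frames -map_comp; congr enc_seq; apply/eq_in_map => t.
rewrite mem_iota add0n -/M => lt /=; rewrite /enc /enc_ffun /enc_perm; congr enc_seq.
apply: eq_map => q; rewrite ffunE; congr VNum.
have le : t <= M.-1 by lia.
case: pickP => [x /eqP|none] /=.
  rewrite -TE // => /ord_inj /=; by move=> <-; rewrite permKV.
have := none (nth 1%g T t q); rewrite -TE // /posn /at_time permK eqxx //.
Qed.

(** The marking of a perfect tangle yields a permutation along [pairable], so the auction cannot
    fail. *)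
Lemma perfect_solvable : perfect pi -> solvable pi.
Proof.
case=> T perfT.
have adm := drawable_admissible pI vI (mark_monotone perfT) (mark_drawable perfT).
have [tau ti tp] := admissible_pairing pI vI adm.
have [own|no] := auctionP (pairable p v); last by case: (no tau ti tp).
by apply/forallP => x; have [y e] := own x; apply/existsP; exists y; apply/eqP.
Qed.
End Correctness.

Theorem theorem2 :
  exists (p : program) (c k : nat),
    forall (n : nat) (pi : 'S_n),
      exists (output : value) (t : nat),
        [/\ runs p (enc_perm pi) output t,
            t <= c * n ^ k + c &
            (exists2 T : seq 'S_n, output = answer_yes T & perfect_tangle pi T)
            \/ (output = answer_no /\ ~ perfect pi)].
Proof.
have [e he] := comp_answer; have [c [k hc]] := cost_poly e.
exists (start :: compile e 1), (c + 40), k => n pi.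
have [t run le] := run_compile e [seq VNum (pi x) | x <- enum 'I_n].
rewrite size_map size_enum_ord in run le.
exists (answer pi), t; split.
- by have <- : den n.+2 e (enc_perm pi) = answer pi := he n pi.
- have := hc n; rewrite mulnDl; lia.
rewrite /answer; case: ifP => [/frames_perfect[T e1 perf]|/negP no]; [left | right].
  by exists T; rewrite // /answer_yes e1.
by split=> // /perfect_solvable.
Qed.
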